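(* Let $Q$ be a Dynkin quiver and let $X,M,N\in\mathcal{D}^b(Q)$ with $\mathbf{dim}\,M=\mathbf{dim}\,N$. Then $$\langle X,N\rangle-\langle X,M\rangle=\langle N,\tau X\rangle-\langle M,\tau X\rangle.$$
   Context: $\Bbbk$ is an algebraically closed field; $Q$ is a quiver whose underlying graph is Dynkin of type $\mathbb{A}$, $\mathbb{D}$ or $\mathbb{E}$; $\mathcal{D}^b(Q)$ is the bounded derived category of the category of finite dimensional representations of $Q$ over $\Bbbk$, with shift $[1]$. $\mathbf{dim}\,X\in\mathbb{Z}^{Q_0}\cong K_0(\mathcal{D}^b(Q))$ is the class of $X$ in the Grothendieck group (extending the dimension vector). $[X,Y]^i=\dim_\Bbbk\mathrm{Hom}_{\mathcal{D}^b(Q)}(X,Y[i])$ and $\langle X,Y\rangle=\sum_{i\le0}(-1)^i[X,Y]^i$. $\nu$ is the Serre functor of $\mathcal{D}^b(Q)$, i.e. an auto-equivalence with natural isomorphisms $\mathrm{Hom}(Y,\nu X)\simeq\mathrm{Hom}_\Bbbk(\mathrm{Hom}(X,Y),\Bbbk)$, and $\tau=\nu\circ[-1]$ is the Auslander–Reiten translation. *)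

(* Defs.v *)
From HB Require Import structures.
From mathcomp Require Import all_boot all_order all_algebra generic_quotient.
From mathcomp Require Import boolp classical_sets fsbigop.

Set Implicit Arguments.
Unset Strict Implicit.
Unset Printing Implicit Defensive.
Import Order.TTheory GRing.Theory Num.Theory.
Local Open Scope quotient_scope.
Local Open Scope ring_scope.

(* [dimk V] is the dimension of [V], with the junk value 0 when [V] is not
   finite dimensional. *)
Definition dimk (k : fieldType) (V : lmodType k) : nat :=
  xget 0%N [set n | exists f : {linear V -> 'rV[k]_n}, bijective f]%classic.

Section LinearFamilies.
Variables (k : fieldType) (I : Type) (V : I -> lmodType k).
Implicit Type P : (forall i, V i) -> Prop.

Definition lin_closed P : Prop :=
  P (fun=> 0) /\ forall a f g, P f -> P g -> P (fun i => a *: f i + g i).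

Record linfam P (hP : lin_closed P) := LinFam {
  fam :> forall i, V i;
  famP : P fam }.

Variables (P : (forall i, V i) -> Prop) (hP : lin_closed P).
Local Notation F := (linfam hP).

Lemma linfamE (f g : F) : (forall i, f i = g i) -> f = g.
Proof.
case: f g => [f pf] [g pg] /= fg; have e : f = g by apply: functional_extensionality_dep.
by case: _ / e pg => pg; rewrite (Prop_irrelevance pf pg).
Qed.

Lemma lin_closedD f g : P f -> P g -> P (fun i => f i + g i).
Proof.
move=> pf pg; have := hP.2 1 f g pf pg.
by congr P; apply: functional_extensionality_dep => i; rewrite scale1r.
Qed.

Lemma lin_closedZ a f : P f -> P (fun i => a *: f i).
Proof.
move=> pf; have := hP.2 a f _ pf hP.1.
by congr P; apply: functional_extensionality_dep => i; rewrite addr0.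
Qed.

Lemma lin_closedN f : P f -> P (fun i => - f i).
Proof.
move=> pf; have := lin_closedZ (-1) pf.
by congr P; apply: functional_extensionality_dep => i; rewrite scaleN1r.
Qed.

Definition linfam0 : F := LinFam hP hP.1.
Definition linfam_opp (f : F) : F := LinFam hP (lin_closedN (famP f)).
Definition linfam_add (f g : F) : F := LinFam hP (lin_closedD (famP f) (famP g)).
Definition linfam_scale a (f : F) : F := LinFam hP (lin_closedZ a (famP f)).

HB.instance Definition _ := gen_eqMixin F.
HB.instance Definition _ := gen_choiceMixin F.

Let addA : associative linfam_add.
Proof. by move=> f g h; apply: linfamE => i /=; rewrite addrA. Qed.
Let addC : commutative linfam_add.
Proof. by move=> f g; apply: linfamE => i /=; rewrite addrC. Qed.
Let add0 : left_id linfam0 linfam_add.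
Proof. by move=> f; apply: linfamE => i /=; rewrite add0r. Qed.
Let addN : left_inverse linfam0 linfam_opp linfam_add.
Proof. by move=> f; apply: linfamE => i /=; rewrite addNr. Qed.
HB.instance Definition _ := GRing.isZmodule.Build F addA addC add0 addN.

Let scaleA a b f : linfam_scale a (linfam_scale b f) = linfam_scale (a * b) f.
Proof. by apply: linfamE => i /=; rewrite scalerA. Qed.
Let scale1 : left_id 1 linfam_scale.
Proof. by move=> f; apply: linfamE => i /=; rewrite scale1r. Qed.
Let scaleDr : right_distributive linfam_scale +%R.
Proof. by move=> a f g; apply: linfamE => i /=; rewrite scalerDr. Qed.
Let scaleDl f : {morph linfam_scale^~ f : a b / a + b}.
Proof. by move=> a b; apply: linfamE => i /=; rewrite scalerDl. Qed.
HB.instance Definition _ :=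
  GRing.Zmodule_isLmodule.Build k F scaleA scale1 scaleDr scaleDl.
End LinearFamilies.

Section Dual.
Variables (k : fieldType) (V : lmodType k).

Lemma linear_form_closed :
  lin_closed (fun f : V -> k^o => linear f).
Proof.
split=> [a u v|a f g lf lg b u v] /=; first by rewrite scaler0 addr0.
by rewrite lf lg !scalerDr addrACA !scalerA mulrC.
Qed.

Definition dual : lmodType k := linfam linear_form_closed.
End Dual.

Record klincat (k : fieldType) := KLinCat {
  ob :> Type;
  hom : ob -> ob -> lmodType k;
  idm : forall X, hom X X;
  comp : forall X Y Z, hom Y Z -> hom X Y -> hom X Z;
  compA : forall X Y Z T (h : hom Z T) (g : hom Y Z) (f : hom X Y),
    comp h (comp g f) = comp (comp h g) f;
  comp1m : forall X Y (f : hom X Y), comp (idm Y) f = f;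
  compm1 : forall X Y (f : hom X Y), comp f (idm X) = f;
  comp_linl : forall X Y Z a (g g' : hom Y Z) (f : hom X Y),
    comp (a *: g + g') f = a *: comp g f + comp g' f;
  comp_linr : forall X Y Z a (g : hom Y Z) (f f' : hom X Y),
    comp g (a *: f + f') = a *: comp g f + comp g f' }.

Arguments hom {k} C X Y : rename.
Arguments idm {k C} X : rename.
Arguments comp {k C X Y Z} g f : rename.

Section KLinCatTheory.
Variables (k : fieldType) (C : klincat k).

Lemma comp0m (X Y Z : C) (f : hom C X Y) : comp (0 : hom C Y Z) f = 0.
Proof.
have := comp_linl (-1) (0 : hom C Y Z) 0 f.
by rewrite scaler0 addr0 scaleN1r addNr.
Qed.

Lemma compm0 (X Y Z : C) (g : hom C Y Z) : comp g (0 : hom C X Y) = 0.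
Proof.
have := comp_linr (-1) g (0 : hom C X Y) 0.
by rewrite scaler0 addr0 scaleN1r addNr.
Qed.

Lemma compZm (X Y Z : C) a (g : hom C Y Z) (f : hom C X Y) :
  comp (a *: g) f = a *: comp g f.
Proof. by have := comp_linl a g 0 f; rewrite addr0 comp0m addr0. Qed.

Lemma compmZ (X Y Z : C) a (g : hom C Y Z) (f : hom C X Y) :
  comp g (a *: f) = a *: comp g f.
Proof. by have := comp_linr a g f 0; rewrite addr0 compm0 addr0. Qed.
End KLinCatTheory.

Section Functors.
Variable k : fieldType.
Implicit Types C D E : klincat k.

Record functor C D := Functor {
  fob :> C -> D;
  fmap : forall X Y, hom C X Y -> hom D (fob X) (fob Y);
  fmap1 : forall X, fmap (idm X) = idm (fob X);
  fmapM : forall X Y Z (g : hom C Y Z) (f : hom C X Y),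
    fmap (comp g f) = comp (fmap g) (fmap f);
  fmap_lin : forall X Y a (f g : hom C X Y),
    fmap (a *: f + g) = a *: fmap f + fmap g }.

Program Definition fid C : functor C C := @Functor C C id (fun _ _ f => f) _ _ _.

Program Definition fcomp C D E (G : functor D E) (F : functor C D) : functor C E :=
  @Functor C E (fun X => G (F X)) (fun _ _ f => fmap G (fmap F f)) _ _ _.
Next Obligation. by rewrite !fmap1. Qed.
Next Obligation. by rewrite !fmapM. Qed.
Next Obligation. by rewrite !fmap_lin. Qed.

Record natiso C D (F G : functor C D) := NatIso {
  niso : forall X, hom D (F X) (G X);
  ninv : forall X, hom D (G X) (F X);
  nisoK : forall X, comp (ninv X) (niso X) = idm (F X);
  ninvK : forall X, comp (niso X) (ninv X) = idm (G X);
  niso_nat : forall X Y (f : hom C X Y),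
    comp (niso Y) (fmap F f) = comp (fmap G f) (niso X) }.

Definition is_equivalence C D (F : functor C D) : Prop :=
  exists G : functor D C,
    inhabited (natiso (fcomp G F) (fid C)) /\ inhabited (natiso (fcomp F G) (fid D)).

(* [serre_iso] is an isomorphism Hom(Y, nu X) ~ Hom_k(Hom(X, Y), k) natural in
   [Y] (contravariantly) and in [X] (covariantly). *)
Record serre_functor D := SerreFunctor {
  serre_fun :> functor D D;
  serre_equiv : is_equivalence serre_fun;
  serre_iso : forall X Y, hom D Y (serre_fun X) -> dual (hom D X Y);
  serre_iso_lin : forall X Y, linear (@serre_iso X Y);
  serre_iso_bij : forall X Y, bijective (@serre_iso X Y);
  serre_iso_natl : forall X Y Y' (u : hom D Y (serre_fun X)) (g : hom D Y' Y)
    (f : hom D X Y'), serre_iso (comp u g) f = serre_iso u (comp g f);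
  serre_iso_natr : forall X X' Y (u : hom D Y (serre_fun X)) (h : hom D X X')
    (f : hom D X' Y), serre_iso (comp (fmap serre_fun h) u) f = serre_iso u (comp f h) }.
End Functors.

(* The localization of a k-linear category [C] at a class [W] of morphisms,
   i.e. the universal k-linear functor out of [C] that inverts [W]: objects are
   those of [C], and morphisms are formal expressions in the morphisms of [C] and
   formal inverses of elements of [W], modulo the congruence [loceq] generated by
   the axioms of a k-linear category, the functoriality and linearity of [LMap],
   and the relations saying that [LInv s] is inverse to [LMap s]. *)
Section Localization.
Variables (k : fieldType) (C : klincat k).
Variable W : forall X Y : C, hom C X Y -> Prop.

Inductive lterm : C -> C -> Type :=
| LMap X Y (f : hom C X Y) : lterm X Y
| LInv X Y (s : hom C X Y) (Ws : W s) : lterm Y X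
| LComp X Y Z (g : lterm Y Z) (f : lterm X Y) : lterm X Z
| LAdd X Y (f g : lterm X Y) : lterm X Y
| LScale X Y (a : k) (f : lterm X Y) : lterm X Y.

Inductive loceq : forall X Y, lterm X Y -> lterm X Y -> Prop :=
| loceq_refl X Y (f : lterm X Y) : loceq f f
| loceq_sym X Y (f g : lterm X Y) : loceq f g -> loceq g f
| loceq_trans X Y (f g h : lterm X Y) : loceq f g -> loceq g h -> loceq f h
| loceq_comp X Y Z (g g' : lterm Y Z) (f f' : lterm X Y) :
    loceq g g' -> loceq f f' -> loceq (LComp g f) (LComp g' f')
| loceq_add X Y (f f' g g' : lterm X Y) :
    loceq f f' -> loceq g g' -> loceq (LAdd f g) (LAdd f' g')
| loceq_scale X Y a (f f' : lterm X Y) :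
    loceq f f' -> loceq (LScale a f) (LScale a f')
| loceq_compA X Y Z T (h : lterm Z T) (g : lterm Y Z) (f : lterm X Y) :
    loceq (LComp h (LComp g f)) (LComp (LComp h g) f)
| loceq_comp1m X Y (f : lterm X Y) : loceq (LComp (LMap (idm Y)) f) f
| loceq_compm1 X Y (f : lterm X Y) : loceq (LComp f (LMap (idm X))) f
| loceq_addA X Y (f g h : lterm X Y) : loceq (LAdd f (LAdd g h)) (LAdd (LAdd f g) h)
| loceq_addC X Y (f g : lterm X Y) : loceq (LAdd f g) (LAdd g f)
| loceq_add0 X Y (f : lterm X Y) : loceq (LAdd (LMap 0) f) f
| loceq_addN X Y (f : lterm X Y) : loceq (LAdd (LScale (-1) f) f) (LMap 0)
| loceq_scaleA X Y a b (f : lterm X Y) :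
    loceq (LScale a (LScale b f)) (LScale (a * b) f)
| loceq_scale1 X Y (f : lterm X Y) : loceq (LScale 1 f) f
| loceq_scaleDr X Y a (f g : lterm X Y) :
    loceq (LScale a (LAdd f g)) (LAdd (LScale a f) (LScale a g))
| loceq_scaleDl X Y a b (f : lterm X Y) :
    loceq (LScale (a + b) f) (LAdd (LScale a f) (LScale b f))
| loceq_linl X Y Z a (g g' : lterm Y Z) (f : lterm X Y) :
    loceq (LComp (LAdd (LScale a g) g') f) (LAdd (LScale a (LComp g f)) (LComp g' f))
| loceq_linr X Y Z a (g : lterm Y Z) (f f' : lterm X Y) :
    loceq (LComp g (LAdd (LScale a f) f')) (LAdd (LScale a (LComp g f)) (LComp g f'))
| loceq_mapM X Y Z (g : hom C Y Z) (f : hom C X Y) :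
    loceq (LMap (comp g f)) (LComp (LMap g) (LMap f))
| loceq_map_lin X Y a (f g : hom C X Y) :
    loceq (LMap (a *: f + g)) (LAdd (LScale a (LMap f)) (LMap g))
| loceq_invK X Y (s : hom C X Y) (Ws : W s) :
    loceq (LComp (LInv Ws) (LMap s)) (LMap (idm X))
| loceq_mapK X Y (s : hom C X Y) (Ws : W s) :
    loceq (LComp (LMap s) (LInv Ws)) (LMap (idm Y)).

Section Hom.
Variables X Y : C.
HB.instance Definition _ := gen_eqMixin (lterm X Y).
HB.instance Definition _ := gen_choiceMixin (lterm X Y).

Definition loceqb (f g : lterm X Y) : bool := `[< loceq f g >].
Lemma loceqb_refl : reflexive loceqb.
Proof. by move=> f; apply/asboolP/loceq_refl. Qed.
Lemma loceqb_sym : symmetric loceqb.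
Proof. by move=> f g; apply/asboolP/asboolP; apply: loceq_sym. Qed.
Lemma loceqb_trans : transitive loceqb.
Proof. by move=> g f h /asboolP fg /asboolP gh; apply/asboolP; exact: loceq_trans gh. Qed.
Definition loceqb_equiv : equiv_rel (lterm X Y) := EquivRel loceqb loceqb_refl loceqb_sym loceqb_trans.

Definition lhom := {eq_quot loceqb_equiv}.
HB.instance Definition _ := Choice.on lhom.

Definition lcls (f : lterm X Y) : lhom := \pi_lhom f.

Lemma lclsP f g : lcls f = lcls g <-> loceq f g.
Proof.
split; first by move/eqmodP/asboolP.
by move=> fg; apply/eqmodP/asboolP.
Qed.

Lemma loceq_repr f : loceq (repr (lcls f)) f.
Proof. by apply/lclsP; rewrite /lcls reprK. Qed.

Lemma lclsK (u : lhom) : lcls (repr u) = u. Proof. exact: reprK. Qed.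

Definition lzero : lhom := lcls (LMap 0).
Definition ladd (u v : lhom) : lhom := lcls (LAdd (repr u) (repr v)).
Definition lscale a (u : lhom) : lhom := lcls (LScale a (repr u)).
Definition lopp : lhom -> lhom := lscale (-1).

Lemma laddE f g : ladd (lcls f) (lcls g) = lcls (LAdd f g).
Proof. by apply/lclsP; apply: loceq_add; apply: loceq_repr. Qed.
Lemma lscaleE a f : lscale a (lcls f) = lcls (LScale a f).
Proof. by apply/lclsP; apply: loceq_scale; apply: loceq_repr. Qed.

Let addA : associative ladd.
Proof.
move=> u v w; rewrite -(lclsK u) -(lclsK v) -(lclsK w) !laddE.
by apply/lclsP/loceq_addA.
Qed.
Let addC : commutative ladd.
Proof. by move=> u v; rewrite -(lclsK u) -(lclsK v) !laddE; apply/lclsP/loceq_addC. Qed.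
Let add0 : left_id lzero ladd.
Proof. by move=> u; rewrite -(lclsK u) laddE; apply/lclsP/loceq_add0. Qed.
Let addN : left_inverse lzero lopp ladd.
Proof. by move=> u; rewrite -(lclsK u) /lopp lscaleE laddE; apply/lclsP/loceq_addN. Qed.
HB.instance Definition _ := GRing.isZmodule.Build lhom addA addC add0 addN.

Let addlE (u v : lhom) : u + v = ladd u v. Proof. by []. Qed.

Let scaleA a b u : lscale a (lscale b u) = lscale (a * b) u.
Proof. by rewrite -(lclsK u) !lscaleE; apply/lclsP/loceq_scaleA. Qed.
Let scale1 : left_id 1 lscale.
Proof. by move=> u; rewrite -(lclsK u) lscaleE; apply/lclsP/loceq_scale1. Qed.
Let scaleDr : right_distributive lscale +%R.
Proof.
move=> a u v; rewrite -(lclsK u) -(lclsK v) !addlE laddE !lscaleE.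
by rewrite laddE; apply/lclsP/loceq_scaleDr.
Qed.
Let scaleDl u : {morph lscale^~ u : a b / a + b}.
Proof.
move=> a b; rewrite -(lclsK u) !lscaleE addlE laddE.
by apply/lclsP/loceq_scaleDl.
Qed.
HB.instance Definition _ :=
  GRing.Zmodule_isLmodule.Build k lhom scaleA scale1 scaleDr scaleDl.

Lemma lcls_lin a f g : a *: lcls f + lcls g = lcls (LAdd (LScale a f) g).
Proof.
by rewrite addlE -[a *: _]/(lscale _ _) lscaleE laddE.
Qed.
End Hom.

Definition lcomp X Y Z (v : lhom Y Z) (u : lhom X Y) : lhom X Z :=
  lcls (LComp (repr v) (repr u)).

Lemma lcompE X Y Z (g : lterm Y Z) (f : lterm X Y) :
  lcomp (lcls g) (lcls f) = lcls (LComp g f).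
Proof. by apply/lclsP; apply: loceq_comp; apply: loceq_repr. Qed.

Program Definition localization : klincat k :=
  @KLinCat k C (fun X Y => lhom X Y) (fun X => lcls (LMap (idm X))) lcomp _ _ _ _ _.
Next Obligation.
rewrite -(lclsK h) -(lclsK g) -(lclsK f) !lcompE.
by apply/lclsP/loceq_compA.
Qed.
Next Obligation. by rewrite -(lclsK f) lcompE; apply/lclsP/loceq_comp1m. Qed.
Next Obligation. by rewrite -(lclsK f) lcompE; apply/lclsP/loceq_compm1. Qed.
Next Obligation.
rewrite -(lclsK g) -(lclsK g') -(lclsK f) lcls_lin !lcompE lcls_lin.
by apply/lclsP/loceq_linl.
Qed.
Next Obligation.
rewrite -(lclsK g) -(lclsK f') -(lclsK f) lcls_lin !lcompE lcls_lin.
by apply/lclsP/loceq_linr.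
Qed.
End Localization.

Section Complexes.
Variables (k : fieldType) (A : klincat k).

(* The differential is given for all pairs of degrees, with [cd m n] zero unless
   n = m + 1; this avoids transports along equalities of degrees.  An object is
   zero when its identity is zero. *)
Record cpx := Cpx {
  cob :> int -> A;
  cd : forall m n, hom A (cob m) (cob n);
  cd_shape : forall m n, n <> m + 1 -> cd m n = 0;
  cd_sq : forall m n p, comp (cd n p) (cd m n) = 0;
  cpx_bounded : exists N : int, forall n : int, N < `|n| -> idm (cob n) = 0 }.

Definition is_chain_map (X Y : cpx) (f : forall n, hom A (X n) (Y n)) : Prop :=
  forall m n, comp (cd Y m n) (f m) = comp (f n) (cd X m n).

Lemma chain_map_closed (X Y : cpx) : lin_closed (@is_chain_map X Y).
Proof.
split=> [m n|a f g cf cg m n]; first by rewrite comp0m compm0.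
by rewrite comp_linl comp_linr cf cg.
Qed.

Definition chain_map (X Y : cpx) : lmodType k := linfam (@chain_map_closed X Y).

Lemma chain_id_subproof (X : cpx) : is_chain_map (fun n => idm (X n)).
Proof. by move=> m n; rewrite comp1m compm1. Qed.
Definition chain_id (X : cpx) : chain_map X X :=
  LinFam (chain_map_closed X X) (@chain_id_subproof X).

Lemma chain_comp_subproof (X Y Z : cpx) (g : chain_map Y Z) (f : chain_map X Y) :
  is_chain_map (fun n => comp (g n) (f n)).
Proof.
by move=> m n; rewrite compA (famP g) -compA (famP f) compA.
Qed.
Definition chain_comp (X Y Z : cpx) (g : chain_map Y Z) (f : chain_map X Y) :
    chain_map X Z :=
  LinFam (chain_map_closed X Z) (chain_comp_subproof g f).

Program Definition Cb : klincat k :=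
  @KLinCat k cpx chain_map chain_id chain_comp _ _ _ _ _.
Next Obligation. by apply: linfamE => n; rewrite /= compA. Qed.
Next Obligation. by apply: linfamE => n; rewrite /= comp1m. Qed.
Next Obligation. by apply: linfamE => n; rewrite /= compm1. Qed.
Next Obligation. by apply: linfamE => n; rewrite /= comp_linl. Qed.
Next Obligation. by apply: linfamE => n; rewrite /= comp_linr. Qed.

Program Definition shift (X : cpx) (i : int) : cpx :=
  @Cpx (fun n => X (n + i)) (fun m n => ((-1) ^ i) *: cd X (m + i) (n + i)) _ _ _.
Next Obligation.
rewrite cd_shape ?scaler0 // => e; apply: H.
by apply: (addIr i); rewrite e addrAC.
Qed.
Next Obligation.
by rewrite compZm compmZ cd_sq !scaler0.
Qed.
Next Obligation.
have [N hN] := cpx_bounded X; exists (N + `|i|) => n hn; apply: hN.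
by rewrite -(ltrD2r `|i|); apply: (lt_le_trans hn); rewrite -{1}(addrK i n) ler_normB.
Qed.
End Complexes.

Record quiver := Quiver {
  vert : finType;
  arrow : finType;
  src : arrow -> vert;
  tgt : arrow -> vert }.

(* Vertices are numbered from 0.  In types D and E the vertices 0, ..., n - 2 form a
   chain, and vertex n - 1 is joined to vertex n - 3, resp. to vertex 2. *)
Inductive dynkin_type := DynA of nat | DynD of nat | DynE of nat.

Definition dynkin_rank (T : dynkin_type) : nat :=
  match T with DynA n | DynD n | DynE n => n end.

Definition dynkin_valid (T : dynkin_type) : bool :=
  match T with
  | DynA n => 1 <= n
  | DynD n => 4 <= n
  | DynE n => 6 <= n <= 8
  end%N.

Definition dynkin_edge (T : dynkin_type) (i j : nat) : bool :=
  match T with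
  | DynA n => j == i.+1
  | DynD n => (j == i.+1) && (j < n.-1) || (i == n - 3) && (j == n.-1)
  | DynE n => (j == i.+1) && (j < n.-1) || (i == 2) && (j == n.-1)
  end%N.

Definition dynkin_adj (T : dynkin_type) (i j : nat) : bool :=
  dynkin_edge T i j || dynkin_edge T j i.

Definition dynkin (Q : quiver) : Prop :=
  exists T : dynkin_type, dynkin_valid T /\
  exists2 e : vert Q -> 'I_(dynkin_rank T), bijective e &
    forall i j : vert Q,
      #|[set a : arrow Q | ((src a == i) && (tgt a == j))
                        || ((src a == j) && (tgt a == i))]|
      = dynkin_adj T (e i) (e j) :> nat.

Section Representations.
Variables (k : fieldType) (Q : quiver).

(* Finite dimensional representations, with coordinate spaces k^d at the vertices:
   every finite dimensional representation is isomorphic to one of these.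
   (Arbitrary [vectType]s at the vertices would make [rep] too large a type for
   the morphisms of the localization below to form an [lmodType].) *)
Record rep := Rep {
  rdim : vert Q -> nat;
  ract : forall a : arrow Q, 'Hom('rV[k]_(rdim (src a)), 'rV[k]_(rdim (tgt a))) }.

Definition rsp (V : rep) (i : vert Q) : vectType k := 'rV[k]_(rdim V i).
Coercion rsp : rep >-> Funclass.

Definition is_rep_map (V W : rep) (f : forall i, 'Hom(V i, W i)) : Prop :=
  forall (a : arrow Q) (v : V (src a)), f (tgt a) (ract V a v) = ract W a (f (src a) v).

Lemma rep_map_closed (V W : rep) :
  lin_closed (V := fun i => 'Hom(V i, W i) : lmodType k) (@is_rep_map V W).
Proof.
split=> [a v|c f g cf cg a v]; first by rewrite !lfunE /= linear0.
by rewrite !add_lfunE !scale_lfunE cf cg linearP.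
Qed.

Definition rep_map (V W : rep) : lmodType k := linfam (rep_map_closed V W).

Lemma rep_id_subproof (V : rep) : @is_rep_map V V (fun i => \1%VF).
Proof. by move=> a v; rewrite !id_lfunE. Qed.
Definition rep_id (V : rep) : rep_map V V :=
  LinFam (rep_map_closed V V) (@rep_id_subproof V).

Lemma rep_comp_subproof (V W U : rep) (g : rep_map W U) (f : rep_map V W) :
  @is_rep_map V U (fun i => g i \o f i)%VF.
Proof. by move=> a v; rewrite !comp_lfunE (famP f) (famP g). Qed.
Definition rep_comp (V W U : rep) (g : rep_map W U) (f : rep_map V W) : rep_map V U :=
  LinFam (rep_map_closed V U) (rep_comp_subproof g f).

Program Definition rep_cat : klincat k :=
  @KLinCat k rep rep_map rep_id rep_comp _ _ _ _ _.
Next Obligation. by apply: linfamE => i; rewrite /= comp_lfunA. Qed.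
Next Obligation. by apply: linfamE => i; rewrite /= comp_lfun1l. Qed.
Next Obligation. by apply: linfamE => i; rewrite /= comp_lfun1r. Qed.
Next Obligation. by apply: linfamE => i; rewrite /= comp_lfunDl comp_lfunZl. Qed.
Next Obligation. by apply: linfamE => i; rewrite /= comp_lfunDr comp_lfunZr. Qed.

Local Notation cpxQ := (cpx rep_cat).

Definition dv (X : cpxQ) (m n : int) (i : vert Q) : 'Hom((X m : rep) i, (X n : rep) i) :=
  (cd X m n : rep_map (X m) (X n)) i.

Definition cv (X Y : cpxQ) (f : chain_map X Y) (n : int) (i : vert Q) :
    'Hom((X n : rep) i, (Y n : rep) i) :=
  (f n : rep_map (X n) (Y n)) i.

Definition cocycles (X : cpxQ) (n : int) (i : vert Q) := lker (dv X n (n + 1) i).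
Definition coboundaries (X : cpxQ) (n : int) (i : vert Q) := limg (dv X (n - 1) n i).

(* The maps H^n(X) -> H^n(Y) on H^n = cocycles / coboundaries, which are computed
   vertex by vertex, are injective and surjective. *)
Definition quasi_iso (X Y : cpxQ) (f : chain_map X Y) : Prop :=
  forall n i,
    (forall x, x \in cocycles X n i -> cv f n i x \in coboundaries Y n i ->
       x \in coboundaries X n i) /\
    (forall y, y \in cocycles Y n i ->
       exists2 x, x \in cocycles X n i & y - cv f n i x \in coboundaries Y n i).

(* The localization of [Cb rep_cat] at the quasi-isomorphisms as a plain category
   carries a unique k-linear structure for which the localization functor is
   k-linear, hence it agrees with the k-linear localization used here. *)
Definition Db : klincat k := localization (C := Cb rep_cat) quasi_iso.

Definition hdim (X Y : Db) (i : int) : nat := dimk (hom Db X (shift Y i)).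

(* All but finitely many terms of the sums below vanish; [\sum_(i \in A)] is the
   sum over the support of the summand. *)
Definition pairing (X Y : Db) : int :=
  \sum_(i \in [set i : int | i <= 0]%classic) (-1) ^ i * (hdim X Y i)%:Z.

(* The image of the class of [X] under the isomorphism from K_0 to the lattice of
   dimension vectors, on which [X] = sum_n (-1)^n [X^n]. *)
Definition dimvect (X : Db) : {ffun vert Q -> int} :=
  [ffun i => \sum_(n \in [set: int]%classic)
     (-1) ^ n * (rdim ((X : cpxQ) n) i)%:Z].

Definition ar_translation (nu : serre_functor Db) (X : Db) : Db :=
  nu (shift X (-1)).
End Representations.

(* Main.v *)
(* By Serre duality [N, tau X]^j = [X, N]^(1 - j), so <X, N> - <N, tau X> is the full alternating
   sum chi(X, N) of the [X, N]^i over all integers i, and it suffices to show that chi(X, N)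
   depends only on X and on the dimension vector of N.

   Path algebras being hereditary, RHom(X, N) is computed by the total complex of
     prod_i Hom(X_i, N_i) -> prod_a Hom(X_(src a), N_(tgt a)),
   whose Euler characteristic visibly has this property.  To identify its cohomology with the
   morphisms in the localization: quasi-isomorphisms X -> X' are homotopy equivalences vertex by
   vertex, hence induce bijections on the cohomology, on which the localization therefore acts;
   and cocycles are the pullbacks of a universal one along chain maps X -> I, where I is the
   standard cofree resolution of N.  The resolution is finite dimensional because the paths in
   a Dynkin quiver have bounded length.

   Graded maps between complexes are given for all pairs of degrees and are zero off the relevant
   diagonal, in order to avoid transports along equalities of degrees. *)

Require Import Defs.
From HB Require Import structures.
From mathcomp Require Import all_boot all_order all_algebra.
From mathcomp Require Import boolp classical_sets functions fsbigop.
From mathcomp Require Import zify ring.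
Import VectorInternalTheory Order.TTheory GRing.Theory Num.Theory.
Local Open Scope ring_scope.
Set Implicit Arguments.
Unset Strict Implicit.
Unset Printing Implicit Defensive.

(** * Dimensions of vector spaces *)

Lemma dep_choice (I : Type) (T : I -> Type) (P : forall i, T i -> Prop) :
  (forall i, exists y, P i y) -> exists f : forall i, T i, forall i, P i (f i).
Proof.
by move=> h; exists (fun i => projT1 (cid (h i))) => i; case: cid.
Qed.

Section Dimension.
Variable k : fieldType.
Implicit Types V W K : lmodType k.

Definition mk_linear V W (f : V -> W) (hf : linear f) : {linear V -> W} :=
  HB.pack f (GRing.isLinear.Build k V W _ f hf).

Lemma bij_of_inj_surj (A B : Type) (f : A -> B) :
  injective f -> (forall y, exists x, f x = y) -> bijective f.
Proof.
move=> fi fs; have [g gK] := dep_choice fs.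
by exists g => // x; apply: fi; rewrite gK.
Qed.

Lemma bij_surj (A B : Type) (f : A -> B) : bijective f -> forall y, exists x, f x = y.
Proof. by case=> g _ gK y; exists (g y). Qed.

Definition hasdim V n := exists f : {linear V -> 'rV[k]_n}, bijective f.

Lemma linear_inverse V W (f : {linear V -> W}) :
  bijective f -> exists2 g : {linear W -> V}, cancel f g & cancel g f.
Proof.
case=> g fK gK; have lg : linear g.
  by move=> a u v; apply: (can_inj fK); rewrite linearP !gK.
by exists (mk_linear lg).
Qed.

Lemma hasdim_iso V W n (f : {linear V -> W}) : bijective f -> hasdim V n <-> hasdim W n.
Proof.
move=> bf; have [g fK gK] := linear_inverse bf.
split=> -[h bh]; first by exists (h \o g); apply: bij_comp => //; exists f.
by exists (h \o f); apply: bij_comp.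
Qed.

Lemma hasdim_le V n m (f : {linear V -> 'rV[k]_n}) (g : {linear V -> 'rV[k]_m}) :
  bijective f -> bijective g -> (n <= m)%N.
Proof.
move=> bf bg; have [f' fK f'K] := linear_inverse bf.
pose h : {linear 'rV[k]_n -> 'rV[k]_m} := g \o f'.
have hi : lker (linfun h) == 0%VS.
  apply/lker0P => x y; rewrite !lfunE /= => /(bij_inj bg) e.
  by rewrite -(f'K x) e f'K.
have := limg_dim_eq (f := linfun h) (U := fullv).
have := dimvS (subvf (limg (linfun h))).
move/eqP: hi => ->; rewrite capv0 => le /(_ erefl) e.
by move: le; rewrite e !dimvf /dim /= !mul1n.
Qed.

Lemma hasdim_uniq V n m : hasdim V n -> hasdim V m -> n = m.
Proof.
by move=> [f bf] [g bg]; apply/eqP; rewrite eqn_leq !(hasdim_le bf bg, hasdim_le bg bf).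
Qed.

Lemma hasdim_dimk V n : hasdim V n -> dimk V = n.
Proof.
by move=> h; rewrite /dimk; case: xgetP => [m _ /hasdim_uniq|/(_ n)] //; exact.
Qed.

Lemma dimk_iso V W (f : {linear V -> W}) : bijective f -> dimk V = dimk W.
Proof.
move=> bf; rewrite /dimk; congr xget; apply/seteqP; split=> n /=;
  by rewrite -?[exists _, _]/(hasdim _ _) (hasdim_iso n bf).
Qed.

Definition findim V := exists n, hasdim V n.

Lemma findim_dimk V : findim V -> hasdim V (dimk V).
Proof. by move=> [n h]; rewrite (hasdim_dimk h). Qed.

Lemma subspace_vspace (E : vectType k) (P : E -> Prop) :
  P 0 -> (forall a u v, P u -> P v -> P (a *: u + v)) ->
  exists U : {vspace E}, forall v, v \in U <-> P v.
Proof.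
move=> P0 Plin.
pose A n := `[< exists U : {vspace E}, (\dim U = n) /\ forall v, v \in U -> P v >].
have exA : exists n, A n.
  exists 0%N; apply/asboolP; exists 0%VS; split; first exact: dimv0.
  by move=> v; rewrite memv0 => /eqP ->.
have leA n : A n -> (n <= \dim {:E})%N.
  by move/asboolP=> [U [<- _]]; apply: dimvS; apply: subvf.
have [n /asboolP[U [dU PU]] maxn] := ex_maxnP exA leA.
exists U => v; split; first exact: PU.
move=> Pv; suff: (U + <[v]> <= U)%VS.
  by move/(subv_trans (addvSr _ _)); rewrite -memvE.
have l := dimv_leqif_eq (addvSl U <[v]>%VS).
have : (\dim U == \dim (U + <[v]>)%VS).
  rewrite eqn_leq l.1 dU maxn //; apply/asboolP; exists (U + <[v]>)%VS; split=> // x.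
  by case/memv_addP=> u uU [w /vlineP[c ->] ->]; rewrite addrC; apply: Plin => //; apply: PU.
by rewrite l.2 => /eqP <-.
Qed.

Lemma hasdim_subvs (E : vectType k) (U : {vspace E}) : hasdim (subvs_of U) (\dim U).
Proof.
exists (v2r : {linear subvs_of U -> _}).
exact: (Bijective (@v2rK _ (subvs_of U)) (@r2vK _ (subvs_of U))).
Qed.

Lemma hasdim_exact V W K n (i : {linear K -> V}) (p : {linear V -> W}) :
    hasdim V n -> injective i -> (forall w, exists v, p v = w) ->
    (forall v, p v = 0 <-> exists x, i x = v) ->
  exists a b, [/\ hasdim K a, hasdim W b & n = (a + b)%N].
Proof.
move=> [f bf] ii ps ex; have [g fK gK] := linear_inverse bf.
have [|a u v|U PU] := @subspace_vspace 'rV[k]_n (fun v => p (g v) = 0).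
- by rewrite !linear0.
- by rewrite !linearP => -> ->; rewrite scaler0 addr0.
have UE v : p (g v) = 0 -> v \in U by move/PU.
exists (\dim U), (\dim U^C); split; last first.
- rewrite dimv_compl subnKC ?dimvf ?/dim /= ?mul1n // (leq_trans (dimvS (subvf U))) //.
  by rewrite dimvf /dim /= mul1n.
- pose h : {linear subvs_of U^C -> W} := p \o g \o vsval.
  have bh : bijective h.
    apply: bij_of_inj_surj => [x y e|w].
      apply: val_inj; apply/eqP; rewrite -subr_eq0 -memv0 -(capv_compl U) memv_cap.
      rewrite UE ?memvB ?subvsP //; apply/eqP; rewrite !linearB subr_eq0; exact/eqP.
    have [v <-] := ps w; have : f v \in (U + U^C)%VS by rewrite addv_complf memvf.
    case/memv_addP=> x xU [y yU fv]; exists (Subvs yU); rewrite /h /=.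
    by rewrite -{1}(fK v) fv !linearD (PU x).1 // add0r.
  exact/(hasdim_iso _ bh)/hasdim_subvs.
- have hP (x : K) : f (i x) \in U by apply: UE; rewrite fK; apply/ex; exists x.
  have lh : linear (fun x => Subvs (hP x)).
    by move=> c x y; apply: val_inj; rewrite /= !linearP.
  have bh : bijective (mk_linear lh).
    apply: bij_of_inj_surj => [x y /(congr1 vsval) /= /(bij_inj bf) /ii //|[v vU]].
    have [x e] := (ex _).1 ((PU v).1 vU).
    by exists x; apply: val_inj; rewrite /= e gK.
  exact/(hasdim_iso _ bh)/hasdim_subvs.
Qed.

Lemma dimk_exact V W K (i : {linear K -> V}) (p : {linear V -> W}) :
    findim V -> injective i -> (forall w, exists v, p v = w) ->
    (forall v, p v = 0 <-> exists x, i x = v) ->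
  dimk V = (dimk K + dimk W)%N.
Proof.
move=> [n dV] ii ps ex; have [a [b [dK dW e]]] := hasdim_exact dV ii ps ex.
by rewrite (hasdim_dimk dV) (hasdim_dimk dK) (hasdim_dimk dW).
Qed.

Lemma hasdim_prod V W K a b (f : {linear V -> W}) (r : {linear V -> K}) :
    hasdim W a -> hasdim K b -> (forall v, f v = 0 -> r v = 0 -> v = 0) ->
    (forall w x, exists v, f v = w /\ r v = x) -> hasdim V (a + b).
Proof.
move=> [g bg] [h bh] fr0 frs.
have lh : linear (fun v => row_mx (g (f v)) (h (r v))).
  by move=> c u v; rewrite !linearP scale_row_mx add_row_mx.
exists (mk_linear lh); apply: bij_of_inj_surj => [u v /= e|y].
  have [e1 e2] := eq_row_mx e.
  apply/eqP; rewrite -subr_eq0; apply/eqP; apply: fr0; rewrite linearB.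
    by rewrite (bij_inj bg e1) subrr.
  by rewrite (bij_inj bh e2) subrr.
have [w ew] := bij_surj bg (lsubmx y); have [x ex] := bij_surj bh (rsubmx y).
by have [v [ev1 ev2]] := frs w x; exists v; rewrite /= ev1 ev2 ew ex hsubmxK.
Qed.

Lemma hasdim0 V : (forall v : V, v = 0) -> hasdim V 0.
Proof.
move=> V0; have l0 : linear (fun _ : V => 0 : 'rV[k]_0) by move=> a u v; rewrite scaler0 addr0.
exists (mk_linear l0); exists (fun _ => 0) => x; first by rewrite (V0 x).
by apply/rowP; case.
Qed.

Lemma hasdim_dual V n : hasdim V n -> hasdim (dual V) n.
Proof.
move=> [f bf]; have [g fK gK] := linear_inverse bf.
have lh : linear (fun phi : dual V => \row_i (phi (g (delta_mx 0 i)) : k)).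
  by move=> c u v; apply/rowP => i; rewrite !mxE.
have phiE (phi : dual V) v : phi v = \sum_i f v 0 i * phi (g (delta_mx 0 i)) :> k.
  pose p := mk_linear (famP phi).
  rewrite -[LHS]/(p v) -{1}(fK v) {1}(row_sum_delta (f v)) !linear_sum.
  by apply: eq_bigr => i _; rewrite !linearZ.
exists (mk_linear lh); apply: bij_of_inj_surj => [u v /= e|y].
  apply: linfamE => x; rewrite !phiE; apply: eq_bigr => i _.
  by move/rowP: e => /(_ i); rewrite !mxE => ->.
have ly : linear (fun v => \sum_i f v 0 i * y 0 i : k^o).
  move=> c u v; rewrite scaler_sumr -big_split; apply: eq_bigr => i _.
  by rewrite linearP !mxE mulrDl -mulrA.
exists (LinFam (linear_form_closed V) ly); apply/rowP => i; rewrite !mxE /=.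
rewrite gK (bigD1 i) //= big1 => [|j ji]; first by rewrite mxE !eqxx mul1r addr0.
have e : (j == i) = false by exact: negbTE.
by rewrite mxE [_ && _]e mul0r.
Qed.
End Dimension.

Section Families.
Variables (k : fieldType) (I : eqType) (V : I -> lmodType k) (d : I -> nat).

Definition supported_closed (s : seq I) :
  lin_closed (fun f : forall i, V i => forall i, i \notin s -> f i = 0).
Proof.
by split=> [//|a f g hf hg i si]; rewrite hf // hg // scaler0 addr0.
Qed.

Lemma hasdim_family (s : seq I) : uniq s -> (forall i, i \in s -> hasdim (V i) (d i)) ->
  hasdim (linfam (supported_closed s)) (\sum_(i <- s) d i).
Proof.
elim: s => [_ _|i s IH /= /andP[is_ us] hd].
  by rewrite big_nil; apply: hasdim0 => f; apply: linfamE => i; rewrite (famP f).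
rewrite big_cons.
have lf : linear (fun f : linfam (supported_closed (i :: s)) => f i) by [].
have rP (f : linfam (supported_closed (i :: s))) j :
    j \notin s -> (if j == i then 0 else f j) = 0.
  by case: ifP => // ji js; rewrite (famP f) // in_cons ji.
have lr : linear (fun f => LinFam (supported_closed s) (rP f)).
  move=> a f g; apply: linfamE => j /=.
  by case: (j == i) => //; rewrite scaler0 addr0.
apply: (hasdim_prod (f := mk_linear lf) (r := mk_linear lr)).
- by apply: hd; rewrite inE eqxx.
- by apply: IH => // j js; apply: hd; rewrite inE js orbT.
- move=> f /= fi /(congr1 (@fam _ _ _ _ _)) /= e; apply: linfamE => j.
  case: (eqVneq j i) => [-> //|ji].
  by have := congr1 (fun h => h j) e; rewrite /= (negbTE ji).
move=> w x /=.
pose F j : V j := if j =P i is ReflectT e then eq_rect i V w j (esym e) else x j.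
have Fi : F i = w.
  rewrite /F; case: eqP => [e|] //.
  by rewrite (eq_irrelevance (esym e) erefl).
have Fj j : j != i -> F j = x j.
  by rewrite /F; case: eqP => // ->; rewrite eqxx.
have FP j : j \notin i :: s -> F j = 0.
  by rewrite inE negb_or => /andP[ji js]; rewrite Fj // (famP x).
exists (LinFam (supported_closed (i :: s)) FP); split; first exact: Fi.
apply: linfamE => j /=; case: eqVneq => [->|ji]; last exact: Fj.
by rewrite (famP x).
Qed.

Lemma linfam_ext (P P' : (forall i, V i) -> Prop) (h : lin_closed P) (h' : lin_closed P') n :
  (forall f, P f <-> P' f) -> hasdim (linfam h) n -> hasdim (linfam h') n.
Proof.
move=> PP' hd.
have l : linear (fun f : linfam h => LinFam h' ((PP' _).1 (famP f))).
  by move=> a f g; apply: linfamE.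
suff b : bijective (mk_linear l) by apply/(hasdim_iso _ b).
apply: bij_of_inj_surj => [f g /(congr1 (@fam _ _ _ _ _)) /= e|f].
  by apply: linfamE => i; rewrite e.
by exists (LinFam h ((PP' _).2 (famP f))); apply: linfamE.
Qed.
End Families.

(** * Complexes of vector spaces *)

Section VectorComplexes.
Variable k : fieldType.

Definition sg (p : int) : k := (-1) ^ p.

Lemma sgD p q : sg (p + q) = sg p * sg q.
Proof. by rewrite /sg expfzDr // oppr_eq0 oner_eq0. Qed.

Lemma sgN1 : sg (-1) = -1. Proof. by rewrite /sg exprN1 invrN1. Qed.
Lemma sgB1 p : sg (p - 1) = - sg p. Proof. by rewrite sgD sgN1 mulrN1. Qed.
Lemma sgN p : sg (- p) = sg p. Proof. by rewrite /sg -exprz_inv invrN1. Qed.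

Lemma sgM p : sg p * sg p = 1.
Proof. by rewrite -{2}sgN -sgD subrr. Qed.

(* As in [cpx], the differential is given between any two degrees; only those between
   consecutive degrees matter. *)
Record vcpx := VCpx {
  vsp : int -> vectType k;
  vd : forall m n, 'Hom(vsp m, vsp n);
  vd_sq : forall m n p x, vd n p (vd m n x) = 0 }.

Definition vhom_sp (A C : vcpx) (t : int * int) : lmodType k := 'Hom(vsp A t.1, vsp C t.2).

Lemma true_closed (I : Type) (V : I -> lmodType k) : lin_closed (fun _ : forall i, V i => True).
Proof. by []. Qed.

Definition vhom (A C : vcpx) : lmodType k := linfam (@true_closed _ (vhom_sp A C)).
Definition hv A C (f : vhom A C) m n : 'Hom(vsp A m, vsp C n) := f (m, n).
Definition mkv A C (F : forall m n, 'Hom(vsp A m, vsp C n)) : vhom A C :=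
  @LinFam k _ (vhom_sp A C) _ (@true_closed _ _) (fun t => F t.1 t.2) I.

Lemma hv_eq A C (f g : vhom A C) : (forall m n x, hv f m n x = hv g m n x) -> f = g.
Proof. by move=> fg; apply: linfamE => -[m n]; apply/lfunP => x; apply: fg. Qed.

Lemma hv_lin A C a (f g : vhom A C) m n x :
  hv (a *: f + g) m n x = a *: hv f m n x + hv g m n x.
Proof. by rewrite /hv /= add_lfunE scale_lfunE. Qed.
Lemma hvD A C (f g : vhom A C) m n x : hv (f + g) m n x = hv f m n x + hv g m n x.
Proof. by rewrite /hv /= add_lfunE. Qed.
Lemma hvN A C (f : vhom A C) m n x : hv (- f) m n x = - hv f m n x.
Proof. by rewrite /hv /= opp_lfunE. Qed.
Lemma hvB A C (f g : vhom A C) m n x : hv (f - g) m n x = hv f m n x - hv g m n x.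
Proof. by rewrite hvD hvN. Qed.
Lemma hv0 A C m n x : hv (0 : vhom A C) m n x = 0.
Proof. by rewrite /hv /= zero_lfunE. Qed.

Definition delta A C p (f : vhom A C) : vhom A C :=
  mkv (fun m n => (vd C (n - 1) n \o hv f m (n - 1))
                  - sg p *: (hv f (m + 1) n \o vd A m (m + 1)))%VF.

Lemma deltaE A C p (f : vhom A C) m n x :
  hv (delta p f) m n x =
  vd C (n - 1) n (hv f m (n - 1) x) - sg p *: hv f (m + 1) n (vd A m (m + 1) x).
Proof. by rewrite {1}/hv /= add_lfunE opp_lfunE scale_lfunE !comp_lfunE. Qed.

Lemma delta_lin A C p : linear (@delta A C p).
Proof.
move=> a f g; apply: hv_eq => m n x; rewrite !(deltaE, hv_lin) linearP.
rewrite scalerDr scalerBr opprD addrACA; congr (_ - _ + _).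
by rewrite !scalerA mulrC.
Qed.
HB.instance Definition _ A C p :=
  GRing.isLinear.Build k (vhom A C) (vhom A C) *:%R (delta p) (@delta_lin A C p).

Lemma deltaB A C p (f g : vhom A C) : delta p (f - g) = delta p f - delta p g.
Proof. exact: linearB. Qed.
Lemma deltaD A C p (f g : vhom A C) : delta p (f + g) = delta p f + delta p g.
Proof. exact: linearD. Qed.

Definition vdeg A C p (f : vhom A C) := forall m n, n <> m + p -> forall x, hv f m n x = 0.

Lemma vdegD A C p (f g : vhom A C) : vdeg p f -> vdeg p g -> vdeg p (f + g).
Proof. by move=> df dg m n e x; rewrite hvD df // dg // addr0. Qed.
Lemma vdegN A C p (f : vhom A C) : vdeg p f -> vdeg p (- f).
Proof. by move=> df m n e x; rewrite hvN df // oppr0. Qed.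
Lemma vdegB A C p (f g : vhom A C) : vdeg p f -> vdeg p g -> vdeg p (f - g).
Proof. by move=> df dg; apply: vdegD => //; apply: vdegN. Qed.

Lemma vdeg_delta A C p (f : vhom A C) : vdeg p f -> vdeg (p + 1) (delta p f).
Proof.
move=> df m n e x; rewrite deltaE !df ?linear0 ?scaler0 ?subr0 ?addr0 //.
  by move=> en; apply: e; rewrite en -addrA (addrC 1).
by move=> en; apply: e; rewrite -[n](subrK 1) en addrA.
Qed.

Lemma delta_delta A C p (f : vhom A C) : delta p (delta (p - 1) f) = 0.
Proof.
apply: hv_eq => m n x; rewrite deltaE !(deltaE, hv0) linearB linearZ /= !vd_sq.
rewrite linear0 scaler0 sub0r.
by rewrite subr0 sgB1 scaleNr opprK subrr.
Qed.

Definition pre A B C (s : forall n, 'Hom(vsp A n, vsp B n)) (f : vhom B C) : vhom A C :=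
  mkv (fun m n => hv f m n \o s m)%VF.
Definition post A C D (t : forall n, 'Hom(vsp C n, vsp D n)) (f : vhom A C) : vhom A D :=
  mkv (fun m n => t n \o hv f m n)%VF.

Lemma preE A B C s (f : vhom B C) m n x : hv (@pre A B C s f) m n x = hv f m n (s m x).
Proof. by rewrite {1}/hv /= comp_lfunE. Qed.
Lemma postE A C D t (f : vhom A C) m n x : hv (@post A C D t f) m n x = t n (hv f m n x).
Proof. by rewrite {1}/hv /= comp_lfunE. Qed.

Lemma pre_lin A B C s : linear (@pre A B C s).
Proof. by move=> a f g; apply: hv_eq => m n x; rewrite !(preE, hv_lin). Qed.
HB.instance Definition _ A B C s :=
  GRing.isLinear.Build k (vhom B C) (vhom A C) *:%R (pre s) (@pre_lin A B C s).
Lemma preD A B C s (f g : vhom B C) : @pre A B C s (f + g) = pre s f + pre s g.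
Proof. exact: linearD. Qed.
Lemma preB A B C s (f g : vhom B C) : @pre A B C s (f - g) = pre s f - pre s g.
Proof. exact: linearB. Qed.
Lemma post_lin A C D t : linear (@post A C D t).
Proof. by move=> a f g; apply: hv_eq => m n x; rewrite !(postE, hv_lin) linearP. Qed.
HB.instance Definition _ A C D t :=
  GRing.isLinear.Build k (vhom A C) (vhom A D) *:%R (post t) (@post_lin A C D t).

Definition vchain A B (s : forall n, 'Hom(vsp A n, vsp B n)) :=
  forall m n x, vd B m n (s m x) = s n (vd A m n x).

Lemma delta_pre A B C p s (f : vhom B C) : @vchain A B s -> delta p (pre s f) = pre s (delta p f).
Proof. by move=> cs; apply: hv_eq => m n x; rewrite !(deltaE, preE) cs. Qed.
Lemma delta_post A C D p t (f : vhom A C) :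
  @vchain C D t -> delta p (post t f) = post t (delta p f).
Proof.
move=> ct; apply: hv_eq => m n x.
by rewrite !(deltaE, postE) linearB /= [t n (_ *: _)]linearZ /= ct.
Qed.

Lemma vdeg_pre A B C p s (f : vhom B C) : vdeg p f -> vdeg p (@pre A B C s f).
Proof. by move=> df m n e x; rewrite preE df. Qed.
Lemma vdeg_post A C D p t (f : vhom A C) : vdeg p f -> vdeg p (@post A C D t f).
Proof. by move=> df m n e x; rewrite postE df // linear0. Qed.

Definition vinv A m n : 'Hom(vsp A m, vsp A n) := ((vd A n m)^-1)%VF.
(* [harm A n] is chain homotopic to the identity, vanishes on coboundaries and takes
   values in cocycles. *)
Definition harm A n : 'Hom(vsp A n, vsp A n) :=
  (\1 - (vd A (n - 1) n \o vinv A n (n - 1)) - (vinv A (n + 1) n \o vd A n (n + 1)))%VF.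

Lemma harmE A n x :
  harm A n x = x - vd A (n - 1) n (vinv A n (n - 1) x) - vinv A (n + 1) n (vd A n (n + 1) x).
Proof. by rewrite /harm !add_lfunE !opp_lfunE !comp_lfunE id_lfunE. Qed.

Lemma vinvK A m n x : x \in limg (vd A m n) -> vd A m n (vinv A n m x) = x.
Proof. exact: limg_lfunVK. Qed.

Lemma memv_limg (U V : vectType k) (f : 'Hom(U, V)) x : f x \in limg f.
Proof. by rewrite memv_img ?memvf. Qed.

Lemma vd_harm A n x : vd A n (n + 1) (harm A n x) = 0.
Proof. by rewrite harmE !linearB /= vd_sq subr0 vinvK ?memv_limg // subrr. Qed.

Lemma harm_vd A n x : harm A n (vd A (n - 1) n x) = 0.
Proof. by rewrite harmE vd_sq linear0 subr0 vinvK ?memv_limg // subrr. Qed.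

Lemma harm_vdS A m x : harm A (m + 1) (vd A m (m + 1) x) = 0.
Proof.
have h n : m + 1 = n -> harm A n (vd A m n x) = 0.
  by move=> en; have e : m = n - 1 by [rewrite -en addrK]; subst m; apply: harm_vd.
exact: h.
Qed.

Lemma harm_cob A n x : x \in limg (vd A (n - 1) n) -> harm A n x = 0.
Proof. by move=> xB; rewrite -(vinvK xB) harm_vd. Qed.

Lemma harm_cocycle A n x : vd A n (n + 1) x = 0 -> x - harm A n x \in limg (vd A (n - 1) n).
Proof. by move=> dx; rewrite harmE dx linear0 subr0 opprB addrC subrK memv_limg. Qed.

Definition homotopy A C p (f : vhom A C) : vhom A C :=
  mkv (fun m n => (vinv C (n + 1) n \o hv f m (n + 1) \o harm A m)
                  + sg p *: (hv f (m - 1) n \o vinv A m (m - 1)))%VF.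

Lemma homotopyE A C p (f : vhom A C) m n x : hv (homotopy p f) m n x =
  vinv C (n + 1) n (hv f m (n + 1) (harm A m x)) + sg p *: hv f (m - 1) n (vinv A m (m - 1) x).
Proof. by rewrite {1}/hv /= add_lfunE scale_lfunE !comp_lfunE. Qed.

Lemma closed_vd A C p (f : vhom A C) m n x : delta p f = 0 ->
  vd C (n - 1) n (hv f (m - 1) (n - 1) x) = sg p *: hv f m n (vd A (m - 1) m x).
Proof.
move=> df; have := @deltaE A C p f (m - 1) n x; rewrite df hv0 subrK => /esym/eqP.
by rewrite subr_eq0 => /eqP.
Qed.

Arguments closed_vd {A C p f m} n x df.

Lemma closed_cob A C p (f : vhom A C) m n x : delta p f = 0 ->
  x \in limg (vd A (m - 1) m) -> hv f m n x \in limg (vd C (n - 1) n).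
Proof.
move=> df /vinvK <-; rewrite -[hv _ _ _ _]scale1r -(sgM p) -scalerA -(closed_vd _ _ df).
by rewrite memvZ ?memv_limg.
Qed.

Lemma null_homotopic A C p (f : vhom A C) :
    vdeg p f -> delta p f = 0 ->
    (forall m n x, vd A m (m + 1) x = 0 -> hv f m n x \in limg (vd C (n - 1) n)) ->
  exists2 h, vdeg (p - 1) h & f = delta (p - 1) h.
Proof.
move=> degf df fco; exists (homotopy p f).
  move=> m n e x; rewrite homotopyE !degf ?linear0 ?scaler0 ?addr0 // => en; apply: e.
    by rewrite en addrAC addrA.
  by rewrite -[n](addrK 1) en addrA.
apply: hv_eq => m n x; rewrite deltaE !homotopyE subrK addrK linearD linearZ /=.
rewrite vinvK ?fco ?vd_harm // (closed_vd _ _ df) scalerA sgM scale1r.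
rewrite harm_vdS !linear0 add0r sgB1 scaleNr opprK scalerA sgM scale1r -!linearD harmE.
by rewrite [_ - _ - _]addrAC !subrK.
Qed.

Definition vqis A B (s : forall n, 'Hom(vsp A n, vsp B n)) := forall n,
  (forall x, x \in lker (vd A n (n + 1)) -> s n x \in limg (vd B (n - 1) n) ->
     x \in limg (vd A (n - 1) n)) /\
  (forall y, y \in lker (vd B n (n + 1)) ->
     exists2 x, x \in lker (vd A n (n + 1)) & y - s n x \in limg (vd B (n - 1) n)).

Section QuasiIso.
Variables (A B : vcpx) (s : forall n, 'Hom(vsp A n, vsp B n)).
Hypotheses (cs : vchain s) (qs : vqis s).

Let w n := (harm B n \o s n \o harm A n)%VF.
Definition quasi_inverse n := (harm A n \o (w n)^-1 \o harm B n)%VF.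

Lemma quasi_inverse_vd m x :
  vd A m (m + 1) (quasi_inverse m x) = quasi_inverse (m + 1) (vd B m (m + 1) x).
Proof.
by rewrite /quasi_inverse !comp_lfunE vd_harm harm_vdS !linear0.
Qed.

Lemma quasi_inverseK m x : vd A m (m + 1) x = 0 ->
  x - quasi_inverse m (s m x) \in limg (vd A (m - 1) m).
Proof.
move=> dx.
have sB y : y \in limg (vd A (m - 1) m) -> s m y \in limg (vd B (m - 1) m).
  by move/vinvK <-; rewrite -cs memv_limg.
have e1 : harm B m (s m x) = w m x.
  rewrite /w !comp_lfunE; apply/eqP; rewrite -subr_eq0 -!linearB; apply/eqP/harm_cob/sB.
  exact: harm_cocycle.
rewrite /quasi_inverse !comp_lfunE e1; set x' := (w m)^-1%VF (w m x).
have e2 : w m x' = w m x by apply: limg_lfunVK; apply: memv_limg.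
rewrite -[x](subrK (harm A m x)) -addrA; apply: memvD; first exact: harm_cocycle.
rewrite -linearB; apply: (qs m).1; first by rewrite memv_ker vd_harm.
rewrite -[s m _](subrK (harm B m (s m (harm A m (x - x'))))).
apply: memvD; first by apply: harm_cocycle; rewrite cs vd_harm linear0.
by have := e2; rewrite /w !comp_lfunE => e; rewrite !linearB /= e subrr mem0v.
Qed.

Lemma pre_surj C p (f : vhom A C) : vdeg p f -> delta p f = 0 ->
  exists f' : vhom B C, exists h : vhom A C,
    [/\ vdeg p f', delta p f' = 0, vdeg (p - 1) h & f - pre s f' = delta (p - 1) h].
Proof.
move=> degf df; pose f' : vhom B C := pre quasi_inverse f.
have df' : delta p f' = 0.
  apply: hv_eq => m n x; rewrite deltaE !preE -quasi_inverse_vd -deltaE df !hv0 //.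
have degf' : vdeg p f' by apply: vdeg_pre.
suff [h dh e] : exists2 h, vdeg (p - 1) h & f - pre s f' = delta (p - 1) h.
  by exists f', h.
apply: null_homotopic; first by apply: vdegB => //; apply: vdeg_pre.
  by rewrite linearB /= delta_pre // df df' linear0 subr0.
move=> m n x dx; rewrite hvB !preE -linearB.
exact/(closed_cob _ df)/quasi_inverseK.
Qed.

Lemma pre_inj C p (f : vhom B C) (h : vhom A C) : vdeg p f -> delta p f = 0 ->
  pre s f = delta (p - 1) h ->
  exists2 h', vdeg (p - 1) h' & f = delta (p - 1) h'.
Proof.
move=> degf df e; apply: null_homotopic => // m n y dy.
have [|x] := (qs m).2 y; first by rewrite memv_ker dy.
rewrite memv_ker => /eqP dx yx.
rewrite -[y](subrK (s m x)) linearD /=; apply: memvD; first exact: (closed_cob _ df).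
have -> : hv f m n (s m x) = hv (pre s f) m n x by rewrite preE.
by rewrite e deltaE dx linear0 scaler0 subr0 memv_limg.
Qed.
End QuasiIso.
End VectorComplexes.

(** * A model of RHom *)

Section DerivedHom.
Variables (k : fieldType) (Q : quiver).
Local Notation cpxQ := (cpx (rep_cat k Q)).
Implicit Types X Y Z : cpxQ.

Definition edge := (vert Q + arrow Q)%type.
Definition osrc (o : edge) := match o with inl i => i | inr a => src a end.
Definition otgt (o : edge) := match o with inl i => i | inr a => tgt a end.

Lemma dv_sq X i m n p x : dv X n p i (dv X m n i x) = 0.
Proof.
have := congr1 (fun f : rep_map (X m : rep k Q) (X p) => f i x) (cd_sq X m n p).
by rewrite /= zero_lfunE comp_lfunE.
Qed.

Lemma dv_shape X i m n : n <> m + 1 -> dv X m n i = 0.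
Proof. by move=> e; rewrite /dv cd_shape. Qed.

Definition at_vert X i : vcpx k :=
  @VCpx k (fun n => (X n : rep k Q) i) (fun m n => dv X m n i) (@dv_sq X i).

Definition xact X a n : 'Hom(vsp (at_vert X (src a)) n, vsp (at_vert X (tgt a)) n) :=
  ract (X n : rep k Q) a.

Lemma xact_chain X a : vchain (xact X a).
Proof. by move=> m n x; rewrite /xact /= /dv (famP (cd X m n : rep_map _ _)). Qed.

Lemma cv_xact X Y (f : chain_map X Y) a n x :
  cv f n (tgt a) (xact X a n x) = xact Y a n (cv f n (src a) x).
Proof. by rewrite /cv (famP (f n : rep_map _ _)). Qed.

Lemma cv_chain X Y (f : chain_map X Y) i :
  @vchain _ (at_vert X i) (at_vert Y i) (fun n => cv f n i).
Proof.
move=> m n x; have := congr1 (fun g : rep_map (X m : rep k Q) (Y n) => g i x) (famP f m n).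
by rewrite /= !comp_lfunE.
Qed.

Definition rhom_sp X Y (o : edge) : lmodType k := vhom (at_vert X (osrc o)) (at_vert Y (otgt o)).
(* Families of linear maps X^m_i -> Y^n_i and X^m_(src a) -> Y^n_(tgt a) for all [m] and [n].
   An element of degree [p] ([rdeg]) has n = m + p at vertices and n = m + p - 1 at arrows; a
   cocycle of degree 0 for [rdiff] is a family of chain maps at the vertices together with
   homotopies that make it compatible with the arrows. *)
Definition rhom X Y : lmodType k := linfam (@true_closed _ _ (rhom_sp X Y)).
Definition mkr X Y (F : forall o, rhom_sp X Y o) : rhom X Y :=
  @LinFam k _ (rhom_sp X Y) _ (@true_closed _ _ _) F I.
Definition rv X Y (f : rhom X Y) i : vhom (at_vert X i) (at_vert Y i) := f (inl i).
Definition ra X Y (f : rhom X Y) a : vhom (at_vert X (src a)) (at_vert Y (tgt a)) := f (inr a).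

Lemma rhom_eq X Y (f g : rhom X Y) : (forall i, rv f i = rv g i) ->
  (forall a, ra f a = ra g a) -> f = g.
Proof. by move=> e1 e2; apply: linfamE => -[i|a]; [exact: e1 | exact: e2]. Qed.

Definition rho X Y a (u : vhom (at_vert X (src a)) (at_vert Y (src a)))
    (v : vhom (at_vert X (tgt a)) (at_vert Y (tgt a))) :
    vhom (at_vert X (src a)) (at_vert Y (tgt a)) :=
  post (xact Y a) u - pre (xact X a) v.

Arguments rho {X Y} a u v.

Lemma rho_lin X Y a c u v u' v' :
  rho a (c *: u + u') (c *: v + v') =
  c *: (rho a u v : vhom (at_vert X _) (at_vert Y _)) + rho a u' v'.
Proof. by rewrite /rho !linearP /= addrACA -scalerDr. Qed.

Lemma rho0 X Y a : (rho a 0 0 : vhom (at_vert X _) (at_vert Y _)) = 0.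
Proof. by rewrite /rho !linear0 addr0. Qed.

Lemma rhoB X Y a u v u' v' : rho a (u - u') (v - v') =
  (rho a u v : vhom (at_vert X _) (at_vert Y _)) - rho a u' v'.
Proof.
have e (V : lmodType k) (x y : V) : x - y = -1 *: y + x by rewrite scaleN1r addrC.
by rewrite !e rho_lin.
Qed.

Lemma rho_delta X Y p a u v :
  rho a (delta p u) (delta p v) = delta p (rho a u v : vhom (at_vert X _) (at_vert Y _)).
Proof. by rewrite /rho linearB /= delta_post ?delta_pre //; apply: xact_chain. Qed.

Lemma vdeg_rho X Y p a u v :
  vdeg p u -> vdeg p v -> vdeg p (rho a u v : vhom (at_vert X _) (at_vert Y _)).
Proof. by move=> du dv; apply: vdegB; [apply: vdeg_post | apply: vdeg_pre]. Qed.

Definition rdiff p X Y (f : rhom X Y) : rhom X Y :=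
  mkr (fun o => match o return rhom_sp X Y o with
    | inl i => delta p (rv f i)
    | inr a => rho a (rv f (src a)) (rv f (tgt a)) - delta (p - 1) (ra f a)
    end).

Lemma rdiff_v p X Y (f : rhom X Y) i : rv (rdiff p f) i = delta p (rv f i). Proof. by []. Qed.
Lemma rdiff_a p X Y (f : rhom X Y) a :
  ra (rdiff p f) a = rho a (rv f (src a)) (rv f (tgt a)) - delta (p - 1) (ra f a).
Proof. by []. Qed.

Lemma rv_lin X Y i c (f g : rhom X Y) : rv (c *: f + g) i = c *: rv f i + rv g i.
Proof. by []. Qed.
Lemma ra_lin X Y a c (f g : rhom X Y) : ra (c *: f + g) a = c *: ra f a + ra g a.
Proof. by []. Qed.

Lemma rdiff_lin p X Y : linear (@rdiff p X Y).
Proof.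
move=> c f g; apply: rhom_eq => [i|a].
  by rewrite rdiff_v !rv_lin !rdiff_v linearP.
rewrite rdiff_a !rv_lin !ra_lin !rdiff_a rho_lin linearP scalerBr opprD addrACA //.
Qed.
HB.instance Definition _ p X Y :=
  GRing.isLinear.Build k (rhom X Y) (rhom X Y) *:%R (@rdiff p X Y) (@rdiff_lin p X Y).

Lemma rdiff_rdiff p X Y (f : rhom X Y) : rdiff p (rdiff (p - 1) f) = 0.
Proof.
apply: rhom_eq => [i|a]; first by rewrite !rdiff_v delta_delta.
rewrite rdiff_a !rdiff_v rho_delta rdiff_a; move: (rho a _ _) => u.
by rewrite deltaB delta_delta subr0 subrr.
Qed.

Definition rdeg p X Y (f : rhom X Y) :=
  (forall i, vdeg p (rv f i)) /\ (forall a, vdeg (p - 1) (ra f a)).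

Lemma vdeg0 (A C : vcpx k) p : vdeg p (0 : vhom A C). Proof. by move=> m n _ x; rewrite hv0. Qed.
Lemma vdeg_lin (A C : vcpx k) p c (f g : vhom A C) : vdeg p f -> vdeg p g -> vdeg p (c *: f + g).
Proof. by move=> df dg m n e x; rewrite hv_lin df // dg // scaler0 addr0. Qed.

Lemma rdeg_closed p X Y : lin_closed (V := rhom_sp X Y)
  (fun f => rdeg p (mkr f)).
Proof.
split=> [|c f g [f1 f2] [g1 g2]].
  by split=> [i|a]; apply: vdeg0.
by split=> [i|a]; apply: vdeg_lin.
Qed.

Lemma rdeg_lin p X Y c (f g : rhom X Y) : rdeg p f -> rdeg p g -> rdeg p (c *: f + g).
Proof. by move=> [f1 f2] [g1 g2]; split=> [i|a]; apply: vdeg_lin. Qed.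
Lemma rdeg0 p X Y : rdeg p (0 : rhom X Y).
Proof. by split=> [i|a]; apply: vdeg0. Qed.

Lemma rdeg_rdiff p X Y (f : rhom X Y) : rdeg (p - 1) f -> rdeg p (rdiff (p - 1) f).
Proof.
move=> [f1 f2]; split=> [i|a].
  by rewrite rdiff_v -{1}(subrK 1 p); apply: vdeg_delta.
rewrite rdiff_a; apply: vdegB; first exact: vdeg_rho.
by rewrite -{1}(subrK 1 (p - 1)); apply: vdeg_delta.
Qed.

Definition rexact p X Y (f : rhom X Y) := exists2 h, rdeg (p - 1) h & f = rdiff (p - 1) h.

Lemma rexact_lin p X Y c (f g : rhom X Y) : rexact p f -> rexact p g -> rexact p (c *: f + g).
Proof.
move=> [h dh ->] [l dl ->]; exists (c *: h + l); first exact: rdeg_lin.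
by rewrite linearP.
Qed.
Lemma rexact0 p X Y : rexact p (0 : rhom X Y).
Proof. by exists 0; [exact: rdeg0 | rewrite linear0]. Qed.
Lemma rexactD p X Y (f g : rhom X Y) : rexact p f -> rexact p g -> rexact p (f + g).
Proof. by rewrite -{2}[f]scale1r; apply: rexact_lin. Qed.
Lemma rexactZ p X Y c (f : rhom X Y) : rexact p f -> rexact p (c *: f).
Proof. by move=> ef; rewrite -[_ *: _]addr0; apply: rexact_lin => //; apply: rexact0. Qed.
Lemma rexactN p X Y (f : rhom X Y) : rexact p f -> rexact p (- f).
Proof. by rewrite -scaleN1r; apply: rexactZ. Qed.

Definition rpre X Y Z (s : chain_map X Y) (f : rhom Y Z) : rhom X Z :=
  mkr (fun o => pre (fun n => cv s n (osrc o) : 'Hom(vsp (at_vert X _) n, vsp (at_vert Y _) n))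
     (f o) : rhom_sp X Z o).

Lemma rpre_v X Y Z s (f : rhom Y Z) i :
  rv (@rpre X Y Z s f) i =
  pre (fun n => cv s n i : 'Hom(vsp (at_vert X i) n, vsp (at_vert Y i) n)) (rv f i).
Proof. by []. Qed.
Lemma rpre_a X Y Z s (f : rhom Y Z) a :
  ra (@rpre X Y Z s f) a =
  pre (fun n => cv s n (src a) : 'Hom(vsp (at_vert X _) n, vsp (at_vert Y _) n)) (ra f a).
Proof. by []. Qed.

Lemma rpre_lin X Y Z s : linear (@rpre X Y Z s).
Proof.
by move=> c f g; apply: rhom_eq => [i|a]; rewrite !(rpre_v, rpre_a, rv_lin, ra_lin) linearP.
Qed.
HB.instance Definition _ X Y Z s :=
  GRing.isLinear.Build k (rhom Y Z) (rhom X Z) *:%R (rpre s) (@rpre_lin X Y Z s).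

Lemma rho_pre X Y Z (s : chain_map X Y) a u v :
  rho a (pre (fun n => cv s n (src a) : 'Hom(vsp (at_vert X _) n, vsp (at_vert Y _) n)) u)
    (pre (fun n => cv s n (tgt a) : 'Hom(vsp (at_vert X _) n, vsp (at_vert Y _) n)) v) =
  pre (fun n => cv s n (src a) : 'Hom(vsp (at_vert X _) n, vsp (at_vert Y _) n)) 
    (rho a u v : vhom (at_vert Y _) (at_vert Z _)).
Proof.
by apply: hv_eq => m n x; rewrite /rho !(hvB, preE, postE) cv_xact.
Qed.

Lemma rdiff_pre p X Y Z (s : chain_map X Y) (f : rhom Y Z) :
  rdiff p (rpre s f) = rpre s (rdiff p f).
Proof.
apply: rhom_eq => [i|a].
  by rewrite rdiff_v !rpre_v rdiff_v delta_pre //; apply: cv_chain.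
by rewrite rdiff_a !(rpre_v, rpre_a) rdiff_a rho_pre delta_pre ?linearB //; apply: cv_chain.
Qed.

Lemma rdeg_pre p X Y Z (s : chain_map X Y) (f : rhom Y Z) : rdeg p f -> rdeg p (rpre s f).
Proof. by move=> [f1 f2]; split=> [i|a]; rewrite (rpre_v, rpre_a); apply: vdeg_pre. Qed.

Lemma rexact_pre p X Y Z (s : chain_map X Y) (f : rhom Y Z) : rexact p f -> rexact p (rpre s f).
Proof.
by move=> [h dh ->]; exists (rpre s h); [apply: rdeg_pre | rewrite rdiff_pre].
Qed.

Section QuasiIso.
Variables (X Y Z : cpxQ) (s : chain_map X Y).
Hypothesis qs : quasi_iso s.

Let qv i : @vqis _ (at_vert X i) (at_vert Y i) (fun n => cv s n i).
Proof. by move=> n; exact: qs. Qed.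

Local Notation sv i := (fun n => cv s n i : 'Hom(vsp (at_vert X i) n, vsp (at_vert Y i) n)).

Let surj i (C : vcpx k) p (f : vhom (at_vert X i) C) : vdeg p f -> delta p f = 0 ->
  exists f' : vhom (at_vert Y i) C, exists h : vhom (at_vert X i) C,
    [/\ vdeg p f', delta p f' = 0, vdeg (p - 1) h & f - pre (sv i) f' = delta (p - 1) h].
Proof. by apply: pre_surj; [apply: cv_chain | apply: qv]. Qed.

Let inj i (C : vcpx k) p (f : vhom (at_vert Y i) C) (h : vhom (at_vert X i) C) :
  vdeg p f -> delta p f = 0 -> pre (sv i) f = delta (p - 1) h ->
  exists2 h', vdeg (p - 1) h' & f = delta (p - 1) h'.
Proof. by apply: pre_inj; apply: qv. Qed.

Lemma rpre_surj p (f : rhom X Z) : rdeg p f -> rdiff p f = 0 ->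
  exists f' : rhom Y Z, [/\ rdeg p f', rdiff p f' = 0 & rexact p (f - rpre s f')].
Proof.
move=> [df1 df2] df.
have cv_ i : delta p (rv f i) = 0 by rewrite -rdiff_v df.
have ca a : rho a (rv f (src a)) (rv f (tgt a)) = delta (p - 1) (ra f a).
  by apply/eqP; rewrite -subr_eq0 -rdiff_a df.
have /dep_choice[f' /dep_choice[h hP]] := fun i => surj (df1 i) (cv_ i).
have crho a : delta p (rho a (f' (src a)) (f' (tgt a))) = 0.
  have [_ e1 _ _] := hP (src a); have [_ e2 _ _] := hP (tgt a).
  by rewrite -rho_delta e1 e2 rho0.
have prho a : pre (sv (src a)) (rho a (f' (src a)) (f' (tgt a))) =
    delta (p - 1) (ra f a - rho a (h (src a)) (h (tgt a))).
  have [_ _ _ e1] := hP (src a); have [_ _ _ e2] := hP (tgt a).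
  by rewrite deltaB -ca -rho_delta -e1 -e2 rhoB rho_pre opprB addrC subrK.
have drho a : vdeg p (rho a (f' (src a)) (f' (tgt a))).
  by apply: vdeg_rho; [have [] := hP (src a) | have [] := hP (tgt a)].
have /dep_choice[g gP] : forall a, exists g : vhom (at_vert Y (src a)) (at_vert Z (tgt a)),
    vdeg (p - 1) g /\ rho a (f' (src a)) (f' (tgt a)) = delta (p - 1) g.
  by move=> a; have [g dg e] := inj (drho a) (crho a) (prho a); exists g.
have /dep_choice[g' /dep_choice[l lP]] : forall a,
    exists g' : vhom (at_vert Y (src a)) (at_vert Z (tgt a)),
    exists l : vhom (at_vert X (src a)) (at_vert Z (tgt a)),
    [/\ vdeg (p - 1) g', delta (p - 1) g' = 0, vdeg (p - 1 - 1) l &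
      ra f a - rho a (h (src a)) (h (tgt a)) - pre (sv (src a)) (g a) - pre (sv (src a)) g'
      = delta (p - 1 - 1) l].
  move=> a; have [dg eg] := gP a; apply: surj.
    apply: vdegB; last exact: vdeg_pre.
    apply: vdegB => //.
    by apply: vdeg_rho; [have [_ _ //] := hP (src a) | have [_ _ //] := hP (tgt a)].
  by rewrite deltaB -prho delta_pre ?eg ?subrr //; apply: cv_chain.
exists (mkr (fun o => match o return rhom_sp Y Z o with
   inl i => f' i | inr a => g a + g' a end)); split.
- split=> [i|a]; first by have [] := hP i.
  by apply: vdegD; [have [] := gP a | have [] := lP a].
- apply: rhom_eq => [i|a]; first by rewrite rdiff_v; have [] := hP i.
  rewrite rdiff_a /rv /ra /= deltaD; have [_ -> _ _] := lP a.
  by have [_ ->] := gP a; rewrite addr0 subrr.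
exists (mkr (fun o => match o return rhom_sp X Z o with
   inl i => h i | inr a => - l a end)).
  by split=> [i|a]; [have [] := hP i | apply: vdegN; have [] := lP a].
apply: rhom_eq => [i|a].
  by rewrite rdiff_v; have [_ _ _ <-] := hP i.
rewrite rdiff_a -[ra (mkr _) a]/(- l a) linearN /= opprK.
have [_ _ _ <-] := lP a.
change (ra f a - pre (sv (src a)) (g a + g' a) = rho a (h (src a)) (h (tgt a)) +
  (ra f a - rho a (h (src a)) (h (tgt a)) - pre (sv (src a)) (g a) - pre (sv (src a)) (g' a))).
move: (rho a _ _) => u.
by rewrite preD opprD -!addrA [RHS]addrCA addNKr.
Qed.

Lemma rpre_inj p (f : rhom Y Z) : rdeg p f -> rdiff p f = 0 -> rexact p (rpre s f) -> rexact p f.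
Proof.
move=> [df1 df2] df [kl [dk1 dk2] e].
have cv_ i : delta p (rv f i) = 0 by rewrite -rdiff_v df.
have ca a : rho a (rv f (src a)) (rv f (tgt a)) = delta (p - 1) (ra f a).
  by apply/eqP; rewrite -subr_eq0 -rdiff_a df.
have ev i : pre (sv i) (rv f i) = delta (p - 1) (rv kl i).
  by rewrite -rdiff_v -e rpre_v.
have ea a : pre (sv (src a)) (ra f a) =
    rho a (rv kl (src a)) (rv kl (tgt a)) - delta (p - 1 - 1) (ra kl a).
  by rewrite -rdiff_a -e rpre_a.
have /dep_choice[h hP] : forall i, exists h : vhom (at_vert Y i) (at_vert Z i), exists m,
    [/\ vdeg (p - 1) h, rv f i = delta (p - 1) h, vdeg (p - 1 - 1) m &
        rv kl i = pre (sv i) h + delta (p - 1 - 1) m].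
  move=> i; have [h' dh' eh'] := inj (df1 i) (cv_ i) (ev i).
  have [||h'' [m [dh'' eh'' dm em]]] := @surj i _ (p - 1) (rv kl i - pre (sv i) h').
  - by apply: vdegB => //; apply: vdeg_pre.
  - by rewrite deltaB -ev eh' delta_pre ?subrr //; apply: cv_chain.
  exists (h' + h''), m; split=> //; first exact: vdegD.
    by rewrite deltaD eh'' addr0.
  by rewrite -em preD -[_ - pre _ h' - _]addrA -opprD [RHS]addrC subrK.
have {hP}/dep_choice[m hP] := hP.
have /dep_choice[l lP] : forall a, exists l : vhom (at_vert Y (src a)) (at_vert Z (tgt a)),
    vdeg (p - 1 - 1) l /\ ra f a - rho a (h (src a)) (h (tgt a)) = delta (p - 1 - 1) l.
  move=> a; have [dh1 e1 dm1 k1] := hP (src a); have [dh2 e2 dm2 k2] := hP (tgt a).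
  have [|||l dl el] := @inj (src a) _ (p - 1) (ra f a - rho a (h (src a)) (h (tgt a)))
    (rho a (m (src a)) (m (tgt a)) - ra kl a).
  - by apply: vdegB => //; apply: vdeg_rho.
  - by rewrite deltaB -ca e1 e2 rho_delta subrr.
  - rewrite preB ea k1 k2 -rho_pre deltaB -rho_delta.
    have -> : rho a (pre (sv (src a)) (h (src a)) + delta (p - 1 - 1) (m (src a)))
         (pre (sv (tgt a)) (h (tgt a)) + delta (p - 1 - 1) (m (tgt a))) =
       rho a (pre (sv (src a)) (h (src a))) (pre (sv (tgt a)) (h (tgt a))) +
       rho a (delta (p - 1 - 1) (m (src a))) (delta (p - 1 - 1) (m (tgt a))).
      by rewrite -[pre (sv (src a)) _]scale1r -[pre (sv (tgt a)) _]scale1r rho_lin !scale1r.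
    by rewrite addrAC [X in X - _ - _]addrC addrK.
  by exists l.
exists (mkr (fun o => match o return rhom_sp Y Z o with
   inl i => h i | inr a => - l a end)).
  by split=> [i|a]; [have [] := hP i | apply: vdegN; have [] := lP a].
apply: rhom_eq => [i|a]; first by rewrite rdiff_v; have [] := hP i.
rewrite rdiff_a -[ra (mkr _) a]/(- l a) linearN /= opprK.
by have [_ <-] := lP a; rewrite addrC subrK.
Qed.
End QuasiIso.
End DerivedHom.

(** * Complexes of abstract finite dimensional representations *)

Section Realization.
Variables (k : fieldType) (Q : quiver).
Local Notation cpxQ := (cpx (rep_cat k Q)).
Implicit Types X Y : cpxQ.

Record lcpx := LCpx {
  lsp : int -> vert Q -> lmodType k;
  lact : forall n a, {linear lsp n (src a) -> lsp n (tgt a)};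
  ld : forall m n i, {linear lsp m i -> lsp n i};
  ld_shape : forall m n i x, n <> m + 1 -> ld m n i x = 0;
  ld_sq : forall m n p i x, ld n p i (ld m n i x) = 0;
  ld_act : forall m n a x, ld m n (tgt a) (lact m a x) = lact n a (ld m n (src a) x);
  lsp_findim : forall n i, findim (lsp n i);
  lsp_bounded : exists N : int, forall n : int, N < `|n| -> forall i (x : lsp n i), x = 0 }.

Lemma findim_coords (V : lmodType k) : findim V ->
  exists fg : {linear V -> 'rV[k]_(dimk V)} * {linear 'rV[k]_(dimk V) -> V},
    cancel fg.1 fg.2 /\ cancel fg.2 fg.1.
Proof.
by move=> /findim_dimk[f /linear_inverse[g fK gK]]; exists (f, g).
Qed.

Section Real.
Variable L : lcpx.

Definition ltor n i := (projT1 (cid (findim_coords (lsp_findim L n i)))).1.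
Definition lofr n i := (projT1 (cid (findim_coords (lsp_findim L n i)))).2.

Lemma ltorK n i : cancel (ltor n i) (lofr n i).
Proof. by rewrite /ltor /lofr; case: cid => fg []. Qed.
Lemma lofrK n i : cancel (lofr n i) (ltor n i).
Proof. by rewrite /ltor /lofr; case: cid => fg []. Qed.

Definition real_rep n : rep k Q :=
  @Rep k Q (fun i => dimk (lsp L n i))
    (fun a => linfun (ltor n (tgt a) \o lact L n a \o lofr n (src a))).

Lemma real_repE n a x : ract (real_rep n) a x = ltor n (tgt a) (lact L n a (lofr n (src a) x)).
Proof. by rewrite lfunE. Qed.

Definition real_dmap m n i : 'Hom(real_rep m i, real_rep n i) :=
  linfun (ltor n i \o ld L m n i \o lofr m i).

Lemma real_dmapE m n i x : real_dmap m n i x = ltor n i (ld L m n i (lofr m i x)).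
Proof. by rewrite lfunE. Qed.

Lemma real_d_subproof m n : @is_rep_map k Q (real_rep m) (real_rep n) (real_dmap m n).
Proof. by move=> a v; rewrite !real_repE !real_dmapE !ltorK ld_act. Qed.

Definition real_d m n : rep_map (real_rep m) (real_rep n) :=
  LinFam (rep_map_closed _ _) (@real_d_subproof m n).

Lemma real_shape m n : n <> m + 1 -> real_d m n = 0.
Proof.
move=> e; apply: linfamE => i; apply/lfunP => x.
by rewrite [LHS]real_dmapE zero_lfunE ld_shape // linear0.
Qed.

Lemma real_sq m n p : @Defs.comp k (rep_cat k Q) _ _ _ (real_d n p) (real_d m n) = 0.
Proof.
apply: linfamE => i; apply/lfunP => x.
by rewrite comp_lfunE zero_lfunE [LHS]real_dmapE real_dmapE ltorK ld_sq linear0.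
Qed.

Lemma real_bounded : exists N : int, forall n : int,
  N < `|n| -> @idm k (rep_cat k Q) (real_rep n) = 0.
Proof.
have [N hN] := lsp_bounded L; exists N => n /hN L0; apply: linfamE => i; apply/lfunP => x.
by rewrite id_lfunE zero_lfunE -(lofrK x) (L0 i (lofr n i x)) linear0.
Qed.

Definition real : cpxQ := @Cpx k (rep_cat k Q) real_rep real_d real_shape real_sq real_bounded.

Lemma lofr_dv m n i (x : (real m : rep k Q) i) :
  lofr n i (dv real m n i x) = ld L m n i (lofr m i x).
Proof. by rewrite [dv _ _ _ _ _]real_dmapE ltorK. Qed.

Lemma lofr_act n a (x : (real n : rep k Q) (src a)) :
  lofr n (tgt a) (ract (real n : rep k Q) a x) = lact L n a (lofr n (src a) x).
Proof. by rewrite [ract _ _ _]real_repE ltorK. Qed.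

Lemma lofr_vd m n i (x : vsp (at_vert real i) m) :
  lofr n i (vd (at_vert real i) m n x) = ld L m n i (lofr m i x).
Proof. exact: lofr_dv. Qed.

Lemma lofr_xact n a (x : vsp (at_vert real (src a)) n) :
  lofr n (tgt a) (xact real a n x) = lact L n a (lofr n (src a) x).
Proof. exact: lofr_act. Qed.

Lemma lofr_inj n i (x y : (real n : rep k Q) i) : lofr n i x = lofr n i y -> x = y.
Proof. exact: (can_inj (@lofrK n i)). Qed.

Section Lift.
Variables (X : cpxQ) (phi : forall n i, {linear ((X n : rep k Q) i) -> lsp L n i}).
Hypothesis phi_act : forall n a x,
  phi n (tgt a) (ract (X n : rep k Q) a x) = lact L n a (phi n (src a) x).
Hypothesis phi_d : forall m i x, phi (m + 1) i (dv X m (m + 1) i x) = ld L m (m + 1) i (phi m i x).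

Definition chain_to_fun n i : 'Hom((X n : rep k Q) i, (real n : rep k Q) i) :=
  linfun (ltor n i \o phi n i).

Lemma chain_to_funE n i x : chain_to_fun n i x = ltor n i (phi n i x).
Proof. by rewrite lfunE. Qed.

Lemma chain_to_subproof1 n : @is_rep_map k Q (X n) (real n) (chain_to_fun n).
Proof.
by move=> a v; apply: lofr_inj; rewrite lofr_act !chain_to_funE !ltorK phi_act.
Qed.

Definition chain_to_rep n : Defs.hom (rep_cat k Q) (X n) (real n) :=
  LinFam (rep_map_closed _ _) (@chain_to_subproof1 n).

Lemma chain_to_subproof2 : @is_chain_map k (rep_cat k Q) X real chain_to_rep.
Proof.
move=> m n; apply: linfamE => i; apply/lfunP => x; rewrite !comp_lfunE.
apply: lofr_inj; rewrite [LHS]lofr_dv [chain_to_rep m i x]chain_to_funE.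
rewrite [chain_to_rep n i _]chain_to_funE !ltorK.
have [e|/eqP e] := eqVneq n (m + 1); first by subst n; rewrite -phi_d.
rewrite ld_shape // -[(cd X m n : rep_map (X m) (X n)) i]/(dv X m n i).
by rewrite dv_shape // zero_lfunE linear0.
Qed.

Definition chain_to : chain_map X real := LinFam (chain_map_closed _ _) chain_to_subproof2.

Lemma lofr_chain_to n i x : lofr n i (cv chain_to n i x) = phi n i x.
Proof. by rewrite [cv _ _ _ _]chain_to_funE ltorK. Qed.

Lemma quasi_iso_chain_to :
  (forall n i x v, dv X n (n + 1) i x = 0 -> phi n i x = ld L (n - 1) n i v ->
     x \in limg (dv X (n - 1) n i)) ->
  (forall n i v, ld L n (n + 1) i v = 0 -> exists2 x, dv X n (n + 1) i x = 0 &
     exists v', v - phi n i x = ld L (n - 1) n i v') ->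
  quasi_iso chain_to.
Proof.
move=> hi hs n i; split=> [x|y].
  rewrite memv_ker => /eqP dx /memv_imgP[v _ e]; apply: (hi n i x (lofr _ _ v)) => //.
  by rewrite -lofr_chain_to e lofr_dv.
rewrite memv_ker => /eqP dy; have [|x dx [v' e]] := hs n i (lofr _ _ y).
  by rewrite -lofr_dv dy linear0.
exists x; first by rewrite memv_ker dx.
apply/memv_imgP; exists (ltor (n - 1) i v'); first exact: memvf.
by apply: lofr_inj; rewrite lofr_dv ltorK -e linearB /= lofr_chain_to.
Qed.
End Lift.

Lemma quasi_iso_acyclic :
  (forall n i v, ld L n (n + 1) i v = 0 -> exists v', v = ld L (n - 1) n i v') ->
  quasi_iso (0 : chain_map real real).
Proof.
move=> h.
have kerB n i x : x \in cocycles real n i -> x \in coboundaries real n i.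
  rewrite memv_ker => /eqP dx; have [|v' e] := h n i (lofr _ _ x).
    by rewrite -lofr_dv dx linear0.
  apply/memv_imgP; exists (ltor (n - 1) i v'); first exact: memvf.
  by apply: lofr_inj; rewrite lofr_dv ltorK.
move=> n i; split=> [x xZ _|y yZ]; first exact: kerB.
exists 0; first exact: mem0v.
by rewrite linear0 subr0; apply: kerB.
Qed.
End Real.

Lemma cpx_zero X : exists N : int, forall n : int, N < `|n| ->
  forall i (x : (X n : rep k Q) i), x = 0.
Proof.
have [N hN] := cpx_bounded X; exists N => n /hN id0 i x.
have := congr1 (fun f : rep_map (X n) (X n) => f i x) id0.
by rewrite /= id_lfunE zero_lfunE.
Qed.
End Realization.

Section Cast.
Variables (k : fieldType) (I : eqType).
Implicit Type V : I -> vectType k.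

(* The identity of [V i] when [i = j], and zero otherwise. *)
Definition cast V i j : 'Hom(V i, V j) :=
  if i =P j is ReflectT e then eq_rect i (fun z => 'Hom(V i, V z)) \1%VF j e else 0.

Lemma cast_id V i x : cast V i i x = x.
Proof.
rewrite /cast; case: eqP => // e.
by rewrite (eq_irrelevance e erefl) id_lfunE.
Qed.

Lemma cast_neq V i j x : i <> j -> cast V i j x = 0.
Proof. by rewrite /cast; case: eqP => // _ _; rewrite zero_lfunE. Qed.

Lemma cast_nat V (W : I -> vectType k) (f : forall i, 'Hom(V i, W i)) i j x :
  f j (cast V i j x) = cast W i j (f i x).
Proof.
have [e|/eqP e] := eqVneq i j; first by subst j; rewrite !cast_id.
by rewrite !cast_neq // linear0.
Qed.
End Cast.

Section Paths.
Variables (k : fieldType) (Q : quiver).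
Implicit Types V W : rep k Q.

Fixpoint ispath (p : seq (arrow Q)) (j i : vert Q) : bool :=
  if p is a :: p' then (src a == j) && ispath p' (tgt a) i else j == i.

Lemma ispath_rcons p a j i : ispath (rcons p a) j i = ispath p j (src a) && (tgt a == i).
Proof.
elim: p j => [|b p IH] j /=; first by rewrite eq_sym.
by rewrite IH andbA.
Qed.

Fixpoint pact V (p : seq (arrow Q)) (j i : vert Q) : 'Hom(V j, V i) :=
  if p is a :: p' then (pact V p' (tgt a) i \o (ract V a \o cast (rsp V) j (src a)))%VF
  else cast (rsp V) j i.

Lemma pact_cons V b p i x : pact V (b :: p) (src b) i x = pact V p (tgt b) i (ract V b x).
Proof. by rewrite /= !comp_lfunE cast_id. Qed.

Lemma pact_rcons V p a j x : pact V (rcons p a) j (tgt a) x = ract V a (pact V p j (src a) x).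
Proof.
elim: p j x => [|b p IH] j x; rewrite /= !comp_lfunE ?cast_id //.
Qed.

Lemma pact_nat V W (f : rep_map V W) p j i x : f i (pact V p j i x) = pact W p j i (f j x).
Proof.
elim: p j x => [|b p IH] j x /=; first exact: (@cast_nat _ _ (rsp V) (rsp W) (fun i => f i)).
by rewrite !comp_lfunE IH (famP f) (@cast_nat _ _ (rsp V) (rsp W) (fun i => f i)).
Qed.

Lemma pact_nopath V p j i x : ~~ ispath p j i -> pact V p j i x = 0.
Proof.
elim: p j x => [|b p IH] j x /=; first by move/eqP => e; rewrite cast_neq.
rewrite !comp_lfunE negb_and => /orP[/eqP e|np]; last by rewrite IH.
by rewrite cast_neq ?linear0 //; apply: nesym.
Qed.
End Paths.

(** * The injective resolution *)

Lemma dv_act (k : fieldType) (Q : quiver) (X : cpx (rep_cat k Q)) m n a x :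
  dv X m n (tgt a) (ract (X m : rep k Q) a x) = ract (X n : rep k Q) a (dv X m n (src a) x).
Proof. exact: (@xact_chain k Q X a m n x). Qed.

Section Resolution.
Variables (k : fieldType) (Q : quiver).
Local Notation cpxQ := (cpx (rep_cat k Q)).
Local Notation arrows := (seq (arrow Q)).
Variable path_list : seq arrows.
Hypothesis path_listP : forall p j i, @ispath Q p j i -> p \in path_list.
Variable Y : cpxQ.

Definition odeg (o : edge Q) : int := match o with inl _ => 0 | inr _ => 1 end.

Definition ridx := (arrows * edge Q * int)%type.
Definition rsp_at (t : ridx) : lmodType k := (Y t.2 : rep k Q) (otgt t.1.2).
Definition rsupp n j (p : arrows) (o : edge Q) (l : int) :=
  ispath p j (osrc o) && (l == n - odeg o).

Definition rsupported n j (f : forall t, rsp_at t) :=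
  forall p o l, ~~ rsupp n j p o l -> f (p, o, l) = 0.

Lemma rsupported_closed n j : lin_closed (@rsupported n j).
Proof.
by split=> [//|a f g hf hg p o l h]; rewrite hf // hg // scaler0 addr0.
Qed.

(* The component [(p, o, l)] is a value in Y^l at the target of [o], for a path [p] from [j] to
   the source of [o].  Arrows act by shortening the path, so that each term is a sum of cofree,
   hence injective, representations; the support condition allows the index to range over all
   triples. *)
Definition res_sp n j : lmodType k := linfam (@rsupported_closed n j).
Definition rc n j (f : res_sp n j) p o l : (Y l : rep k Q) (otgt o) := f (p, o, l).

Definition mk_res n j (F : forall p o l, (Y l : rep k Q) (otgt o))
    (hF : forall p o l, ~~ rsupp n j p o l -> F p o l = 0) : res_sp n j :=
  @LinFam k _ rsp_at _ (@rsupported_closed n j) (fun t => F t.1.1 t.1.2 t.2) hF.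

Lemma rc_supp n j (f : res_sp n j) p o l : ~~ rsupp n j p o l -> rc f p o l = 0.
Proof. exact: (famP f). Qed.

Lemma res_eq n j (f g : res_sp n j) :
  (forall p o l, rsupp n j p o l -> rc f p o l = rc g p o l) -> f = g.
Proof.
move=> h; apply: linfamE => -[[p o] l].
case: (boolP (rsupp n j p o l)) => [/h //|s].
by rewrite -[LHS]/(rc f p o l) -[RHS]/(rc g p o l) !rc_supp.
Qed.

Lemma rc_lin n j c (f g : res_sp n j) p o l : rc (c *: f + g) p o l = c *: rc f p o l + rc g p o l.
Proof. by []. Qed.

Lemma res_act_subproof n b (f : res_sp n (src b)) p o l :
  ~~ rsupp n (tgt b) p o l -> rc f (b :: p) o l = 0.
Proof. by move=> s; apply: rc_supp; rewrite /rsupp /= eqxx. Qed.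

Lemma res_act_lin n b : linear (fun f => mk_res (@res_act_subproof n b f)).
Proof. by move=> c f g; apply: linfamE. Qed.
Definition res_act n b : {linear res_sp n (src b) -> res_sp n (tgt b)} :=
  mk_linear (@res_act_lin n b).

Lemma rc_act n b f p o l : rc (res_act n b f) p o l = rc f (b :: p) o l.
Proof. by []. Qed.

Definition res_d_fun m j (f : res_sp m j) p (o : edge Q) l : (Y l : rep k Q) (otgt o) :=
  match o return (Y l : rep k Q) (otgt o) with
  | inl i => dv Y (l - 1) l i (rc f p (inl i) (l - 1))
  | inr a => ract (Y l : rep k Q) a (rc f p (inl (src a)) l) - rc f (rcons p a) (inl (tgt a)) l
             - dv Y (l - 1) l (tgt a) (rc f p (inr a) (l - 1))
  end.

Lemma res_d_subproof m n j (f : res_sp m j) p o l : ~~ rsupp n j p o l ->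
  (if n == m + 1 then res_d_fun f p o l else 0) = 0.
Proof.
case: eqP => // -> ; case: o => [i|a] /=; rewrite /rsupp /= ?subr0 => s.
  rewrite rc_supp ?linear0 // /rsupp /= subr0; apply: contra s => /andP[-> /eqP <-].
  by rewrite subrK eqxx.
rewrite addrK in s.
have sl : (l - 1 == m - 1) = (l == m) by rewrite (inj_eq (addIr _)).
rewrite !rc_supp ?linear0 ?subr0 ?subrr ?addr0 // /rsupp /=;
  by rewrite ?ispath_rcons ?eqxx ?andbT ?subr0 ?sl.
Qed.

Lemma res_d_lin m n j : linear (fun f => mk_res (@res_d_subproof m n j f)).
Proof.
move=> c f g; apply: linfamE => -[[p o] l] /=.
case: eqP => _; last by rewrite scaler0 addr0.
case: o => [i|a]; rewrite /res_d_fun !rc_lin !linearP //=.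
rewrite [X in X + _ = _]addrACA [LHS]addrACA.
by rewrite -!scalerDr.
Qed.
Definition res_d m n j : {linear res_sp m j -> res_sp n j} := mk_linear (@res_d_lin m n j).

Lemma rc_d m j f p o l : rc (res_d m (m + 1) j f) p o l = res_d_fun f p o l.
Proof. by rewrite {1}/rc /= eqxx. Qed.

Lemma rc_dB m j f p o l : rc (res_d (m - 1) m j f) p o l = res_d_fun f p o l.
Proof. by rewrite {1}/rc /= subrK eqxx. Qed.

Lemma res_d_shape m n j f : n <> m + 1 -> res_d m n j f = 0.
Proof.
move=> /eqP/negbTE e; apply: res_eq => p o l _.
by rewrite {1}/rc /= e.
Qed.

Lemma res_d_sq m n p j f : res_d n p j (res_d m n j f) = 0.
Proof.
have [->|/eqP e] := eqVneq n (m + 1); last by rewrite (res_d_shape f e) linear0.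
have [->|/eqP e] := eqVneq p (m + 1 + 1); last by rewrite res_d_shape.
apply: res_eq => q o l _; rewrite rc_d [RHS]/(rc 0 q o l).
case: o => [i|a]; rewrite /res_d_fun !rc_d /res_d_fun; first exact: dv_sq.
rewrite [dv _ _ _ _ (_ - _ - _)]linearB /= [dv _ _ _ _ (_ - _)]linearB /=.
by rewrite dv_sq subr0 dv_act subrr.
Qed.

Lemma res_d_act m n b f : res_d m n (tgt b) (res_act m b f) = res_act n b (res_d m n (src b) f).
Proof.
have [->|/eqP e] := eqVneq n (m + 1); last by rewrite !(res_d_shape _ e) linear0.
by apply: res_eq => p o l _; rewrite rc_act !rc_d; case: o => [i|a].
Qed.

Lemma res_findim n j : findim (res_sp n j).
Proof.
pose s := undup [seq t <- [seq (p, o, n - odeg o) | p <- path_list, o <- enum {: vert Q + arrow Q}]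
                | ispath t.1.1 j (osrc t.1.2)].
exists (\sum_(t <- s) rdim (Y t.2 : rep k Q) (otgt t.1.2)).
apply: (linfam_ext (h := supported_closed rsp_at s)); last first.
  apply: hasdim_family; first exact: undup_uniq.
  move=> t _; exists (mk_linear (f := id) (fun _ _ _ => erefl)).
  by exists id.
have sE p o l : ((p, o, l) \in s) = rsupp n j p o l.
  rewrite mem_undup mem_filter /rsupp /=; case: (boolP (ispath _ _ _)) => //= hp.
  apply/allpairsP/eqP => [[[p' o'] /= [_ _ [_ <- ->]]] //|->].
  by exists (p, o); split=> //=; [apply: path_listP hp | rewrite mem_enum].
by move=> f; split=> h => [p o l|[[p o] l]]; [rewrite -sE | rewrite sE]; apply: h.
Qed.

Lemma res_bounded : exists N : int, forall n : int, N < `|n| -> forall j (f : res_sp n j), f = 0.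
Proof.
have [N hN] := cpx_zero Y; exists (N + 1) => n hn j f.
apply: res_eq => p o l /andP[_ /eqP e]; rewrite [LHS](hN l) ?[RHS](hN l) //;
  rewrite e -(ltrD2r 1) (lt_le_trans hn) // -{1}(subrK (odeg o) n);
  apply: le_trans (ler_normD _ _) _; rewrite lerD2l; by case: (o).
Qed.

Definition res : lcpx k Q := LCpx res_d_shape res_d_sq res_d_act res_findim res_bounded.
Definition resolution : cpxQ := real res.

Lemma res_eval_lin n (o : edge Q) l :
  linear (fun v : (resolution n : rep k Q) (osrc o) => rc (lofr res n (osrc o) v) [::] o l).
Proof. by move=> c u v; rewrite linearP. Qed.

Definition res_eval : rhom resolution Y := mkr (fun o =>
  mkv (fun n l => linfun (mk_linear (@res_eval_lin n o l)) :
    'Hom(vsp (at_vert resolution (osrc o)) n, vsp (at_vert Y (otgt o)) l))).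

Lemma res_evalE n (o : edge Q) l v :
  hv (res_eval o : vhom (at_vert resolution (osrc o)) (at_vert Y (otgt o))) n l v =
  rc (lofr res n (osrc o) v) [::] o l.
Proof. by rewrite [hv _ _ _]/(linfun _) lfunE. Qed.

Lemma res_evalV n i l v : hv (rv res_eval i) n l v = rc (lofr res n i v) [::] (inl i) l.
Proof. exact: (@res_evalE n (inl i) l v). Qed.
Lemma res_evalA n a l v : hv (ra res_eval a) n l v = rc (lofr res n (src a) v) [::] (inr a) l.
Proof. exact: (@res_evalE n (inr a) l v). Qed.

Lemma rdeg_res_eval : rdeg 0 res_eval.
Proof.
split=> [i|a] m n e x; rewrite (res_evalV, res_evalA) rc_supp // /rsupp /= eqxx /=; apply/eqP.
  by rewrite subr0 => en; apply: e; rewrite en addr0.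
by rewrite sub0r in e.
Qed.

Lemma rdiff_res_eval : rdiff 0 res_eval = 0.
Proof.
apply: rhom_eq => [i|a]; apply: hv_eq => m n x.
  rewrite rdiff_v deltaE !res_evalV hv0 lofr_vd rc_d /= scale1r subrr //.
rewrite rdiff_a hvB deltaE hvB postE preE !(res_evalV, res_evalA) hv0.
rewrite lofr_xact lofr_vd rc_d /=.
by rewrite sub0r sgN1 scaleN1r opprK [X in _ - X]addrC subrK subrr.
Qed.

Lemma res_eval_pact n p j (o : edge Q) l (v : (resolution n : rep k Q) j) :
  rc (lofr res n (osrc o) (pact (resolution n : rep k Q) p j (osrc o) v)) [::] o l =
  rc (lofr res n j v) p o l.
Proof.
elim: p j v => [|b p IH] j v.
  have [e|/eqP e] := eqVneq j (osrc o); first by subst j; rewrite /= cast_id.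
  rewrite /= cast_neq // linear0 [RHS]rc_supp //.
  by rewrite /rsupp /= negb_and; move/eqP: e => ->.
have [e|/eqP e] := eqVneq (src b) j.
  by subst j; rewrite pact_cons IH lofr_act rc_act.
have np : ~~ ispath (b :: p) j (osrc o) by rewrite /= negb_and; move/eqP: e => ->.
by rewrite pact_nopath // linear0 [RHS]rc_supp // /rsupp negb_and np.
Qed.

Section LiftToRes.
Variables (X : cpxQ) (f : rhom X Y).
Hypotheses (df : rdeg 0 f) (cf : rdiff 0 f = 0).

Definition res_lift_fun n j (x : (X n : rep k Q) j) p (o : edge Q) l : (Y l : rep k Q) (otgt o) :=
  hv (f o : vhom (at_vert X (osrc o)) (at_vert Y (otgt o))) n l
     (pact (X n : rep k Q) p j (osrc o) x).

Lemma res_lift_subproof n j (x : (X n : rep k Q) j) p o l :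
  ~~ rsupp n j p o l -> res_lift_fun x p o l = 0.
Proof.
rewrite /rsupp /res_lift_fun negb_and => /orP[np|/eqP e].
  by rewrite pact_nopath // linear0.
have [d1 d2] := df; case: o e => [i|a] /= e.
  by apply: d1 => en; apply: e; rewrite en !addr0.
by apply: d2 => en; apply: e; rewrite en sub0r.
Qed.

Lemma res_lift_lin n j : linear (fun x => mk_res (@res_lift_subproof n j x)).
Proof. by move=> c x y; apply: linfamE => t; rewrite /= /res_lift_fun !linearP. Qed.

Definition res_lift_phi n j : {linear (X n : rep k Q) j -> lsp res n j} :=
  mk_linear (@res_lift_lin n j).

Lemma rc_lift n j x p (o : edge Q) l : rc (res_lift_phi n j x) p o l =
  hv (f o : vhom (at_vert X (osrc o)) (at_vert Y (otgt o))) n l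
     (pact (X n : rep k Q) p j (osrc o) x).
Proof. by []. Qed.

Lemma res_lift_act n a x :
  res_lift_phi n (tgt a) (ract (X n : rep k Q) a x) = lact res n a (res_lift_phi n (src a) x).
Proof. by apply: res_eq => p o l _; rewrite rc_act !rc_lift pact_cons. Qed.

Lemma pact_dv m n p j i x :
  pact (X n : rep k Q) p j i (dv X m n j x) = dv X m n i (pact (X m : rep k Q) p j i x).
Proof. by rewrite -(pact_nat (cd X m n)). Qed.

Lemma res_lift_d m j x :
  res_lift_phi (m + 1) j (dv X m (m + 1) j x) = ld res m (m + 1) j (res_lift_phi m j x).
Proof.
apply: res_eq => p o l _; rewrite rc_d rc_lift pact_dv.
case: o => [i|a]; rewrite /res_d_fun !rc_lift.
  have := deltaE 0 (rv f i) (m := m) l (pact (X m : rep k Q) p j i x).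
  by rewrite -rdiff_v cf hv0 scale1r => /esym/eqP; rewrite subr_eq0 => /eqP ->.
rewrite pact_rcons.
set y := pact _ _ _ _ _.
have := congr1 (fun g => hv (ra g a) m l y) cf.
rewrite rdiff_a hvB deltaE hvB postE preE hv0 sub0r sgN1 scaleN1r opprK.
by move/eqP; rewrite subr_eq0 => /eqP ->; rewrite [X in _ = X - _]addrC addrK.
Qed.

Definition res_lift : chain_map X resolution := chain_to res_lift_act res_lift_d.

Lemma rpre_res_lift : rpre res_lift res_eval = f.
Proof.
apply: rhom_eq => [i|a]; apply: hv_eq => m n x.
  by rewrite rpre_v preE res_evalV [lofr _ _ _ _]lofr_chain_to rc_lift /= cast_id.
by rewrite rpre_a preE res_evalA [lofr _ _ _ _]lofr_chain_to rc_lift /= cast_id.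
Qed.
End LiftToRes.

Lemma res_eval_inj X (g h : chain_map X resolution) : rpre g res_eval = rpre h res_eval -> g = h.
Proof.
move=> e; apply: linfamE => n; apply: linfamE => j; apply/lfunP => x.
apply: lofr_inj; apply: res_eq => p o l _.
rewrite -[LHS]res_eval_pact -[RHS]res_eval_pact.
rewrite -!(pact_nat (g n)) -!(pact_nat (h n)).
case: o => [i|a].
  have := congr1 (fun r => hv (rv r i) n l (pact (X n : rep k Q) p j i x)) e.
  by rewrite !rpre_v !preE !res_evalV.
have := congr1 (fun r => hv (ra r a) n l (pact (X n : rep k Q) p j (src a) x)) e.
by rewrite !rpre_a !preE !res_evalA.
Qed.
End Resolution.

Section Identity.
Variables (k : fieldType) (Q : quiver).
Local Notation cpxQ := (cpx (rep_cat k Q)).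
Implicit Types X Y : cpxQ.

Definition rid X : rhom X X := mkr (fun o => match o return rhom_sp X X o with
  | inl i => mkv (fun m n => cast (vsp (at_vert X i)) m n)
  | inr a => 0
  end).

Lemma rid_v X i m n x : hv (rv (rid X) i) m n x = cast (vsp (at_vert X i)) m n x.
Proof. by []. Qed.
Lemma rid_a X a m n x : hv (ra (rid X) a) m n x = 0.
Proof. by rewrite [hv _ _ _]/(0 : 'Hom(_, _)) zero_lfunE. Qed.

Lemma rdeg_rid X : rdeg 0 (rid X).
Proof.
split=> [i|a] m n e x; last exact: rid_a.
by rewrite rid_v cast_neq // => en; apply: e; rewrite en addr0.
Qed.

Lemma cast_vd (A : vcpx k) m l x :
  (forall m n, n <> m + 1 -> forall x, vd A m n x = 0) ->
  vd A (l - 1) l (cast (vsp A) m (l - 1) x) = cast (vsp A) (m + 1) l (vd A m (m + 1) x).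
Proof.
move=> sh; have [e|/eqP e] := eqVneq m (l - 1).
  by subst m; rewrite cast_id subrK cast_id.
rewrite !cast_neq ?linear0 // => em; apply: e.
by rewrite -em addrK.
Qed.

Lemma rdiff_rid X : rdiff 0 (rid X) = 0.
Proof.
apply: rhom_eq => [i|a]; apply: hv_eq => m n x.
  rewrite rdiff_v deltaE !rid_v hv0 scale1r cast_vd ?subrr // => m' n' e y.
  by rewrite /= dv_shape // zero_lfunE.
rewrite rdiff_a hvB deltaE hvB postE preE !rid_a !rid_v linear0 scaler0 !subr0.
have [e|/eqP e] := eqVneq m n; first by subst n; rewrite !cast_id subrr.
by rewrite !cast_neq // linear0 subrr.
Qed.
End Identity.

Section ResolutionMap.
Variables (k : fieldType) (Q : quiver).
Local Notation cpxQ := (cpx (rep_cat k Q)).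
Local Notation arrows := (seq (arrow Q)).
Variable path_list : seq arrows.
Hypothesis path_listP : forall p j i, @ispath Q p j i -> p \in path_list.
Variable Y : cpxQ.
Local Notation res := (res path_listP Y).

Definition res_map : chain_map Y (resolution path_listP Y) :=
  res_lift path_listP (rdeg_rid Y) (rdiff_rid Y).

Lemma rpre_res_map : rpre res_map (res_eval path_listP Y) = rid Y.
Proof. exact: rpre_res_lift. Qed.

Section Primitive.
Variables (n : int) (j : vert Q) (v : lsp res n j).
Hypothesis dv0 : ld res n (n + 1) j v = 0.

(* The path component of a primitive of [v - res_map x], indexed by the reversed path. *)
Fixpoint prim_fun (r : arrows) (i : vert Q) : (Y (n - 1) : rep k Q) i :=
  if r is a :: r' then
    cast (rsp (Y (n - 1) : rep k Q)) (tgt a) i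
      (ract (Y (n - 1) : rep k Q) a (prim_fun r' (src a)) - rc v (rev r') (inr a) (n - 1))
  else 0.

Definition primitive_fun p (o : edge Q) l : (Y l : rep k Q) (otgt o) :=
  match o return (Y l : rep k Q) (otgt o) with
  | inl i => cast (vsp (at_vert Y i)) (n - 1) l (prim_fun (rev p) i)
  | inr a => 0
  end.

Lemma prim_fun_nopath p i : ~~ ispath p j i -> prim_fun (rev p) i = 0.
Proof.
elim/last_ind: p i => [|p a IH] i //.
rewrite ispath_rcons rev_rcons negb_and /= => /orP[np|/eqP e]; last by rewrite [LHS]cast_neq.
have v0 : rc v p (inr a) (n - 1) = 0 by rewrite rc_supp // /rsupp /= negb_and np.
by rewrite IH // revK v0 subr0 !linear0.
Qed.

Lemma primitive_supp p o l : ~~ rsupp (n - 1) j p o l -> primitive_fun p o l = 0.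
Proof.
rewrite /rsupp /primitive_fun; case: o => [i|a] //.
rewrite subr0 negb_and => /orP[np|/eqP e]; first by rewrite prim_fun_nopath // linear0.
by rewrite cast_neq //; apply: nesym.
Qed.

Definition primitive : lsp res (n - 1) j := mk_res primitive_supp.

Lemma rc_primitive p i : rc primitive p (inl i) (n - 1) = prim_fun (rev p) i.
Proof. exact: (@cast_id _ _ (vsp (at_vert Y i)) (n - 1) (prim_fun (rev p) i)). Qed.

Lemma rc_closed p o l : res_d_fun v p o l = 0.
Proof. by rewrite -[LHS]rc_d [res_d _ _ _ _ _]dv0. Qed.

Lemma prim_funP p i : ispath p j i ->
  rc v p (inl i) n - pact (Y n : rep k Q) p j i (rc v [::] (inl j) n) =
  dv Y (n - 1) n i (prim_fun (rev p) i).
Proof.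
elim/last_ind: p i => [|p a IH] i /=; first by move/eqP <-; rewrite cast_id subrr linear0.
rewrite ispath_rcons rev_rcons => /andP[/IH e /eqP <-].
rewrite pact_rcons /= cast_id revK linearB /= dv_act -e linearB /=.
have := rc_closed p (inr a) n; rewrite /res_d_fun => /eqP; rewrite subr_eq0 => /eqP <-.
by rewrite opprB [RHS]addrC addrA subrK.
Qed.

Lemma primitiveP :
  v - res_lift_phi path_listP (rdeg_rid Y) n j (rc v [::] (inl j) n) = ld res (n - 1) n j primitive.
Proof.
apply: res_eq => p o l; rewrite [RHS]rc_dB.
rewrite -[LHS]/(rc v p o l - rc (res_lift_phi _ (rdeg_rid Y) n j _) p o l) rc_lift.
rewrite /rsupp => /andP[hp /eqP]; case: o hp => [i|a] hp e.
  rewrite [odeg _]/= subr0 in e; subst l.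
  rewrite -[hv _ _ _ _]/(hv (rv (rid Y) i) n n _) rid_v cast_id.
  by rewrite /res_d_fun rc_primitive prim_funP.
rewrite [odeg _]/= in e; subst l.
rewrite -[hv _ _ _ _]/(hv (ra (rid Y) a) n (n - 1) _) rid_a subr0 /res_d_fun !rc_primitive.
rewrite -[rc primitive p (inr a) _]/(0 : (Y (n - 1 - 1) : rep k Q) (tgt a)) linear0 subr0.
by rewrite rev_rcons /= cast_id revK opprB [RHS]addrC subrK.
Qed.
End Primitive.

Lemma quasi_iso_res_map : quasi_iso res_map.
Proof.
apply: quasi_iso_chain_to => [n i x v _ e|n j v e].
  have := congr1 (fun f => rc f [::] (inl i) n) e.
  rewrite rc_lift rc_dB -[hv _ _ _ _]/(hv (rv (rid Y) i) n n _) rid_v cast_id /= cast_id => ->.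
  exact: memv_limg.
exists (rc v [::] (inl j) n); last by exists (primitive v); apply: primitiveP.
by have := rc_closed e [::] (inl j) (n + 1); rewrite /res_d_fun addrK.
Qed.
End ResolutionMap.

(** * The cone of the identity *)

Section Cone.
Variables (k : fieldType) (Q : quiver).
Local Notation cpxQ := (cpx (rep_cat k Q)).
Variable X : cpxQ.

(* The cone of the identity of [X]: the component [(false, l)], resp. [(true, l)], in
   degree [n] is [X^l] for [l = n], resp. [l = n + 1], and zero for the other [l]. *)
Definition cone_at j (t : bool * int) : lmodType k := (X t.2 : rep k Q) j.
Definition cone_supported n j (f : forall t, cone_at j t) :=
  forall (b : bool) (l : int), l != n + b%:Z -> f (b, l) = 0.

Lemma cone_closed n j : lin_closed (@cone_supported n j).
Proof. by split=> [//|a f g hf hg b l h]; rewrite hf // hg // scaler0 addr0. Qed.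

Definition cone_sp n j : lmodType k := linfam (@cone_closed n j).
Definition cc n j (f : cone_sp n j) b l : (X l : rep k Q) j := f (b, l).
Definition mk_cone n j (F : forall (b : bool) l, (X l : rep k Q) j)
    (hF : forall (b : bool) l, l != n + b%:Z -> F b l = 0) : cone_sp n j :=
  @LinFam k _ (cone_at j) _ (@cone_closed n j) (fun t => F t.1 t.2) hF.

Lemma cc_supp n j (f : cone_sp n j) (b : bool) l : l != n + b%:Z -> cc f b l = 0.
Proof. exact: (famP f). Qed.

Lemma cone_eq n j (f g : cone_sp n j) : (forall b l, cc f b l = cc g b l) -> f = g.
Proof. by move=> h; apply: linfamE => -[b l]; apply: h. Qed.

Lemma cc_lin n j c (f g : cone_sp n j) b l : cc (c *: f + g) b l = c *: cc f b l + cc g b l.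
Proof. by []. Qed.

Lemma cone_act_subproof n a (f : cone_sp n (src a)) (b : bool) l : l != n + b%:Z ->
  ract (X l : rep k Q) a (cc f b l) = 0.
Proof. by move=> h; rewrite cc_supp // linear0. Qed.
Lemma cone_act_lin n a : linear (fun f => mk_cone (@cone_act_subproof n a f)).
Proof. by move=> c f g; apply: cone_eq => b l; rewrite cc_lin [LHS]linearP. Qed.
Definition cone_act n a : {linear cone_sp n (src a) -> cone_sp n (tgt a)} :=
  mk_linear (@cone_act_lin n a).
Lemma cc_act n a f b l : cc (cone_act n a f) b l = ract (X l : rep k Q) a (cc f b l).
Proof. by []. Qed.

Definition cone_d_fun m j (f : cone_sp m j) (b : bool) l : (X l : rep k Q) j :=
  if b then - dv X (l - 1) l j (cc f true (l - 1))
  else dv X (l - 1) l j (cc f false (l - 1)) + cc f true l.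

Lemma cone_d_subproof m n j (f : cone_sp m j) (b : bool) l : l != n + b%:Z ->
  (if n == m + 1 then cone_d_fun f b l else 0) = 0.
Proof.
case: (n =P m + 1) => // ->; rewrite /cone_d_fun; case: b => /= h.
  by rewrite cc_supp ?linear0 ?oppr0 //= subr_eq.
by rewrite !cc_supp ?linear0 ?addr0 //= ?subr_eq ?addr0; move: h; rewrite addr0.
Qed.

Lemma cone_d_lin m n j : linear (fun f => mk_cone (@cone_d_subproof m n j f)).
Proof.
move=> c f g; apply: cone_eq => b l; rewrite cc_lin /cc /=.
case: eqP => _; last by rewrite scaler0 addr0.
case: b; rewrite /cone_d_fun !cc_lin; first by rewrite [dv _ _ _ _ _]linearP /= opprD scalerN.
by rewrite linearP /= scalerDr addrACA.
Qed.
Definition cone_d m n j : {linear cone_sp m j -> cone_sp n j} := mk_linear (@cone_d_lin m n j).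

Lemma cc_d m j f b l : cc (cone_d m (m + 1) j f) b l = cone_d_fun f b l.
Proof. by rewrite {1}/cc /= eqxx. Qed.
Lemma cc_dB m j f b l : cc (cone_d (m - 1) m j f) b l = cone_d_fun f b l.
Proof. by rewrite {1}/cc /= subrK eqxx. Qed.

Lemma cone_d_shape m n j f : n <> m + 1 -> cone_d m n j f = 0.
Proof. by move=> /eqP/negbTE e; apply: cone_eq => b l; rewrite {1}/cc /= e. Qed.

Lemma cone_d_sq m n p j f : cone_d n p j (cone_d m n j f) = 0.
Proof.
have [->|/eqP e] := eqVneq n (m + 1); last by rewrite (cone_d_shape f e) linear0.
have [->|/eqP e] := eqVneq p (m + 1 + 1); last by rewrite cone_d_shape.
apply: cone_eq => b l; rewrite cc_d [RHS]/(cc 0 b l) /cone_d_fun !cc_d /cone_d_fun.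
case: b; first by rewrite linearN /= dv_sq !oppr0.
by rewrite linearD /= dv_sq add0r subrr.
Qed.

Lemma cone_d_act m n b f :
  cone_d m n (tgt b) (cone_act m b f) = cone_act n b (cone_d m n (src b) f).
Proof.
have [->|/eqP e] := eqVneq n (m + 1); last by rewrite !(cone_d_shape _ e) linear0.
apply: cone_eq => c l; rewrite cc_act !cc_d /cone_d_fun !cc_act.
by case: c; rewrite ?linearN ?linearD /= dv_act.
Qed.

Lemma cone_findim n j : findim (cone_sp n j).
Proof.
pose s : seq (bool * int) := [:: (false, n); (true, n + 1)].
exists (\sum_(t <- s) rdim (X t.2 : rep k Q) j).
apply: (linfam_ext (h := supported_closed (cone_at j) s)); last first.
  apply: hasdim_family => // t _; exists (mk_linear (f := id) (fun _ _ _ => erefl)).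
  by exists id.
have sE (b : bool) l : ((b, l) \in s) = (l == n + b%:Z).
  by rewrite !inE !xpair_eqE; case: b; rewrite /= ?addr0 ?orbF.
by move=> f; split=> h => [b l|[b l]]; [rewrite -sE | rewrite sE]; apply: h.
Qed.

Lemma cone_bounded : exists N : int, forall n : int, N < `|n| -> forall j (f : cone_sp n j), f = 0.
Proof.
have [N hN] := cpx_zero X; exists (N + 1) => n hn j f.
apply: cone_eq => b l; have [e|e] := eqVneq l (n + b%:Z); last by rewrite !cc_supp.
rewrite [LHS](hN l) ?[RHS](hN l) //; rewrite e -(ltrD2r 1) (lt_le_trans hn) //;
  rewrite -{1}(addrK b%:Z n) (le_trans (ler_normB _ _)) // lerD2l; by case: (b).
Qed.

Definition cone_l : lcpx k Q := LCpx cone_d_shape cone_d_sq cone_d_act cone_findim cone_bounded.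
Definition cone : cpxQ := real cone_l.

Lemma cone_acyclic : quasi_iso (0 : chain_map cone cone).
Proof.
apply: quasi_iso_acyclic => n j v dv0.
pose F (b : bool) l := if b then cc v false l else 0 : (X l : rep k Q) j.
have hF (b : bool) l : l != n - 1 + b%:Z -> F b l = 0.
  by case: b => //=; rewrite subrK => h; rewrite /F cc_supp //= addr0.
exists (mk_cone hF); apply: cone_eq => b l; rewrite [RHS]cc_dB /cone_d_fun.
case: b; last by rewrite linear0 add0r.
have := cc_d v false l; rewrite [cone_d _ _ _ _]dv0 /cone_d_fun => /esym/eqP.
by rewrite addrC addr_eq0 => /eqP.
Qed.

Definition cone_in_fun n j (x : (X n : rep k Q) j) (b : bool) l : (X l : rep k Q) j :=
  if b then 0 else cast (vsp (at_vert X j)) n l x.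
Lemma cone_in_subproof n j x (b : bool) l : l != n + b%:Z -> @cone_in_fun n j x b l = 0.
Proof.
rewrite /cone_in_fun; case: b => // /eqP e.
by rewrite cast_neq // => en; apply: e; rewrite -en; exact/esym/addr0.
Qed.
Lemma cone_in_lin n j : linear (fun x => mk_cone (@cone_in_subproof n j x)).
Proof.
move=> c x y; apply: cone_eq => b l; rewrite cc_lin /cc /= /cone_in_fun.
by case: b; rewrite ?linearP // scaler0 addr0.
Qed.
Definition cone_in_phi n j : {linear (X n : rep k Q) j -> lsp cone_l n j} :=
  mk_linear (@cone_in_lin n j).
Lemma cc_in n j x b l : cc (cone_in_phi n j x) b l = cone_in_fun x b l.
Proof. by []. Qed.

Lemma cone_in_act n a x :
  cone_in_phi n (tgt a) (ract (X n : rep k Q) a x) = lact cone_l n a (cone_in_phi n (src a) x).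
Proof.
apply: cone_eq => b l; rewrite [RHS]cc_act !cc_in /cone_in_fun; case: b; first by rewrite linear0.
have [e|/eqP e] := eqVneq n l; first by subst l; rewrite !cast_id.
by rewrite !cast_neq // linear0.
Qed.

Lemma cone_in_d m j x :
  cone_in_phi (m + 1) j (dv X m (m + 1) j x) = ld cone_l m (m + 1) j (cone_in_phi m j x).
Proof.
apply: cone_eq => b l; rewrite [RHS]cc_d /cone_d_fun !cc_in /cone_in_fun.
case: b; first by rewrite linear0 oppr0.
rewrite addr0 -[LHS]cast_vd // => m' n' e y.
by rewrite /= dv_shape // zero_lfunE.
Qed.

Definition cone_in : chain_map X cone := chain_to cone_in_act cone_in_d.

Lemma cone_ext_arith (V : zmodType) (a b c d u v e f g : V) :
  a - b = c + d -> g = u - v - (e - f) -> a + u - (b + v) - (c + e + (d + g - f)) = 0.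
Proof.
move=> ab ->; rewrite opprD addrACA ab; move: (u - v) => w.
rewrite -[d + _ - f]addrA [c + e + _]addrACA.
have -> : e + (w - (e - f) - f) = w by rewrite addrC opprB addrA addrAC addrK subrK.
by rewrite subrr.
Qed.

Section Extend.
Variables (Y : cpxQ) (h : rhom X Y).

(* The extension to the cone of [X] of the coboundary of [h], which is closed although [h] is
   not. *)
Definition cone_ext_fun n (o : edge Q) l (v : (cone n : rep k Q) (osrc o)) :
    (Y l : rep k Q) (otgt o) :=
  hv (rdiff (-1) h o : vhom (at_vert X (osrc o)) (at_vert Y (otgt o))) n l
     (cc (lofr cone_l n (osrc o) v) false n)
  + hv (h o : vhom (at_vert X (osrc o)) (at_vert Y (otgt o))) (n + 1) l
     (cc (lofr cone_l n (osrc o) v) true (n + 1)).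

Lemma cone_ext_lin n o l : linear (@cone_ext_fun n o l).
Proof.
by move=> c u v; rewrite /cone_ext_fun [lofr _ _ _ _]linearP !cc_lin !linearP /= scalerDr addrACA.
Qed.

Definition cone_ext : rhom cone Y := mkr (fun o =>
  mkv (fun n l => linfun (mk_linear (@cone_ext_lin n o l)) :
    'Hom(vsp (at_vert cone (osrc o)) n, vsp (at_vert Y (otgt o)) l))).

Lemma cone_ext_v i n l v : hv (rv cone_ext i) n l v =
  hv (rv (rdiff (-1) h) i) n l (cc (lofr cone_l n i v) false n)
  + hv (rv h i) (n + 1) l (cc (lofr cone_l n i v) true (n + 1)).
Proof. by rewrite [hv _ _ _]/(linfun _) lfunE. Qed.
Lemma cone_ext_a a n l v : hv (ra cone_ext a) n l v =
  hv (ra (rdiff (-1) h) a) n l (cc (lofr cone_l n (src a) v) false n)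
  + hv (ra h a) (n + 1) l (cc (lofr cone_l n (src a) v) true (n + 1)).
Proof. by rewrite [hv _ _ _]/(linfun _) lfunE. Qed.

Lemma rpre_cone_ext : rpre cone_in cone_ext = rdiff (-1) h.
Proof.
apply: rhom_eq => [i|a]; apply: hv_eq => m n x.
  rewrite rpre_v preE cone_ext_v [lofr _ _ _ _]lofr_chain_to !cc_in /cone_in_fun.
  by rewrite linear0 addr0 cast_id.
rewrite rpre_a preE cone_ext_a [lofr _ _ _ _]lofr_chain_to !cc_in /cone_in_fun.
by rewrite linear0 addr0 cast_id.
Qed.

Hypothesis dh : rdeg (-1) h.

Lemma rdeg_cone_ext : rdeg 0 cone_ext.
Proof.
have [d1 d2] := rdeg_rdiff (p := 0) dh; have [e1 e2] := dh.
split=> [i|a] m n e x; rewrite (cone_ext_v, cone_ext_a).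
  rewrite [X in X + _]d1 // add0r e1 // => en; apply: e.
  by rewrite en addrK addr0.
rewrite [X in X + _]d2 // add0r e2 // => en; apply: e.
by rewrite en -addrA; congr (_ + _).
Qed.

Lemma rdiff_cone_ext : rdiff 0 cone_ext = 0.
Proof.
have dd : rdiff 0 (rdiff (-1) h) = 0 := rdiff_rdiff 0 h.
apply: rhom_eq => [i|a]; apply: hv_eq => m n x.
  rewrite rdiff_v deltaE !cone_ext_v hv0 scale1r lofr_vd !cc_d /cone_d_fun !addrK.
  pose c0 : vsp (at_vert X i) m := cc (lofr cone_l m i x) false m.
  pose c1 : vsp (at_vert X i) (m + 1) := cc (lofr cone_l m i x) true (m + 1).
  rewrite -/c0 -/c1.
  have := congr1 (fun f => hv (rv f i) m n c0) dd.
  rewrite rdiff_v deltaE hv0 scale1r => /eqP; rewrite subr_eq0 => /eqP e.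
  have := deltaE (-1) (rv h i) n c1; rewrite -rdiff_v; move: (rdiff (-1) h) e => D e e1.
  rewrite [vd _ _ _ (_ + _)]linearD /= [X in X + _ - _]e !linearD /= linearN /=.
  rewrite [X in _ + (_ - X - _)]e1 sgN1 scaleN1r !opprK opprD.
  by rewrite [X in _ + (X + _)]addrA subrK -opprD subrr.
rewrite rdiff_a hvB deltaE hvB postE preE !(cone_ext_v, cone_ext_a) hv0 lofr_vd lofr_xact.
rewrite !cc_d !cc_act /cone_d_fun !addrK sub0r sgN1 scaleN1r opprK.
pose c0 : vsp (at_vert X (src a)) m := cc (lofr cone_l m (src a) x) false m.
pose c1 : vsp (at_vert X (src a)) (m + 1) := cc (lofr cone_l m (src a) x) true (m + 1).
rewrite -/c0 -/c1.
have := congr1 (fun f => hv (ra f a) m n c0) dd.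
rewrite rdiff_a hvB deltaE hvB postE preE hv0 sub0r sgN1 scaleN1r opprK => /eqP.
rewrite subr_eq0 => /eqP e.
have e1 : hv (ra (rdiff (-1) h) a) (m + 1) n c1 =
    xact Y a n (hv (rv h (src a)) (m + 1) n c1) - hv (rv h (tgt a)) (m + 1) n (xact X a (m + 1) c1)
    - (vd (at_vert Y (tgt a)) (n - 1) n (hv (ra h a) (m + 1) (n - 1) c1)
       - hv (ra h a) (m + 1 + 1) n (vd (at_vert X (src a)) (m + 1) (m + 1 + 1) c1)).
  by rewrite rdiff_a hvB deltaE hvB postE preE sgB1 sgN1 opprK scale1r.
move: (rdiff (-1) h) e e1 => D e e1.
rewrite [xact _ _ _ (_ + _)]linearD [vd _ _ _ (_ + _)]linearD.
rewrite [hv (ra D a) _ _ (_ + _)]linearD linearN /=.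
exact: (cone_ext_arith e e1).
Qed.
End Extend.
End Cone.

(** * Morphisms in the derived category *)

Section LocalizationHom.
Variables (k : fieldType) (Q : quiver).
Local Notation cpxQ := (cpx (rep_cat k Q)).
Local Notation arrows := (seq (arrow Q)).
Local Notation DQ := (Db k Q).
Variable path_list : seq arrows.
Hypothesis path_listP : forall p j i, @ispath Q p j i -> p \in path_list.

Local Notation term := (@lterm k (Cb (rep_cat k Q)) (@quasi_iso k Q)).
Local Notation teq := (@loceq k (Cb (rep_cat k Q)) (@quasi_iso k Q) _ _).
Local Notation cls := (@lcls k (Cb (rep_cat k Q)) (@quasi_iso k Q) _ _).

Definition loc (X Y : cpxQ) (f : chain_map X Y) : Defs.hom DQ X Y :=
  cls (@LMap k (Cb (rep_cat k Q)) (@quasi_iso k Q) X Y f).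
Definition loc_inv (X Y : cpxQ) (s : chain_map X Y) (qs : quasi_iso s) : Defs.hom DQ Y X :=
  cls (@LInv k (Cb (rep_cat k Q)) (@quasi_iso k Q) X Y s qs).

Lemma cls_comp (X Y Z : cpxQ) (g : term Y Z) (f : term X Y) :
  cls (LComp g f) = Defs.comp (cls g : Defs.hom DQ Y Z) (cls f : Defs.hom DQ X Y).
Proof. by rewrite -[RHS]/(lcomp _ _) lcompE. Qed.

Lemma cls_add (X Y : cpxQ) (g f : term X Y) : cls (LAdd g f) = (cls g + cls f : Defs.hom DQ X Y).
Proof. by rewrite -[RHS]/(ladd _ _) laddE. Qed.

Lemma cls_scale (X Y : cpxQ) a (f : term X Y) : cls (LScale a f) = (a *: cls f : Defs.hom DQ X Y).
Proof. by rewrite -[RHS]/(lscale _ _) lscaleE. Qed.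

Lemma loc_comp (X Y Z : cpxQ) (g : chain_map Y Z) (f : chain_map X Y) :
  loc (chain_comp g f) = Defs.comp (loc g) (loc f).
Proof.
by rewrite -[RHS]cls_comp; apply/lclsP; exact: (@loceq_mapM k (Cb (rep_cat k Q)) _ X Y Z g f).
Qed.

Lemma loc_lin (X Y : cpxQ) a (f g : chain_map X Y) : loc (a *: f + g) = a *: loc f + loc g.
Proof.
rewrite /loc -cls_scale -cls_add; apply/lclsP.
exact: (@loceq_map_lin k (Cb (rep_cat k Q)) _ X Y a f g).
Qed.

Lemma loc0 (X Y : cpxQ) : loc (0 : chain_map X Y) = 0.
Proof. by []. Qed.

Lemma loc_invK (X Y : cpxQ) (s : chain_map X Y) (qs : quasi_iso s) :
  Defs.comp (loc_inv qs) (loc s) = idm (X : DQ).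
Proof.
by rewrite -[LHS]cls_comp; apply/lclsP; exact: (@loceq_invK k (Cb (rep_cat k Q)) _ X Y s qs).
Qed.

Lemma loc_mapK (X Y : cpxQ) (s : chain_map X Y) (qs : quasi_iso s) :
  Defs.comp (loc s) (loc_inv qs) = idm (Y : DQ).
Proof.
by rewrite -[LHS]cls_comp; apply/lclsP; exact: (@loceq_mapK k (Cb (rep_cat k Q)) _ X Y s qs).
Qed.

(* The zero endomorphism of an acyclic complex is a quasi-isomorphism, so its inverse forces
   the identity to vanish in the derived category. *)
Lemma loc_cone_in (X : cpxQ) : loc (cone_in X) = 0.
Proof.
rewrite -[LHS]comp1m -(loc_invK (cone_acyclic X)) -Defs.compA.
by rewrite loc0 comp0m compm0.
Qed.

Lemma rpre_linl (X Y Z : cpxQ) c (f g : chain_map X Y) (z : rhom Y Z) :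
  rpre (c *: f + g) z = c *: rpre f z + rpre g z.
Proof.
apply: rhom_eq => [i|a]; apply: hv_eq => m n x.
  rewrite rv_lin hv_lin !rpre_v !preE -linearP; congr (hv _ _ _ _).
  by rewrite /cv /= add_lfunE scale_lfunE.
rewrite ra_lin hv_lin !rpre_a !preE -linearP; congr (hv _ _ _ _).
by rewrite /cv /= add_lfunE scale_lfunE.
Qed.

Lemma rpre_comp (X Y Z W : cpxQ) (g : chain_map Y Z) (f : chain_map X Y) (z : rhom Z W) :
  rpre (chain_comp g f) z = rpre f (rpre g z).
Proof.
by apply: rhom_eq => [i|a]; apply: hv_eq => m n x;
  rewrite !(rpre_v, rpre_a) !preE; congr (hv _ _ _ _); rewrite /cv /= comp_lfunE.
Qed.

Lemma rpre_id (X Y : cpxQ) (z : rhom X Y) : rpre (chain_id X) z = z.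
Proof.
by apply: rhom_eq => [i|a]; apply: hv_eq => m n x;
  rewrite !(rpre_v, rpre_a) preE; congr (hv _ _ _ _); rewrite /cv /= id_lfunE.
Qed.

Lemma rpre0l (X Y Z : cpxQ) (z : rhom Y Z) : rpre (0 : chain_map X Y) z = 0.
Proof.
have := rpre_linl (-1) (0 : chain_map X Y) 0 z.
by rewrite scaler0 addr0 scaleN1r addNr.
Qed.

Definition rclosed (X Y : cpxQ) (z : rhom X Y) := rdeg 0 z /\ rdiff 0 z = 0.

Lemma rclosed_lin (X Y : cpxQ) c (z w : rhom X Y) : rclosed z -> rclosed w -> rclosed (c *: z + w).
Proof.
move=> [dz cz] [dw cw]; split; first exact: rdeg_lin.
by rewrite linearP /= cz cw scaler0 addr0.
Qed.
Lemma rclosed0 (X Y : cpxQ) : rclosed (0 : rhom X Y).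
Proof. by split; [exact: rdeg0 | rewrite linear0]. Qed.
Lemma rclosedD (X Y : cpxQ) (z w : rhom X Y) : rclosed z -> rclosed w -> rclosed (z + w).
Proof. by rewrite -{2}[z]scale1r; apply: rclosed_lin. Qed.
Lemma rclosedZ (X Y : cpxQ) c (z : rhom X Y) : rclosed z -> rclosed (c *: z).
Proof. by move=> h; rewrite -[_ *: _]addr0; apply: rclosed_lin => //; apply: rclosed0. Qed.
Lemma rclosedB (X Y : cpxQ) (z w : rhom X Y) : rclosed z -> rclosed w -> rclosed (z - w).
Proof. by move=> hz hw; rewrite -scaleN1r; apply: rclosedD => //; apply: rclosedZ. Qed.
Lemma rclosed_pre (X Y Z : cpxQ) (f : chain_map X Y) (z : rhom Y Z) :
  rclosed z -> rclosed (rpre f z).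
Proof. by move=> [dz cz]; split; [apply: rdeg_pre | rewrite rdiff_pre cz linear0]. Qed.
Lemma rclosed_rid (X : cpxQ) : rclosed (rid X).
Proof. by split; [apply: rdeg_rid | apply: rdiff_rid]. Qed.

Section Act.
Variable Z : cpxQ.

Definition is_lift (X Y : cpxQ) (s : chain_map X Y) (z : rhom X Z) (w : rhom Y Z) :=
  rclosed w /\ rexact 0 (z - rpre s w).

(* The action of the localization on the cohomology of RHom(-, Z), on representatives: formal
   inverses act by a choice (with junk value 0) of a preimage up to coboundaries, so [act] is
   linear and compatible with [loceq] only up to coboundaries. *)
Fixpoint act (X Y : Cb (rep_cat k Q)) (t : term X Y) : rhom Y Z -> rhom X Z :=
  match t in lterm _ X Y return rhom Y Z -> rhom X Z with
  | LMap X Y f => rpre f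
  | LInv X Y s _ => fun z => xget 0 [set w | is_lift s z w]%classic
  | LComp X Y Z g f => fun z => act f (act g z)
  | LAdd X Y f g => fun z => act f z + act g z
  | LScale X Y a f => fun z => a *: act f z
  end.

Lemma act_inv (X Y : cpxQ) (s : chain_map X Y) (qs : quasi_iso s) z : rclosed z ->
  is_lift s z (act (@LInv k (Cb (rep_cat k Q)) _ X Y s qs) z).
Proof.
move=> [dz cz] /=; have [w [dw cw e]] := rpre_surj qs dz cz.
by case: xgetP => [_ -> //|/(_ w)]; case.
Qed.

Lemma act_closed (X Y : cpxQ) (t : term X Y) z : rclosed z -> rclosed (act t z).
Proof.
elim: t z => {X Y} [X Y f|X Y s qs|X Y Y' g IHg f IHf|X Y f IHf g IHg|X Y a f IHf] z hz.
- exact: rclosed_pre.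
- exact: (act_inv qs hz).1.
- by apply: IHf; apply: IHg.
- by apply: rclosedD; [apply: IHf | apply: IHg].
- by apply: rclosedZ; apply: IHf.
Qed.

Lemma act_exact (X Y : cpxQ) (t : term X Y) z : rclosed z -> rexact 0 z -> rexact 0 (act t z).
Proof.
elim: t z => {X Y} [X Y f|X Y s qs|X Y Y' g IHg f IHf|X Y f IHf g IHg|X Y a f IHf] z hz ez.
- exact: rexact_pre.
- have [[dw cw] ew] := act_inv qs hz; apply: (rpre_inj qs) => //.
  rewrite -[rpre _ _](subKr z); apply: rexactD => //.
  by rewrite opprB -opprB; apply: rexactN.
- by apply: IHf; [apply: act_closed | apply: IHg].
- by apply: rexactD; [apply: IHf | apply: IHg].
- by apply: rexactZ; apply: IHf.
Qed.

Definition coh (X : cpxQ) (z w : rhom X Z) := rexact 0 (z - w).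

Lemma coh_refl (X : cpxQ) (z : rhom X Z) : coh z z.
Proof. by rewrite /coh subrr; apply: rexact0. Qed.
Lemma coh_sym (X : cpxQ) (z w : rhom X Z) : coh z w -> coh w z.
Proof. by rewrite /coh -[w - z]opprB; apply: rexactN. Qed.
Lemma coh_trans (X : cpxQ) (z w v : rhom X Z) : coh z w -> coh w v -> coh z v.
Proof. by move=> zw wv; rewrite /coh -[z](subrK w) -addrA; apply: rexactD. Qed.
Lemma coh_lin (X : cpxQ) a (z w z' w' : rhom X Z) :
  coh z z' -> coh w w' -> coh (a *: z + w) (a *: z' + w').
Proof. by move=> e e'; rewrite /coh opprD addrACA -scalerBr; apply: rexact_lin. Qed.
Lemma coh_add (X : cpxQ) (z w z' w' : rhom X Z) : coh z z' -> coh w w' -> coh (z + w) (z' + w').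
Proof. by move=> e e'; rewrite /coh opprD addrACA; apply: rexactD. Qed.

Definition coh_linear (X Y : cpxQ) (t : term X Y) := forall c z w, rclosed z -> rclosed w ->
  coh (act t (c *: z + w)) (c *: act t z + act t w).

Lemma coh_linear_coh (X Y : cpxQ) (t : term X Y) z w : coh_linear t -> rclosed z -> rclosed w ->
  coh z w -> coh (act t z) (act t w).
Proof.
move=> lt hz hw zw; have h := rclosedB hz hw.
have e := lt 1 _ _ h hw; rewrite !scale1r subrK in e.
by apply: coh_trans e _; rewrite /coh addrK; exact: act_exact.
Qed.

Lemma act_lin (X Y : cpxQ) (t : term X Y) : coh_linear t.
Proof.
elim: t => {X Y} [X Y f|X Y s qs|X Y Y' g IHg f IHf|X Y f IHf g IHg|X Y a f IHf] c z w hz hw.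
- by rewrite /= linearP; apply: coh_refl.
- have hzw := rclosed_lin c hz hw.
  have [h1 e1] := act_inv qs hz; have [h2 e2] := act_inv qs hw.
  have [h3 e3] := act_inv qs hzw.
  have h4 := rclosedB h3 (rclosed_lin c h1 h2).
  apply: (rpre_inj qs h4.1 h4.2); rewrite linearB linearP /=.
  apply: coh_trans (coh_lin c e1 e2); exact: coh_sym.
- have h1 := act_closed g hz; have h2 := act_closed g hw.
  have h3 := act_closed g (rclosed_lin c hz hw); have h4 := rclosed_lin c h1 h2.
  exact: coh_trans (coh_linear_coh IHf h3 h4 (IHg c z w hz hw)) (IHf c _ _ h1 h2).
- rewrite /= scalerDr addrACA; apply: coh_add; [exact: IHf | exact: IHg].
- rewrite /= scalerA mulrC -scalerA -scalerDr /coh -scalerBr; apply: rexactZ; exact: IHf.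
Qed.

Lemma act_coh (X Y : cpxQ) (t : term X Y) z w : rclosed z -> rclosed w ->
  coh z w -> coh (act t z) (act t w).
Proof. by move=> hz hw; apply: (coh_linear_coh (@act_lin _ _ t) hz hw). Qed.

Lemma act_loceq (X Y : cpxQ) (t t' : term X Y) : teq t t' ->
  forall z, rclosed z -> coh (act t z) (act t' z).
Proof.
have eq_coh (X' : cpxQ) (u v : rhom X' Z) : u = v -> coh u v by move->; apply: coh_refl.
elim=> {X Y t t'}.
- by move=> *; apply: coh_refl.
- by move=> X Y f g _ IH z hz; apply/coh_sym/IH.
- by move=> X Y f g h _ IH _ IH' z hz; apply: coh_trans (IH _ hz) (IH' _ hz).
- move=> X Y Y' g g' f f' _ IHg _ IHf z hz /=.
  apply: coh_trans (IHf _ (act_closed g' hz)).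
  by apply: act_coh; [exact: act_closed | exact: act_closed | exact: IHg].
- by move=> X Y f f' g g' _ IHf _ IHg z hz; apply: coh_add; [exact: IHf | exact: IHg].
- by move=> X Y a f f' _ IH z hz; rewrite /coh /= -scalerBr; apply: rexactZ; exact: IH.
- by move=> X Y Y' T h g f z hz; apply: coh_refl.
- by move=> X Y f z hz; rewrite /= rpre_id; apply: coh_refl.
- by move=> X Y f z hz; rewrite /= rpre_id; apply: coh_refl.
- by move=> X Y f g h z hz; apply: eq_coh; rewrite /= addrA.
- by move=> X Y f g z hz; apply: eq_coh; rewrite /= addrC.
- by move=> X Y f z hz; apply: eq_coh; rewrite /= rpre0l add0r.
- by move=> X Y f z hz; apply: eq_coh; rewrite /= rpre0l scaleN1r addNr.
- by move=> X Y a b f z hz; apply: eq_coh; rewrite /= scalerA.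
- by move=> X Y f z hz; apply: eq_coh; rewrite /= scale1r.
- by move=> X Y a f g z hz; apply: eq_coh; rewrite /= scalerDr.
- by move=> X Y a b f z hz; apply: eq_coh; rewrite /= scalerDl.
- by move=> X Y Y' a g g' f z hz; apply: act_lin; apply: act_closed.
- by move=> X Y Y' a g f f' z hz; apply: coh_refl.
- by move=> X Y Y' g f z hz; apply: eq_coh; rewrite /= rpre_comp.
- by move=> X Y a f g z hz; apply: eq_coh; rewrite /= rpre_linl.
- move=> X Y s qs z hz; rewrite /= rpre_id; apply: coh_sym; exact: (act_inv qs hz).2.
- move=> X Y s qs z hz /=; rewrite rpre_id.
  have [h1 e1] := act_inv qs (rclosed_pre s hz).
  have h2 := rclosedB h1 hz; apply: (rpre_inj qs h2.1 h2.2).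
  by rewrite linearB /=; apply: coh_sym.
Qed.
End Act.
Section Psi.
Variable Y : cpxQ.
Local Notation I := (resolution path_listP Y).
Local Notation u := (res_eval path_listP Y).
Local Notation qI := (quasi_iso_res_map path_listP Y).

Lemma rclosed_res_eval : rclosed u.
Proof. by split; [apply: rdeg_res_eval | apply: rdiff_res_eval]. Qed.

Definition lift (X : cpxQ) (z : rhom X Y) (h : rclosed z) : chain_map X I :=
  res_lift path_listP h.1 h.2.

Lemma rpre_lift (X : cpxQ) (z : rhom X Y) (h : rclosed z) : rpre (lift h) u = z.
Proof. exact: rpre_res_lift. Qed.

Lemma lift_uniq (X : cpxQ) (z : rhom X Y) (h : rclosed z) (g : chain_map X I) :
  rpre g u = z -> lift h = g.
Proof. by move=> e; apply: res_eval_inj; rewrite rpre_lift e. Qed.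

(* [psi] sends the cocycle [f^* u], with [u] the universal cocycle of the resolution, to the
   roof [q^-1 f]; it turns out to be an isomorphism modulo coboundaries. *)
Definition psi (X : cpxQ) (z : rhom X Y) (h : rclosed z) : Defs.hom DQ X Y :=
  Defs.comp (loc_inv qI) (loc (lift h)).

Lemma psi_lin (X : cpxQ) c (z w : rhom X Y) hz hw h :
  psi (z := c *: z + w) h = c *: psi (X := X) (z := z) hz + psi (z := w) hw.
Proof.
rewrite /psi -comp_linr -loc_lin; congr (Defs.comp _ (loc _)).
by apply: lift_uniq; rewrite rpre_linl !rpre_lift.
Qed.

Lemma psi_pre (X X' : cpxQ) (f : chain_map X X') (z : rhom X' Y) h h' :
  psi (z := rpre f z) h' = Defs.comp (psi (z := z) h) (loc f).
Proof.
rewrite /psi -Defs.compA -loc_comp; congr (Defs.comp _ (loc _)).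
by apply: lift_uniq; rewrite rpre_comp rpre_lift.
Qed.

Lemma psi_exact (X : cpxQ) (z : rhom X Y) h : rexact 0 z -> psi (z := z) h = 0.
Proof.
move=> [t dt e].
have hc : rclosed (cone_ext t) by split; [apply: rdeg_cone_ext | apply: rdiff_cone_ext].
have := psi_pre (f := cone_in X) hc; rewrite rpre_cone_ext loc_cone_in compm0.
by subst z; apply.
Qed.

Lemma psi_coh (X : cpxQ) (z w : rhom X Y) hz hw : coh z w -> psi (z := z) hz = psi (z := w) hw.
Proof.
move=> zw; have hd := rclosedB hz hw.
have h1 : rclosed (1 *: (z - w) + w) by rewrite scale1r subrK.
have := psi_lin hd hw h1; rewrite (psi_exact hd zw) scaler0 add0r => <-.
rewrite /psi; congr (Defs.comp _ (loc _)); apply: lift_uniq.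
by rewrite rpre_lift scale1r subrK.
Qed.

Lemma psi_ext (X : cpxQ) (z w : rhom X Y) hz hw : z = w -> psi (z := z) hz = psi (z := w) hw.
Proof. by move=> e; apply: psi_coh; rewrite e; apply: coh_refl. Qed.

Lemma psiD (X : cpxQ) (z w : rhom X Y) hz hw h :
  psi (z := z + w) h = psi (z := z) hz + psi (z := w) hw.
Proof.
have h1 := rclosed_lin 1 hz hw; have e : z + w = 1 *: z + w by rewrite scale1r.
by rewrite (psi_ext h h1 e) (psi_lin hz hw) scale1r.
Qed.

Lemma psiZ (X : cpxQ) c (z : rhom X Y) hz h : psi (z := c *: z) h = c *: psi (z := z) hz.
Proof.
have h0 := rclosed0 X Y; have h1 := rclosed_lin c hz h0.
have e : c *: z = c *: z + 0 by rewrite addr0.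
by rewrite (psi_ext h h1 e) (psi_lin hz h0) (psi_exact h0 (rexact0 _ _ _)) addr0.
Qed.

Lemma psi_act (X X' : cpxQ) (t : term X X') (z : rhom X' Y) h h' :
  psi (z := act t z) h' = Defs.comp (psi (z := z) h) (cls t).
Proof.
elim: t z h h' => {X X'}
  [X X' f|X X' s qs|X X' X'' g IHg f IHf|X X' f IHf g IHg|X X' a f IHf] z h h'.
- exact: psi_pre.
- have [h1 e1] := act_inv qs h; have h2 := rclosed_pre s h1.
  rewrite -(psi_coh h2 h (coh_sym e1)) (psi_pre h1 h2) -Defs.compA.
  rewrite -/(loc_inv qs) loc_mapK compm1.
  by apply: psi_coh; apply: coh_refl.
- by rewrite cls_comp Defs.compA -IHg; [exact: act_closed | move=> hg; rewrite -IHf].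
- have h1 := act_closed f h; have h2 := act_closed g h.
  rewrite cls_add (psiD h1 h2) (IHf _ h h1) (IHg _ h h2).
  have := comp_linr 1 (psi h) (cls f : Defs.hom DQ X X') (cls g).
  by rewrite !scale1r.
- have h1 := act_closed f h.
  by rewrite cls_scale (psiZ h1) (IHf _ h h1) compmZ.
Qed.

Lemma psi_rid (h : rclosed (rid Y)) : psi h = idm (Y : DQ).
Proof.
rewrite -(loc_invK qI) /psi; congr (Defs.comp _ (loc _)); apply: lift_uniq.
exact: rpre_res_map.
Qed.

Lemma psi_surj (X : cpxQ) (w : Defs.hom DQ X Y) :
  exists (z : rhom X Y) (h : rclosed z), psi h = w.
Proof.
have h := rclosed_rid Y; have h' := act_closed (repr w) h.
exists (act (repr w) (rid Y)), h'.
by rewrite (psi_act (t := repr w) h h') psi_rid comp1m; apply: lclsK.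
Qed.

Lemma psi_inj (X : cpxQ) (z : rhom X Y) h : psi (z := z) h = 0 -> rexact 0 z.
Proof.
rewrite /psi -[Defs.comp _ _]cls_comp => /lclsP/act_loceq/(_ _ (rclosed_rid Y)).
pose w := act (@LInv k (Cb (rep_cat k Q)) _ _ _ _ qI) (rid Y).
have [hw ew] : is_lift (res_map path_listP Y) (rid Y) w := act_inv qI (rclosed_rid Y).
rewrite /coh [act (LMap _ _) _]rpre0l subr0 -[act (LComp _ _) _]/(rpre (lift h) w) => ez.
move: w hw ew ez => w hw; rewrite -(rpre_res_map path_listP Y) -linearB /= => ew ez.
have hd := rclosedB rclosed_res_eval hw.
have := rexact_pre (lift h) (rpre_inj qI hd.1 hd.2 ew).
by rewrite linearB /= rpre_lift => e; rewrite -[z](subrK (rpre (lift h) w)); apply: rexactD.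
Qed.
End Psi.
End LocalizationHom.

(** * Dimensions of the cohomology *)

Section Cohomology.
Variables (k : fieldType) (Q : quiver).
Local Notation cpxQ := (cpx (rep_cat k Q)).
Implicit Types X Y : cpxQ.

Lemma mkrE X Y (f : rhom X Y) : mkr f = f.
Proof. by apply: linfamE. Qed.

Lemma rcocycle_closed p X Y : lin_closed (V := rhom_sp X Y)
  (fun f => rdeg p (mkr f) /\ rdiff p (mkr f) = 0).
Proof.
split=> [|c f g [df cf] [dg cg]]; split.
- exact: rdeg0.
- by rewrite [mkr _](_ : _ = 0) ?linear0 //; apply: linfamE.
- exact: (rdeg_closed p X Y).2.
- rewrite [mkr _](_ : _ = c *: mkr f + mkr g); last by apply: linfamE.
  by rewrite linearP /= cf cg scaler0 addr0.
Qed.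

Lemma rcoboundary_closed p X Y : lin_closed (V := rhom_sp X Y) (fun f => rexact p (mkr f)).
Proof.
split=> [|c f g ef eg].
  by rewrite [mkr _](_ : _ = 0); [apply: rexact0 | apply: linfamE].
rewrite [mkr _](_ : _ = c *: mkr f + mkr g); last by apply: linfamE.
exact: rexact_lin.
Qed.

Definition cochains p X Y : lmodType k := linfam (rdeg_closed p X Y).
Definition cocyc p X Y : lmodType k := linfam (rcocycle_closed p X Y).
Definition cobound p X Y : lmodType k := linfam (rcoboundary_closed p X Y).

(* [V] is the cohomology of RHom(X, Y) in degree [p]. *)
Definition computes (V : lmodType k) p X Y := exists psi : {linear cocyc p X Y -> V},
  (forall v, exists z, psi z = v) /\ (forall z, psi z = 0 <-> rexact p (mkr z)).

Lemma rcocycle_of_exact p X Y (f : rhom X Y) : rexact p f -> rdeg p f /\ rdiff p f = 0.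
Proof.
by move=> [h dh ->]; split; [apply: rdeg_rdiff | apply: rdiff_rdiff].
Qed.

Definition bz_incl p X Y (f : cobound p X Y) : cocyc p X Y :=
  LinFam (rcocycle_closed p X Y) (rcocycle_of_exact (famP f)).
Definition zc_incl p X Y (f : cocyc p X Y) : cochains p X Y :=
  LinFam (rdeg_closed p X Y) (proj1 (famP f)).

Lemma rexact_rdiff p X Y (f : cochains (p - 1) X Y) : rexact p (rdiff (p - 1) (mkr f)).
Proof. by exists (mkr f) => //; exact: (famP f). Qed.

Lemma cb_subproof p X Y (f : cochains (p - 1) X Y) : rexact p (mkr (rdiff (p - 1) (mkr f))).
Proof. by rewrite mkrE; apply: rexact_rdiff. Qed.
Definition cb_map p X Y (f : cochains (p - 1) X Y) : cobound p X Y :=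
  LinFam (rcoboundary_closed p X Y) (cb_subproof f).

Lemma bz_lin p X Y : linear (@bz_incl p X Y). Proof. by move=> c f g; apply: linfamE. Qed.
Lemma zc_lin p X Y : linear (@zc_incl p X Y). Proof. by move=> c f g; apply: linfamE. Qed.
Lemma cb_lin p X Y : linear (@cb_map p X Y).
Proof.
move=> c f g; apply: linfamE => o.
rewrite [LHS]/(rdiff (p - 1) (mkr (c *: f + g)) o).
rewrite [mkr _](_ : _ = c *: mkr f + mkr g); last by apply: linfamE.
by rewrite linearP.
Qed.

Lemma cochains_exact p X Y : findim (cochains (p - 1) X Y) ->
  findim (cocyc (p - 1) X Y) /\
  dimk (cochains (p - 1) X Y) = (dimk (cocyc (p - 1) X Y) + dimk (cobound p X Y))%N.
Proof.
move=> fc.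
have i1 : injective (mk_linear (@zc_lin (p - 1) X Y)).
  by move=> f g /(congr1 (@fam _ _ _ _ _)) /= e; apply: linfamE => o; rewrite e.
have s1 : forall w, exists v, mk_linear (@cb_lin p X Y) v = w.
  move=> w; have [h dh e] := famP w.
  exists (@LinFam k _ _ _ (rdeg_closed (p - 1) X Y) h dh).
  by apply: linfamE => o; rewrite -[LHS]/(rdiff (p - 1) (mkr h) o) mkrE -e.
have e1 : forall v, mk_linear (@cb_lin p X Y) v = 0 <->
    exists x, mk_linear (@zc_lin (p - 1) X Y) x = v.
  move=> v; split=> [e|[x <-]].
    have cv : rdiff (p - 1) (mkr v) = 0.
      by apply: linfamE => o; exact: (congr1 (fun h : cobound p X Y => h o) e).
    by exists (LinFam (rcocycle_closed (p - 1) X Y) (conj (famP v) cv)); apply: linfamE.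
  by apply: linfamE => o; exact: (congr1 (fun h : rhom X Y => h o) (proj2 (famP x))).
split; last exact: dimk_exact fc i1 s1 e1.
have [n hn] := fc; have [a [b [ha _ _]]] := hasdim_exact hn i1 s1 e1.
by exists a.
Qed.

Lemma computes_dim V p X Y : findim (cocyc p X Y) -> computes V p X Y ->
  findim V /\ dimk (cocyc p X Y) = (dimk (cobound p X Y) + dimk V)%N.
Proof.
move=> fz [psi [spsi kpsi]].
have i1 : injective (mk_linear (@bz_lin p X Y)).
  by move=> f g /(congr1 (@fam _ _ _ _ _)) /= e; apply: linfamE => o; rewrite e.
have e1 : forall v, psi v = 0 <-> exists x, mk_linear (@bz_lin p X Y) x = v.
  move=> v; rewrite kpsi; split=> [e|[x <-]]; last exact: (famP x).
  by exists (LinFam (rcoboundary_closed p X Y) e); apply: linfamE.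
split; last exact: dimk_exact fz i1 spsi e1.
have [n hn] := fz; have [a [b [_ hb _]]] := hasdim_exact hn i1 spsi e1.
by exists b.
Qed.

Lemma hasdim_hom a b : hasdim ('Hom('rV[k]_a, 'rV[k]_b) : lmodType k) (a * b).
Proof.
have : hasdim ('Hom('rV[k]_a, 'rV[k]_b) : lmodType k) (dim 'Hom('rV[k]_a, 'rV[k]_b)).
  exists (v2r : {linear 'Hom('rV[k]_a, 'rV[k]_b) -> _}).
  exact: (Bijective (@v2rK _ 'Hom('rV[k]_a, 'rV[k]_b)) (@r2vK _ 'Hom('rV[k]_a, 'rV[k]_b))).
by rewrite /dim /= /dim /= !mul1n.
Qed.

Definition window (N : nat) : seq int := [seq i%:Z - N%:Z | i <- iota 0 (N + N).+1].

Lemma window_uniq N : uniq (window N).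
Proof. by rewrite map_inj_uniq ?iota_uniq // => i j /addIr []. Qed.

Lemma mem_window N n : (n \in window N) = (`|n| <= N%:Z).
Proof.
apply/mapP/idP => [[i]|].
  rewrite mem_iota add0n ltnS => /= hi ->; lia.
move=> h; exists (absz (n + N%:Z)%R); first by rewrite mem_iota add0n ltnS /=; lia.
lia.
Qed.

Definition rk X n i : nat := rdim (X n : rep k Q) i.

Lemma cpx_rk X : exists N : nat, forall n : int, N%:Z < `|n| -> forall i, rk X n i = 0%N.
Proof.
have [N hN] := cpx_zero X; exists (absz N) => n hn i.
have h : hasdim ((X n : rep k Q) i) 0.
  apply: hasdim0; apply: hN; apply: le_lt_trans hn; lia.
apply: hasdim_uniq h; exists (mk_linear (f := id) (fun _ _ _ => erefl)).
by exists id.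
Qed.

Definition cdim p X Y N : nat :=
  \sum_(o : vert Q + arrow Q) \sum_(m <- window N)
    rk X m (osrc o) * rk Y (m + p - odeg o) (otgt o).

Lemma hasdim_cochains p X Y N :
  (forall n : int, N%:Z < `|n| -> forall i, rk X n i = 0%N) ->
  hasdim (cochains p X Y) (cdim p X Y N).
Proof.
move=> hN.
pose I := ((vert Q + arrow Q) * int * int)%type.
pose V (t : I) : lmodType k :=
  'Hom((X t.1.2 : rep k Q) (osrc t.1.1), (Y t.2 : rep k Q) (otgt t.1.1)).
pose s : seq I := [seq (o, m, m + p - odeg o) | o <- enum {: vert Q + arrow Q}, m <- window N].
have us : uniq s.
  apply: allpairs_uniq; [exact: enum_uniq | exact: window_uniq |].
  by move=> [o m] [o' m'] _ _ /= [-> -> _].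
have hs : hasdim (linfam (supported_closed V s))
    (\sum_(t <- s) rk X t.1.2 (osrc t.1.1) * rk Y t.2 (otgt t.1.1)).
  by apply: hasdim_family => // t _; apply: hasdim_hom.
have -> : cdim p X Y N = (\sum_(t <- s) rk X t.1.2 (osrc t.1.1) * rk Y t.2 (otgt t.1.1))%N.
  by rewrite /s big_allpairs_dep big_enum.
have zX m i (x : (X m : rep k Q) i) : m \notin window N -> x = 0.
  rewrite mem_window -ltNge => /hN/(_ i) e.
  by apply/rowP => j; have : (j < rk X m i)%N := ltn_ord j; rewrite e.
have sE o m n : ((o, m, n) \in s) = (m \in window N) && (n == m + p - odeg o).
  apply/allpairsP/andP => [[[o' m'] /= [_ hm [-> -> ->]]] //|[hm /eqP ->]].
  by exists (o, m); split=> //=; rewrite mem_enum.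
pose F (f : linfam (supported_closed V s)) : rhom X Y :=
  mkr (fun o => mkv (fun m n => f (o, m, n) :
    'Hom(vsp (at_vert X (osrc o)) m, vsp (at_vert Y (otgt o)) n))).
have FE f o m n : hv (F f o : vhom (at_vert X (osrc o)) (at_vert Y (otgt o))) m n = f (o, m, n).
  by [].
have Fdeg f : rdeg p (mkr (F f)).
  split=> [i|a] m n e x; rewrite [hv _ _ _]FE (famP f) ?zero_lfunE // sE negb_and.
    by apply/orP; right; apply/eqP => en; apply: e; rewrite en subr0.
  by apply/orP; right; apply/eqP => en; apply: e; rewrite en addrA.
have lF : linear (fun f => @LinFam k _ _ _ (rdeg_closed p X Y) (F f) (Fdeg f)).
  by move=> c f g; apply: linfamE => o; apply: linfamE.
suff b : bijective (mk_linear lF) by apply/(hasdim_iso _ b).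
apply: bij_of_inj_surj => [f g /(congr1 (@fam _ _ _ _ _)) /= e|g].
  apply: linfamE => -[[o m] n].
  have := congr1 (fun h => hv (h o : vhom (at_vert X (osrc o)) (at_vert Y (otgt o))) m n) e.
  by [].
have gP (t : I) : t \notin s ->
    (hv (g t.1.1 : vhom (at_vert X (osrc t.1.1)) (at_vert Y (otgt t.1.1))) t.1.2 t.2 : V t) = 0.
  case: t => -[o m] n; rewrite sE negb_and /= => /orP[hm|/eqP e];
    apply/lfunP => x; rewrite zero_lfunE.
    by rewrite (zX _ _ x hm) linear0.
  have [d1 d2] := famP g; case: o e x => [i|a] e x.
    by apply: d1 => en; apply: e; rewrite en subr0.
  by apply: d2 => en; apply: e; rewrite en addrA.
exists (@LinFam k _ V _ (supported_closed V s) _ gP).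
by apply: linfamE => o; apply: linfamE => -[m n].
Qed.
End Cohomology.

(** * Paths in Dynkin quivers *)

Section Dynkin.

Lemma dynkin_edge_lt T i j : dynkin_valid T -> dynkin_edge T i j -> (i < j)%N.
Proof. by case: T => n /=; lia. Qed.

Lemma dynkin_edge_parent T i i' j : dynkin_valid T ->
  dynkin_edge T i j -> dynkin_edge T i' j -> i = i'.
Proof. by case: T => n /=; lia. Qed.

Variables (Q : quiver) (T : dynkin_type) (e : vert Q -> 'I_(dynkin_rank T)).
Hypotheses (vT : dynkin_valid T) (be : bijective e).
Hypothesis he : forall i j : vert Q,
  #|[set a : arrow Q | ((src a == i) && (tgt a == j)) || ((src a == j) && (tgt a == i))]|
  = dynkin_adj T (e i) (e j) :> nat.

Lemma dynkin_arrow (a : arrow Q) :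
  dynkin_edge T (e (src a)) (e (tgt a)) || dynkin_edge T (e (tgt a)) (e (src a)).
Proof.
have := he (src a) (tgt a); rewrite -/(dynkin_adj T _ _); case: dynkin_adj => // /eqP.
by rewrite cards_eq0 => /eqP/setP/(_ a); rewrite !inE !eqxx.
Qed.

(* The smaller neighbour of a vertex is unique, and there is at most one arrow between two
   vertices: once a path has gone up, it goes up for ever. *)
Lemma dynkin_up (a b : arrow Q) : src b = tgt a ->
  dynkin_edge T (e (src a)) (e (tgt a)) -> dynkin_edge T (e (src b)) (e (tgt b)).
Proof.
move=> sb ea; have /orP[//|eb] := dynkin_arrow b.
have := dynkin_edge_parent vT ea; rewrite -sb => /(_ _ eb)/val_inj/(bij_inj be) sa.
have := he (src a) (tgt a); set A := [set _ | _].
have aA : a \in A by rewrite inE !eqxx.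
have bA : b \in A by rewrite inE sa -sb !eqxx orbT.
have ab : a != b.
  by apply/eqP => ab; have := dynkin_edge_lt vT ea; rewrite -sb ab ltnn.
have : (1 < #|A|)%N by apply/card_gt1P; exists a, b.
by move=> h h'; move: h; rewrite h'; case: dynkin_adj.
Qed.

Lemma dynkin_up_path (a : arrow Q) p i : dynkin_edge T (e (src a)) (e (tgt a)) ->
  ispath p (tgt a) i -> (size p + e (tgt a) < dynkin_rank T)%N.
Proof.
elim: p a => [|b p IH] a ea /=; first by rewrite add0n ltn_ord.
move=> /andP[/eqP sb hp]; have eb := dynkin_up sb ea.
have := IH b eb hp; have := dynkin_edge_lt vT eb; rewrite sb; lia.
Qed.

Lemma dynkin_path p j i : ispath p j i -> (size p <= dynkin_rank T + e j)%N.
Proof.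
elim: p j => [|b p IH] j //= /andP[/eqP <- hp].
have /orP[eb|eb] := dynkin_arrow b.
  by have := dynkin_up_path eb hp; lia.
by have := IH _ hp; have := dynkin_edge_lt vT eb; lia.
Qed.
End Dynkin.

Fixpoint words (A : finType) (n : nat) : seq (seq A) :=
  if n is n'.+1 then [::] :: [seq a :: p | a <- enum A, p <- words A n'] else [:: [::]].

Lemma mem_words (A : finType) n (p : seq A) : (size p <= n)%N -> p \in words A n.
Proof.
elim: n p => [|n IH] [|a p] //= h; rewrite inE; apply/orP; right.
by apply/allpairsP; exists (a, p); split=> //=; [rewrite mem_enum | apply: IH].
Qed.

Lemma dynkin_path_list (Q : quiver) : dynkin Q ->
  exists s : seq (seq (arrow Q)), forall p j i, ispath p j i -> p \in s.
Proof.
move=> [T [vT [e be he]]]; exists (words (arrow Q) (dynkin_rank T + dynkin_rank T)).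
move=> p j i /(dynkin_path vT be he) h; apply: mem_words; apply: leq_trans h _.
by rewrite leq_add2l ltnW.
Qed.

(** * The Euler form *)

Section FiniteSums.

Definition zsum (F : int -> int) : int := \sum_(n \in [set: int]%classic) F n.
Definition finsupp (F : int -> int) := exists N : nat, forall n : int, N%:Z < `|n| -> F n = 0.

Lemma zsum_window F (N M : nat) : (forall n : int, N%:Z < `|n| -> F n = 0) -> (N <= M)%N ->
  zsum F = \sum_(n <- window M) F n.
Proof.
move=> h NM; rewrite /zsum (fsbigE (window M)) ?window_uniq //; last first.
  by move=> n _; rewrite mem_window -ltNge => hn; apply: h; lia.
by apply: eq_bigl => n; rewrite in_setT.
Qed.

Lemma zsumD F G : finsupp F -> finsupp G -> zsum (fun n => F n + G n) = zsum F + zsum G.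
Proof.
move=> [N hN] [M hM].
rewrite (zsum_window hN (leq_maxl N M)) (zsum_window hM (leq_maxr N M)).
rewrite (@zsum_window _ (maxn N M) (maxn N M)) ?big_split // => n h.
by rewrite hN ?hM ?addr0 //; lia.
Qed.

Lemma zsumZ c F : zsum (fun n => c * F n) = c * zsum F.
Proof. by rewrite /zsum mulr_fsumr. Qed.

Lemma zsum_shift c F : zsum (fun n => F (n + c)) = zsum F.
Proof.
rewrite /zsum [RHS](reindex_fsbigT (fun n => n + c)) //.
by exists (fun n => n - c) => n; rewrite (addrK, subrK).
Qed.

Lemma zsum_opp F c : zsum (fun n => F (c - n)) = zsum F.
Proof.
rewrite /zsum [RHS](reindex_fsbigT (fun n => c - n)) //.
by exists (fun n => c - n) => n; rewrite opprB addrC subrK.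
Qed.

Lemma eq_zsum F G : F =1 G -> zsum F = zsum G.
Proof. by move=> FG; rewrite /zsum; apply: eq_fsbigr => n _; apply: FG. Qed.

Lemma fsum_le0 F :
  \sum_(p \in [set i : int | i <= 0]%classic) F p = zsum (fun p => if p <= 0 then F p else 0).
Proof.
rewrite /zsum fsbig_mkcond; apply: eq_fsbigr => p _; rewrite /patch.
case: ifPn => [/set_mem /= -> //|/negP h]; case: ifP => // hp.
by case: h; apply: mem_set.
Qed.

Lemma finsuppD F G : finsupp F -> finsupp G -> finsupp (fun n => F n + G n).
Proof.
move=> [N hN] [M hM]; exists (maxn N M) => n h.
by rewrite hN ?hM ?addr0 //; lia.
Qed.
Lemma finsupp_mul c F : finsupp F -> finsupp (fun n => c n * F n).
Proof. by move=> [N hN]; exists N => n h; rewrite hN // mulr0. Qed.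
Lemma finsupp_shift c F : finsupp F -> finsupp (fun n => F (n + c)).
Proof. by move=> [N hN]; exists (N + absz c)%N => n h; apply: hN; lia. Qed.

Lemma zsum0 : zsum (fun=> 0) = 0.
Proof. by rewrite /zsum fsbig1. Qed.

Lemma finsupp_sum (I : Type) (s : seq I) F :
  (forall i, finsupp (F i)) -> finsupp (fun n => \sum_(i <- s) F i n).
Proof.
move=> h; elim: s => [|i s [N hN]]; first by exists 0%N => n _; rewrite big_nil.
have [M hM] := h i; exists (maxn N M) => n hn.
by rewrite big_cons hM ?hN ?addr0 //; lia.
Qed.

Lemma zsum_sum (I : Type) (s : seq I) F : (forall i, finsupp (F i)) ->
  zsum (fun n => \sum_(i <- s) F i n) = \sum_(i <- s) zsum (F i).
Proof.
move=> h; elim: s => [|i s IH].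
  by rewrite big_nil -[RHS]zsum0; apply: eq_zsum => n; rewrite big_nil.
rewrite big_cons -IH -zsumD //; last exact: finsupp_sum.
by apply: eq_zsum => n; rewrite big_cons.
Qed.

Definition sgi (n : int) : int := (-1) ^ n.
Lemma sgiD m n : sgi (m + n) = sgi m * sgi n.
Proof. by rewrite /sgi exprzDr // unitrN1. Qed.
Lemma sgiN n : sgi (- n) = sgi n.
Proof. by rewrite /sgi -exprz_inv invrN1. Qed.
Lemma sgiM n : sgi n * sgi n = 1.
Proof. by rewrite -{2}[sgi n]sgiN -sgiD subrr. Qed.
End FiniteSums.

Section EulerForm.
Variables (k : fieldType) (Q : quiver).
Local Notation cpxQ := (cpx (rep_cat k Q)).
Local Notation DQ := (Db k Q).
Implicit Types X Y : cpxQ.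

Lemma computes_transport V p q X Y X' Y' (T : {linear rhom X Y -> rhom X' Y'}) c :
  c != 0 -> injective T -> (forall g, exists f, T f = g) ->
  (forall f, rdeg q f <-> rdeg p (T f)) -> (forall f, rdeg (q - 1) f <-> rdeg (p - 1) (T f)) ->
  (forall f, rdiff p (T f) = c *: T (rdiff q f)) ->
  (forall f, rdiff (p - 1) (T f) = c *: T (rdiff (q - 1) f)) ->
  @computes k Q V p X' Y' -> computes V q X Y.
Proof.
move=> c0 Ti Ts dT dT1 DT DT1 [psi [ps pk]].
have zP (f : cocyc q X Y) : rdeg p (mkr (T (mkr f))) /\ rdiff p (mkr (T (mkr f))) = 0.
  rewrite mkrE DT (proj2 (famP f)) linear0 scaler0; split=> //.
  by apply/dT; apply: (proj1 (famP f)).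
pose t (f : cocyc q X Y) : cocyc p X' Y' := LinFam (rcocycle_closed p X' Y') (zP f).
have tl : linear t.
  move=> a f g; apply: linfamE => o.
  rewrite -[LHS]/(T (mkr (a *: f + g)) o).
  rewrite [mkr _](_ : _ = a *: mkr f + mkr g); last by apply: linfamE.
  by rewrite linearP.
have exT f : rexact q f <-> rexact p (T f).
  split=> -[h dh e].
    exists (c^-1 *: T h).
      by rewrite -[c^-1 *: _]addr0; apply: rdeg_lin; [apply/dT1 | apply: rdeg0].
    by rewrite linearZ /= DT1 scalerA mulVf // scale1r e.
  have [h' eh] := Ts h; subst h; exists (c *: h').
    by rewrite -[c *: _]addr0; apply: rdeg_lin; [apply/dT1 | apply: rdeg0].
  by apply: Ti; rewrite linearZ linearZ /= -DT1.
exists (psi \o mk_linear tl); split=> [v|z].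
  have [z <-] := ps v; have [f ef] := Ts (mkr z).
  have hf : rdeg q (mkr f) /\ rdiff q (mkr f) = 0.
    have [dz cz] := famP z; rewrite mkrE; split; first by apply/dT; rewrite ef.
    apply: Ti; apply: (scalerI c0); rewrite -DT ef cz linear0 scaler0 //.
  exists (LinFam (rcocycle_closed q X Y) hf); congr (psi _); apply: linfamE => o.
  by rewrite -[LHS]/(T (mkr f) o) mkrE ef.
have := pk (t z); rewrite -[mkr (t z)]/(mkr (T (mkr z))) mkrE.
by rewrite exT.
Qed.

Lemma shift_family (T : int -> Type) r (f : forall n, T (n + r)) :
  exists F : forall n, T n, forall n, F (n + r) = f n.
Proof.
exists (fun n => eq_rect _ T (f (n - r)) n (subrK r n)) => n.
have h n0 (e : n0 + r = n + r) : eq_rect _ T (f n0) _ e = f n.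
  have en := addIr r e; subst n0.
  by rewrite (eq_irrelevance e erefl).
exact: h.
Qed.

Section ShiftRight.
Variables (X Y : cpxQ) (r : int).

(* Since the differential of [shift Y r] carries the sign [sg k r], the sign at the arrows makes
   the differentials agree up to a global sign, see [rdiff_shiftr]. *)
Definition shiftr_fun (f : rhom X Y) : rhom X (shift Y r) :=
  mkr (fun o => match o return rhom_sp X (shift Y r) o with
    | inl i => mkv (fun m n => hv (rv f i) m (n + r) :
        'Hom(vsp (at_vert X i) m, vsp (at_vert (shift Y r) i) n))
    | inr a => mkv (fun m n => sg k r *: hv (ra f a) m (n + r) :
        'Hom(vsp (at_vert X (src a)) m, vsp (at_vert (shift Y r) (tgt a)) n))
    end).

Lemma shiftr_v f i m n x : hv (rv (shiftr_fun f) i) m n x = hv (rv f i) m (n + r) x.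
Proof. by []. Qed.
Lemma shiftr_a f a m n x : hv (ra (shiftr_fun f) a) m n x = sg k r *: hv (ra f a) m (n + r) x.
Proof. by rewrite [hv _ _ _]/(sg k r *: hv (ra f a) m (n + r)) scale_lfunE. Qed.

Lemma shiftr_lin : linear shiftr_fun.
Proof.
move=> c f g; apply: rhom_eq => [i|a]; apply: hv_eq => m n x.
  by rewrite -[LHS]/(hv (rv (c *: f + g) i) m (n + r) x) !rv_lin !hv_lin.
by rewrite shiftr_a !ra_lin !hv_lin !shiftr_a scalerDr !scalerA mulrC.
Qed.

Lemma sg_neq0 p : sg k p != 0.
Proof. by apply/eqP => e; have := sgM k p; rewrite e mul0r => /eqP; rewrite eq_sym oner_eq0. Qed.

Lemma vd_shift (Z : cpxQ) s i m n x : vd (at_vert (shift Z s) i) m n x =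
  sg k s *: dv Z (m + s) (n + s) i x.
Proof. by rewrite [vd _ _ _]/(sg k s *: dv Z (m + s) (n + s) i) scale_lfunE. Qed.

Lemma vdeg_shiftr (A C C' : vcpx k) q (f : vhom A C) (g : vhom A C') :
  (forall m n, (forall x, hv f m (n + r) x = 0) <-> (forall x, hv g m n x = 0)) ->
  vdeg (q + r) f <-> vdeg q g.
Proof.
move=> h; split=> d m n e.
  by apply/h; apply: d => en; apply: e; apply: (addIr r); rewrite en addrA.
rewrite -[n](subrK r); apply/h; apply: d => en; apply: e.
by rewrite -[n](subrK r) en addrA.
Qed.

Lemma rdeg_shiftr q f : rdeg (q + r) f <-> rdeg q (shiftr_fun f).
Proof.
have hv_ i : vdeg (q + r) (rv f i) <-> vdeg q (rv (shiftr_fun f) i).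
  by apply: vdeg_shiftr => m n; split=> h x; exact: h.
have ha a : vdeg (q - 1 + r) (ra f a) <-> vdeg (q - 1) (ra (shiftr_fun f) a).
  apply: vdeg_shiftr => m n; split=> h x; first by rewrite shiftr_a h scaler0.
  by apply: (scalerI (sg_neq0 r)); rewrite -shiftr_a h scaler0.
rewrite /rdeg [q + r - 1]addrAC.
by split=> -[h1 h2]; split=> [i|a]; [apply/hv_ | apply/ha | apply/hv_ | apply/ha].
Qed.

Lemma rdiff_shiftr q f : rdiff q (shiftr_fun f) = sg k r *: shiftr_fun (rdiff (q + r) f).
Proof.
apply: rhom_eq => [i|a]; apply: hv_eq => m n x.
  have -> : hv (rv (sg k r *: shiftr_fun (rdiff (q + r) f)) i) m n x =
      sg k r *: hv (delta (q + r) (rv f i)) m (n + r) x by rewrite [LHS]scale_lfunE.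
  rewrite rdiff_v !deltaE vd_shift scalerBr scalerA sgD mulrCA sgM mulr1.
  rewrite -[hv (rv (shiftr_fun f) i) m (n - 1) x]/(hv (rv f i) m (n - 1 + r) x).
  by rewrite [n - 1 + r]addrAC.
have -> : hv (ra (sg k r *: shiftr_fun (rdiff (q + r) f)) a) m n x =
    hv (ra (rdiff (q + r) f) a) m (n + r) x.
  by rewrite [LHS]scale_lfunE shiftr_a scalerA sgM scale1r.
rewrite !rdiff_a !hvB !deltaE !postE !preE !shiftr_a vd_shift.
rewrite linearZ /= !scalerA sgM scale1r sgB1 [q + r - 1]addrAC sgD sgB1.
by rewrite [n - 1 + r]addrAC.
Qed.

Lemma shiftr_inj : injective shiftr_fun.
Proof.
move=> f g e; apply: rhom_eq => [i|a]; apply: hv_eq => m n x; rewrite -[n](subrK r).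
  by rewrite -!shiftr_v e.
by apply: (scalerI (sg_neq0 r)); rewrite -!shiftr_a e.
Qed.

Lemma shiftr_surj g : exists f, shiftr_fun f = g.
Proof.
have /dep_choice[F HF] : forall i, exists F : vhom (at_vert X i) (at_vert Y i),
    forall m n, hv F m (n + r) = hv (rv g i) m n.
  move=> i; have /dep_choice[F HF] m := @shift_family
    (fun n => 'Hom(vsp (at_vert X i) m, vsp (at_vert Y i) n)) r (fun n => hv (rv g i) m n).
  by exists (mkv F).
have /dep_choice[G HG] : forall a, exists F : vhom (at_vert X (src a)) (at_vert Y (tgt a)),
    forall m n, hv F m (n + r) = sg k r *: hv (ra g a) m n.
  move=> a; have /dep_choice[G HG] m := @shift_family
    (fun n => 'Hom(vsp (at_vert X (src a)) m, vsp (at_vert Y (tgt a)) n)) r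
    (fun n => sg k r *: hv (ra g a) m n).
  by exists (mkv G).
exists (mkr (fun o => match o return rhom_sp X Y o with inl i => F i | inr a => G a end)).
apply: rhom_eq => [i|a]; apply: hv_eq => m n x.
  by rewrite -[LHS]/(hv (F i) m (n + r) x) HF.
by rewrite shiftr_a -[ra (mkr _) _]/(G a) HG scale_lfunE scalerA sgM scale1r.
Qed.

Lemma computes_shiftr V p : computes V p X (shift Y r) -> computes V (p + r) X Y.
Proof.
have e : p + r - 1 = p - 1 + r by rewrite addrAC.
apply: (computes_transport (T := mk_linear shiftr_lin) (sg_neq0 r)).
- exact: shiftr_inj.
- exact: shiftr_surj.
- by move=> f; apply: rdeg_shiftr.
- by move=> f; rewrite e; apply: rdeg_shiftr.
- by move=> f; apply: rdiff_shiftr.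
- by move=> f; rewrite e; apply: rdiff_shiftr.
Qed.
End ShiftRight.

Section ShiftLeft.
Variables (X Y : cpxQ) (s : int).

Definition shiftl_fun (f : rhom X Y) : rhom (shift X s) Y :=
  mkr (fun o => mkv (fun m n =>
    hv (f o : vhom (at_vert X (osrc o)) (at_vert Y (otgt o))) (m + s) n :
        'Hom(vsp (at_vert (shift X s) (osrc o)) m, vsp (at_vert Y (otgt o)) n))).

Lemma shiftl_v f i m n x : hv (rv (shiftl_fun f) i) m n x = hv (rv f i) (m + s) n x.
Proof. by []. Qed.
Lemma shiftl_a f a m n x : hv (ra (shiftl_fun f) a) m n x = hv (ra f a) (m + s) n x.
Proof. by []. Qed.

Lemma shiftl_lin : linear shiftl_fun.
Proof. by move=> c f g; apply: rhom_eq => [i|a]; apply: hv_eq. Qed.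

Lemma vdeg_shiftl (A A' C : vcpx k) q (f : vhom A C) (g : vhom A' C) :
  (forall m n, (forall x, hv f (m + s) n x = 0) <-> (forall x, hv g m n x = 0)) ->
  vdeg (q - s) f <-> vdeg q g.
Proof.
move=> h; split=> d m n e.
  by apply/h; apply: d => en; apply: e; rewrite en addrACA subrr addr0.
rewrite -[m](subrK s); apply/h; apply: d => en; apply: e.
by rewrite en addrAC addrA.
Qed.

Lemma rdeg_shiftl q f : rdeg (q - s) f <-> rdeg q (shiftl_fun f).
Proof.
have hv_ i : vdeg (q - s) (rv f i) <-> vdeg q (rv (shiftl_fun f) i).
  by apply: vdeg_shiftl => m n; split=> h x; exact: h.
have ha a : vdeg (q - 1 - s) (ra f a) <-> vdeg (q - 1) (ra (shiftl_fun f) a).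
  by apply: vdeg_shiftl => m n; split=> h x; exact: h.
rewrite /rdeg [q - s - 1]addrAC.
by split=> -[h1 h2]; split=> [i|a]; [apply/hv_ | apply/ha | apply/hv_ | apply/ha].
Qed.

Lemma rdiff_shiftl q f : rdiff q (shiftl_fun f) = 1 *: shiftl_fun (rdiff (q - s) f).
Proof.
rewrite scale1r; apply: rhom_eq => [i|a]; apply: hv_eq => m n x.
  rewrite -[RHS]/(hv (delta (q - s) (rv f i)) (m + s) n x).
  rewrite rdiff_v !deltaE vd_shift.
  rewrite -[hv (rv (shiftl_fun f) i) (m + 1) n _]/(hv (rv f i) (m + 1 + s) n _).
  rewrite [hv (rv f i) (m + 1 + s) n _]linearZ scalerA sgD sgN.
  by rewrite [m + 1 + s]addrAC.
rewrite -[RHS]/(hv (ra (rdiff (q - s) f) a) (m + s) n x).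
rewrite !rdiff_a !hvB !deltaE !postE !preE [vd (at_vert (shift X s) _) _ _ _]vd_shift.
rewrite -[hv (ra (shiftl_fun f) a) (m + 1) n _]/(hv (ra f a) (m + 1 + s) n _).
rewrite [hv (ra f a) (m + 1 + s) n _]linearZ scalerA.
have es : sg k (q - s - 1) = sg k (q - 1) * sg k s.
  by rewrite [q - s - 1]addrAC (sgD k (q - 1) (- s)) (sgN k s).
by rewrite [m + 1 + s]addrAC es.
Qed.

Lemma shiftl_inj : injective shiftl_fun.
Proof.
move=> f g e; apply: rhom_eq => [i|a]; apply: hv_eq => m n; rewrite -[m](subrK s) => x.
  by rewrite -!shiftl_v e.
by rewrite -!shiftl_a e.
Qed.

Lemma shiftl_surj g : exists f, shiftl_fun f = g.
Proof.
have /dep_choice[F HF] : forall o : edge Q,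
    exists F : vhom (at_vert X (osrc o)) (at_vert Y (otgt o)),
    forall n m, hv F (m + s) n =
      hv (g o : vhom (at_vert (shift X s) (osrc o)) (at_vert Y (otgt o))) m n.
  move=> o; have /dep_choice[F HF] n := @shift_family
    (fun m => 'Hom(vsp (at_vert X (osrc o)) m, vsp (at_vert Y (otgt o)) n)) s
    (fun m => hv (g o : vhom (at_vert (shift X s) (osrc o)) (at_vert Y (otgt o))) m n).
  by exists (mkv (fun m n => F n m)).
exists (mkr F); apply: linfamE => o; apply: hv_eq => m n x.
by rewrite -[LHS]/(hv (F o) (m + s) n x) HF.
Qed.

Lemma computes_shiftl V p : computes V p (shift X s) Y -> computes V (p - s) X Y.
Proof.
have e : p - s - 1 = p - 1 - s by rewrite addrAC.
apply: (computes_transport (T := mk_linear shiftl_lin) (oner_neq0 k)).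
- exact: shiftl_inj.
- exact: shiftl_surj.
- by move=> f; apply: rdeg_shiftl.
- by move=> f; rewrite e; apply: rdeg_shiftl.
- by move=> f; apply: rdiff_shiftl.
- by move=> f; rewrite e; apply: rdiff_shiftl.
Qed.
End ShiftLeft.

Section WithPaths.
Variable path_list : seq (seq (arrow Q)).
Hypothesis path_listP : forall p j i, @ispath Q p j i -> p \in path_list.

Lemma computes_hom X Y : computes (Defs.hom DQ X Y) 0 X Y.
Proof.
have cz (z : cocyc 0 X Y) : rclosed (mkr z) := famP z.
have lp : linear (fun z : cocyc 0 X Y => psi path_listP (cz z)).
  move=> c f g; have h := rclosed_lin c (cz f) (cz g).
  rewrite -(psi_lin path_listP (cz f) (cz g) h); apply: psi_ext.
  by apply: linfamE.
exists (mk_linear lp); split=> [v|z].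
  have [z [h <-]] := psi_surj path_listP v.
  exists (LinFam (rcocycle_closed 0 X Y) (h : rdeg 0 (mkr z) /\ rdiff 0 (mkr z) = 0)).
  by apply: psi_ext; rewrite mkrE.
by split; [apply: psi_inj | apply: psi_exact].
Qed.

Lemma findim_cochains p X Y : findim (cochains p X Y).
Proof. by have [N hN] := cpx_rk X; exists (cdim p X Y N); apply: hasdim_cochains. Qed.

Lemma findim_cocyc p X Y : findim (cocyc p X Y).
Proof.
have [] := @cochains_exact k Q (p + 1) X Y; rewrite addrK //.
exact: findim_cochains.
Qed.

Lemma computes_uniq V V' p X Y : computes V p X Y -> computes V' p X Y -> dimk V = dimk V'.
Proof.
move=> h h'; have [_ e] := computes_dim (findim_cocyc p X Y) h.
have [_ e'] := computes_dim (findim_cocyc p X Y) h'.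
by apply/eqP; rewrite -(eqn_add2l (dimk (cobound p X Y))) -e -e'.
Qed.

Lemma computes_shift_hom X Y s r :
  computes (Defs.hom DQ (shift X s) (shift Y r)) (r - s) X Y.
Proof.
by have := computes_shiftl (computes_shiftr (computes_hom (shift X s) (shift Y r))); rewrite add0r.
Qed.

Lemma computes_hdim X Y r : computes (Defs.hom DQ X (shift Y r)) r X Y.
Proof. by have := computes_shiftr (computes_hom X (shift Y r)); rewrite add0r. Qed.

Lemma findim_dbhom X Y : findim (Defs.hom DQ X Y).
Proof. exact: (computes_dim (findim_cocyc 0 X Y) (computes_hom X Y)).1. Qed.

(* Only the compatibility of [Hom] with simultaneous shifts is used: the functor [nu] is not
   shown to commute with the shift. *)
Lemma hdim_serre (nu : serre_functor DQ) X Y j :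
  hdim (Y : DQ) (ar_translation nu X) j = hdim (X : DQ) Y (1 - j).
Proof.
rewrite /hdim; set W := ar_translation nu X.
have -> : dimk (Defs.hom DQ Y (shift W j)) = dimk (Defs.hom DQ (shift Y (- j)) W).
  apply: (computes_uniq (computes_hdim Y W j)).
  by have := computes_shiftl (computes_hom (shift Y (- j)) W); rewrite add0r opprK.
have e := dimk_iso (f := mk_linear (@serre_iso_lin k DQ nu (shift X (- 1)) (shift Y (- j))))
  (@serre_iso_bij k DQ nu (shift X (- 1)) (shift Y (- j))).
rewrite [LHS]e (hasdim_dimk (hasdim_dual (findim_dimk (findim_dbhom _ _)))).
apply: computes_uniq (computes_hdim X Y (1 - j)).
by have := computes_shift_hom X Y (- 1) (- j); rewrite opprK addrC.
Qed.

Definition zdim p X Y : int := (dimk (cocyc p X Y))%:Z.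
Definition kdim p X Y : int := (dimk (cochains p X Y))%:Z.

Lemma hdimE X Y p :
  (hdim (X : DQ) Y p)%:Z = zdim p X Y + zdim (p - 1) X Y - kdim (p - 1) X Y.
Proof.
have [_ e] := computes_dim (findim_cocyc p X Y) (computes_hdim X Y p).
have [_ e'] := cochains_exact (findim_cochains (p - 1) X Y).
have h (a b c d f : nat) : d = (b + a)%N -> f = (c + b)%N -> a%:Z = d%:Z + c%:Z - f%:Z by lia.
exact: h e e'.
Qed.

Lemma kdimE p X Y N : (forall n : int, N%:Z < `|n| -> forall i, rk X n i = 0%N) ->
  kdim p X Y = (cdim p X Y N)%:Z.
Proof. by move=> hN; rewrite /kdim (hasdim_dimk (hasdim_cochains p Y hN)). Qed.

Lemma finsupp_rk X i : finsupp (fun n => (rk X n i)%:Z).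
Proof. by have [N hN] := cpx_rk X; exists N => n /hN ->. Qed.

Lemma sum_cdim X Y N p : sgi p * (cdim p X Y N)%:Z =
  \sum_(o : vert Q + arrow Q) \sum_(m <- window N)
    (rk X m (osrc o))%:Z * sgi (m - odeg o) *
    (sgi (m + p - odeg o) * (rk Y (m + p - odeg o) (otgt o))%:Z).
Proof.
have zs (I : Type) (r : seq I) (F : I -> nat) :
    ((\sum_(i <- r) F i)%N)%:Z = \sum_(i <- r) (F i)%:Z :> int.
  by elim: r => [|i r IH]; rewrite ?big_nil // !big_cons PoszD IH.
rewrite /cdim zs mulr_sumr; apply: eq_bigr => o _.
rewrite zs mulr_sumr; apply: eq_bigr => m _.
have -> : sgi (m + p - odeg o) = sgi (m - odeg o) * sgi p by rewrite -sgiD addrAC.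
rewrite PoszM -[LHS]mul1r -(sgiM (m - odeg o)).
by move: (sgi _) (sgi _) (Posz _) (Posz _) => a b c d; ring.
Qed.

Definition dimvec_pairing X N (d : {ffun vert Q -> int}) : int :=
  \sum_(o : vert Q + arrow Q) \sum_(m <- window N)
    (rk X m (osrc o))%:Z * sgi (m - odeg o) * d (otgt o).

Lemma zsum_cdim X Y N :
  zsum (fun p => sgi p * (cdim p X Y N)%:Z) = dimvec_pairing X N (dimvect (Y : DQ)).
Proof.
pose F (o : vert Q + arrow Q) m p : int := (rk X m (osrc o))%:Z * sgi (m - odeg o) *
    (sgi (m + p - odeg o) * (rk Y (m + p - odeg o) (otgt o))%:Z).
have fF o m : finsupp (F o m).
  apply: (finsupp_mul (fun=> _)).
  have := finsupp_shift (m - odeg o) (finsupp_mul sgi (finsupp_rk Y (otgt o))).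
  by move=> [M hM]; exists M => n /hM; rewrite addrA [n + m]addrC.
rewrite (eq_zsum (sum_cdim X Y N)) zsum_sum => [|o]; last by apply: finsupp_sum => m; apply: fF.
apply: eq_bigr => o _; rewrite zsum_sum => [|m]; last exact: fF.
apply: eq_bigr => m _; rewrite zsumZ ffunE; congr (_ * _).
rewrite -[RHS](zsum_shift (m - odeg o) (fun n => sgi n * (rk Y n (otgt o))%:Z)).
by apply: eq_zsum => n; rewrite addrA [n + m]addrC.
Qed.

Lemma finsupp_kdim X Y : finsupp (fun p => kdim p X Y).
Proof.
have [N hN] := cpx_rk X; have [M hM] := cpx_rk Y; exists (N + M + 1)%N => p hp.
rewrite (kdimE _ _ hN) /cdim big1 // => o _; rewrite big_seq big1 // => m.
rewrite mem_window => hm; rewrite [rk Y _ _]hM ?muln0 //.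
by case: o => ? /=; lia.
Qed.

Lemma finsupp_zdim X Y : finsupp (fun p => zdim p X Y).
Proof.
have [N hN] := finsupp_kdim X Y; exists N => p /hN; rewrite /kdim /zdim.
have [_] := @cochains_exact k Q (p + 1) X Y (findim_cochains _ X Y); rewrite addrK => ->.
by lia.
Qed.

Lemma euler_hdim X Y N : (forall n : int, N%:Z < `|n| -> forall i, rk X n i = 0%N) ->
  zsum (fun p => sgi p * (hdim (X : DQ) Y p)%:Z) = dimvec_pairing X N (dimvect (Y : DQ)).
Proof.
move=> hN; rewrite -zsum_cdim.
pose Z p := sgi p * zdim p X Y; pose K p := sgi p * kdim p X Y.
have fZ : finsupp Z := finsupp_mul sgi (finsupp_zdim X Y).
have fK : finsupp K := finsupp_mul sgi (finsupp_kdim X Y).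
have fZ' : finsupp (fun p => - 1 * Z (p - 1)).
  by apply: (finsupp_mul (fun=> _)); apply: (finsupp_shift (- 1)).
have fK' := finsupp_shift (- 1) fK.
have e p : sgi p = - 1 * sgi (p - 1).
  by have s1 : sgi (- 1) = - 1 by []; rewrite sgiD s1; ring.
transitivity (zsum (fun p => Z p + (- 1 * Z (p - 1) + K (p - 1)))).
  apply: eq_zsum => p; by rewrite hdimE /Z /K (e p); ring.
rewrite zsumD //; last exact: finsuppD.
rewrite zsumD // zsumZ (zsum_shift (- 1) Z) (zsum_shift (- 1) K) addrA mulN1r subrr add0r.
by apply: eq_zsum => p; rewrite /K (kdimE _ _ hN).
Qed.

Lemma finsupp_hdim X Y : finsupp (fun p => (hdim (X : DQ) Y p)%:Z).
Proof.
have [N hN] := finsuppD (finsupp_zdim X Y) (finsuppD (finsupp_shift (- 1) (finsupp_zdim X Y))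
  (finsupp_mul (fun=> - 1) (finsupp_shift (- 1) (finsupp_kdim X Y)))).
by exists N => p /hN; rewrite hdimE mulN1r addrA.
Qed.

Lemma pairing_tau (nu : serre_functor DQ) X Y N :
  (forall n : int, N%:Z < `|n| -> forall i, rk X n i = 0%N) ->
  pairing (X : DQ) Y - pairing (Y : DQ) (ar_translation nu X) =
  dimvec_pairing X N (dimvect (Y : DQ)).
Proof.
move=> hN; rewrite -(euler_hdim Y hN).
pose H p := (hdim (X : DQ) Y p)%:Z.
have fH : finsupp H := finsupp_hdim X Y.
have E1 : pairing (X : DQ) Y = zsum (fun p => (if p <= 0 then sgi p else 0) * H p).
  by rewrite /pairing fsum_le0; apply: eq_zsum => p; case: ifP; rewrite ?mul0r.
have E2 : pairing (Y : DQ) (ar_translation nu X) =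
    zsum (fun p => - 1 * ((if p <= 0 then 0 else sgi p) * H p)).
  rewrite -(zsum_opp _ 1) /pairing fsum_le0; apply: eq_zsum => p; rewrite hdim_serre -/(H (1 - p)).
  have -> : (1 - p <= 0) = ~~ (p <= 0) by lia.
  case: (p <= 0); rewrite /= ?mul0r ?mulr0 // sgiD sgiN (_ : sgi 1 = - 1) //; ring.
rewrite E1 E2 zsumZ mulN1r opprK -zsumD; try exact: finsupp_mul.
by apply: eq_zsum => p; case: ifP; rewrite mul0r ?addr0 ?add0r.
Qed.
End WithPaths.
End EulerForm.

Theorem lemma2p9 (k : closedFieldType) (Q : quiver) (hQ : dynkin Q)
    (nu : serre_functor (Db k Q)) (X M N : Db k Q) (hMN : dimvect M = dimvect N) :
  pairing X N - pairing X M =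
  pairing N (ar_translation nu X) - pairing M (ar_translation nu X).
Proof.
have [s path_s] := dynkin_path_list hQ; have [B hB] := cpx_rk X.
have eN := pairing_tau path_s nu N hB; have eM := pairing_tau path_s nu M hB.
move: eN eM; rewrite hMN => <- /eqP; rewrite subr_eq => /eqP ->.
by rewrite opprD opprB addrA [X in X - _]addrC subrK.
Qed.
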